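(* Let $b$ be a connected graph over $X$ and let $q:X\to\mathbb{R}$ be a potential such that $h\ge0$ on $C_c(X)$. Then the following are equivalent: (i) $h$ is critical in $X$. (ii) $\lim_{\lambda\nearrow0}(H^{(1)}-\lambda)^{-1}1_{\{x\}}(y)=\infty$ for some (equivalently, all) $x,y\in X$. (ii') $\lim_{t\to\infty}\int_0^t e^{-sH^{(1)}}1_{\{x\}}(y)\,\mathrm{d}s=\infty$ for some (equivalently, all) $x,y\in X$. (iii) There is a unique positive $H$-superharmonic function in $X$ (up to linear dependence). (iii') There are only finitely many linearly independent positive $H$-superharmonic functions in $X$. (iv) For any $o\in X$ and $c>0$ there is a null-sequence $(e_n)$ of $h$ such that $e_n(o)=c$ for all $n$. (iv') There exist a positive $H$-harmonic function $v$ in $X$ and a null-sequence $(e_n)$ of $h$ satisfying $0\le e_n\le v$ and $e_n(x)\to v(x)$ for all $x\in X$. (v) $\mathrm{cap}_h(\{x\}):=\inf\{h(\varphi)\mid\varphi\in C_c(X),\ \varphi(x)=1\}=0$ for all $x\in X$. In particular, if one of the equivalent conditions holds true, then the unique (up to linear dependence) positive $H$-superharmonic function on $X$ is $H$-harmonic.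
   Context: $X$ is an infinite set with the discrete topology. A graph over $X$ is a symmetric function $b:X\times X\to[0,\infty)$ with zero diagonal such that $\sum_{y\in X}b(x,y)<\infty$ for all $x\in X$; it is connected if any two vertices are joined by a finite path $x_0,\dots,x_n$ with $b(x_i,x_{i+1})>0$. $C(X)$ is the space of real valued functions on $X$ and $C_c(X)$ the subspace of finitely supported functions. Let $F(X)=\{f\in C(X)\mid \sum_{y}b(x,y)|f(y)|<\infty \text{ for all } x\in X\}$, and for $f\in F(X)$ let $Hf(x)=\sum_{y}b(x,y)(f(x)-f(y))+q(x)f(x)$. The form $h$ on $C_c(X)$ is $h(\varphi)=\frac12\sum_{x,y}b(x,y)(\varphi(x)-\varphi(y))^2+\sum_x q(x)\varphi(x)^2$; $h\ge0$ on $C_c(X)$ means $h(\varphi)\ge0$ for all $\varphi\in C_c(X)$. A function $f$ is called positive if $f\ge0$ and $f\ne0$. A function $u\in F(X)$ is $H$-harmonic (resp. $H$-superharmonic) in $X$ if $Hu=0$ (resp. $Hu\ge0$) on $X$. If $h\ge0$ on $C_c(X)$, then $h$ is closable in $\ell^2(X)=\ell^2(X,1)$ (counting measure), and $H^{(1)}$ denotes the nonnegative selfadjoint operator in $\ell^2(X)$ associated with its closure. A form $h\ge0$ on $C_c(X)$ is subcritical in $X$ if there is a positive $w\in C(X)$ such that $h-w\ge0$ on $C_c(X)$, i.e. $h(\varphi)\ge\sum_x w(x)\varphi(x)^2$ for all $\varphi\in C_c(X)$; otherwise $h$ is critical in $X$. A null-sequence of $h$ is a sequence $(e_n)$ of positive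 functions in $C_c(X)$ for which there are $o\in X$ and $c>0$ with $e_n(o)=c$ for all $n$, and $h(e_n)\to0$. *)

(* Defs.v *)
From mathcomp Require Import all_boot all_order all_algebra.
From mathcomp Require Import all_classical all_reals all_analysis.
Import Order.TTheory GRing.Theory Num.Theory.
Import numFieldNormedType.Exports.

Set Implicit Arguments.
Unset Strict Implicit.
Unset Printing Implicit Defensive.

Local Open Scope classical_set_scope.
Local Open Scope ring_scope.

(* The discrete set X is a choiceType, as required by \esum; classically this
   is no restriction, since every type carries such a structure. *)

(* Sum of an absolutely summable real family; the value is only meaningful when
   [abs_summable f] holds. *)
Definition abs_summable (R : realType) (X : choiceType) (f : X -> R) : Prop :=
  summable [set: X] (EFin \o f).

Definition rsum (R : realType) (X : choiceType) (f : X -> R) : R :=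
  fine (\esum_(x in [set: X]) ((EFin \o f)^\+ x)%E)
  - fine (\esum_(x in [set: X]) ((EFin \o f)^\- x)%E).

Definition finsupp_fun (R : realType) (X : choiceType) (f : X -> R) : Prop :=
  finite_set [set x | f x <> 0].

Definition positive_fun (R : realType) (X : choiceType) (f : X -> R) : Prop :=
  (forall x, 0 <= f x) /\ (exists x, f x <> 0).

Definition lin_indep (R : realType) (X : choiceType) (n : nat)
    (u : 'I_n -> X -> R) : Prop :=
  forall a : 'I_n -> R,
    (forall x, \sum_(i < n) a i * u i x = 0) -> forall i, a i = 0.

Definition is_graph (R : realType) (X : choiceType) (b : X -> X -> R) : Prop :=
  [/\ forall x y, 0 <= b x y,
      forall x y, b x y = b y x,
      forall x, b x x = 0
    & forall x, abs_summable (b x)].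

Definition graph_connected (R : realType) (X : choiceType) (b : X -> X -> R) :
    Prop :=
  forall x y : X,
    exists2 s : seq X, path (fun z w => 0 < b z w) x s & last x s = y.

(* Used on finitely supported functions only: there the double sum is finite
   and the potential term has finitely many nonzero summands. *)
Definition hform (R : realType) (X : choiceType) (b : X -> X -> R) (q : X -> R)
    (phi : X -> R) : R :=
  2^-1 * fine (\esum_(p in [set: X * X])
                 (b p.1 p.2 * (phi p.1 - phi p.2) ^+ 2)%:E)
  + \sum_(x \in [set: X]) q x * phi x ^+ 2.

Definition hform_ge0 (R : realType) (X : choiceType) (b : X -> X -> R)
    (q : X -> R) : Prop :=
  forall phi, finsupp_fun phi -> 0 <= hform b q phi.

Definition in_F (R : realType) (X : choiceType) (b : X -> X -> R) (f : X -> R) :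
    Prop :=
  forall x, abs_summable (fun y => b x y * f y).

Definition formalH (R : realType) (X : choiceType) (b : X -> X -> R)
    (q : X -> R) (f : X -> R) (x : X) : R :=
  rsum (fun y => b x y * (f x - f y)) + q x * f x.

Definition H_harmonic (R : realType) (X : choiceType) (b : X -> X -> R)
    (q : X -> R) (u : X -> R) : Prop :=
  in_F b u /\ forall x, formalH b q u x = 0.

Definition H_superharmonic (R : realType) (X : choiceType) (b : X -> X -> R)
    (q : X -> R) (u : X -> R) : Prop :=
  in_F b u /\ forall x, 0 <= formalH b q u x.

Definition h_subcritical (R : realType) (X : choiceType) (b : X -> X -> R)
    (q : X -> R) : Prop :=
  exists w : X -> R, positive_fun w /\
    forall phi, finsupp_fun phi ->
      \sum_(x \in [set: X]) w x * phi x ^+ 2 <= hform b q phi.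

Definition h_critical (R : realType) (X : choiceType) (b : X -> X -> R)
    (q : X -> R) : Prop := ~ h_subcritical b q.

Definition null_sequence (R : realType) (X : choiceType) (b : X -> X -> R)
    (q : X -> R) (e : nat -> X -> R) : Prop :=
  [/\ forall n, finsupp_fun (e n) /\ positive_fun (e n),
      exists (o : X) (c : R), 0 < c /\ forall n, e n o = c
    & hform b q (e n) @[n --> \oo] --> (0 : R)].

Definition hcap (R : realType) (X : choiceType) (b : X -> X -> R) (q : X -> R)
    (x : X) : R :=
  inf [set hform b q phi | phi in [set phi | finsupp_fun phi /\ phi x = 1]].

Definition ell2 (R : realType) (X : choiceType) (f : X -> R) : Prop :=
  abs_summable (fun x => f x ^+ 2).

Definition inner2 (R : realType) (X : choiceType) (f g : X -> R) : R :=
  rsum (fun x => f x * g x).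

Definition norm2 (R : realType) (X : choiceType) (f : X -> R) : R :=
  Num.sqrt (inner2 f f).

Definition closure_approx (R : realType) (X : choiceType) (b : X -> X -> R)
    (q : X -> R) (u : X -> R) (phi : nat -> X -> R) : Prop :=
  [/\ ell2 u, forall n, finsupp_fun (phi n),
      norm2 (fun x => phi n x - u x) @[n --> \oo] --> (0 : R)
    & forall eps : R, 0 < eps ->
        exists N, forall n m, (N <= n)%N -> (N <= m)%N ->
          hform b q (fun x => phi n x - phi m x) < eps].

Definition closure_dom (R : realType) (X : choiceType) (b : X -> X -> R)
    (q : X -> R) (u : X -> R) : Prop :=
  exists phi, closure_approx b q u phi.

(* The limit does not depend on the approximating sequence since the form is
   closable. *)
Definition closure_form (R : realType) (X : choiceType) (b : X -> X -> R)
    (q : X -> R) (u : X -> R) : R :=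
  get [set a : R | exists2 phi, closure_approx b q u phi
                     & hform b q (phi n) @[n --> \oo] --> a].

(* Polarization of the closed quadratic form. *)
Definition closure_bform (R : realType) (X : choiceType) (b : X -> X -> R)
    (q : X -> R) (u v : X -> R) : R :=
  (closure_form b q (fun x => u x + v x)
   - closure_form b q (fun x => u x - v x)) / 4.

(* Unbounded operators in l^2(X) are given by their graphs: [A u f] means that
   u is in the domain of A and A u = f. *)
Definition l2_operator (R : realType) (X : choiceType) : Type :=
  (X -> R) -> (X -> R) -> Prop.

Definition H1 (R : realType) (X : choiceType) (b : X -> X -> R) (q : X -> R) :
    l2_operator R X :=
  fun u f => [/\ closure_dom b q u, ell2 f
    & forall v, closure_dom b q v -> closure_bform b q u v = inner2 f v].

(* (A - lambda)^-1 f, for lambda in the resolvent set of A. *)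
Definition resolvent (R : realType) (X : choiceType) (A : l2_operator R X)
    (lambda : R) (f : X -> R) : X -> R :=
  get [set u : X -> R | A u (fun x => f x + lambda * u x)].

Definition bounded_op (R : realType) (X : choiceType)
    (T : (X -> R) -> (X -> R)) : Prop :=
  [/\ forall f, ell2 f -> ell2 (T f),
      forall (a : R) f g, ell2 f -> ell2 g ->
        T (fun x => a * f x + g x) = (fun x => a * T f x + T g x)
    & exists M : R, forall f, ell2 f -> norm2 (T f) <= M * norm2 f].

Definition c0_semigroup (R : realType) (X : choiceType)
    (T : R -> (X -> R) -> (X -> R)) : Prop :=
  [/\ forall t, 0 <= t -> bounded_op (T t),
      forall f, ell2 f -> T 0 f = f,
      forall s t f, 0 <= s -> 0 <= t -> ell2 f -> T (s + t) f = T s (T t f)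
    & forall f, ell2 f ->
        norm2 (fun x => T t f x - f x) @[t --> (0 : R)^'+] --> (0 : R)].

Definition sg_generator (R : realType) (X : choiceType)
    (T : R -> (X -> R) -> (X -> R)) : l2_operator R X :=
  fun f g => [/\ ell2 f, ell2 g
    & norm2 (fun x => (T t f x - f x) / t - g x) @[t --> (0 : R)^'+]
        --> (0 : R)].

(* t |-> e^(-tA), the strongly continuous semigroup with generator -A, which exists
   for A selfadjoint and nonnegative; it is
   determined by A on l^2(X) and for t >= 0, its only arguments of interest. *)
Definition exp_semigroup (R : realType) (X : choiceType) (A : l2_operator R X) :
    R -> (X -> R) -> (X -> R) :=
  get [set T : R -> (X -> R) -> (X -> R) |
        c0_semigroup T /\
        forall f g, A f g <-> sg_generator T f (fun x => - g x)].

Definition resolvent_blowup (R : realType) (X : choiceType) (b : X -> X -> R)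
    (q : X -> R) (x y : X) : Prop :=
  resolvent (H1 b q) lambda (\1_[set x] : X -> R) y
    @[lambda --> (0 : R)^'-] --> +oo.

Definition semigroup_blowup (R : realType) (X : choiceType) (b : X -> X -> R)
    (q : X -> R) (x y : X) : Prop :=
  (\int[lebesgue_measure]_(s in `[0, t])
     exp_semigroup (H1 b q) s (\1_[set x] : X -> R) y)
    @[t --> +oo] --> +oo.

(* Main.v *)
(** Every condition is compared with the vanishing of the capacity.  If [v > 0] is
    superharmonic, then [h (v f)] is a sum of nonnegative edge and killing terms
    in [f]; hence normalized sequences along which [h] tends to 0 converge to
    multiples of [v], truncation at [v] decreases [h], and zero capacity at one
    point forces zero capacity everywhere, harmonicity and uniqueness.  A positive
    superharmonic function is a limit of normalized resolvents
    [(H1 + mu)^-1 1_o] along an ultrafilter.  Applied to the form lowered by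
    [cap {x} 1_x], which is critical, this yields in the subcritical case a
    function [v_x > 0] with [H v_x = cap {x} v_x(x) 1_x] for each [x], and these
    are linearly independent.

    Let [g] be [(H1 + mu)^-1 1_x] or the integral of [e^(-s H1) 1_x] over
    [[0, t]].  Then the closed form satisfies [h g <= g(x)], and testing the
    equation of [g] against [phi] with [phi x = 1] gives
    [1 <= 2 g(x) (h phi + o(1))], so [g(x)] blows up exactly if the capacity is 0;
    in that case [g / g(x)] is a null family and [g(y)] blows up for every [y].

    The semigroup is built without the spectral theorem: [G = (H1 + 1)^-1] is a
    selfadjoint operator with [0 <= G <= 1], Bernstein polynomials give a
    continuous functional calculus for [G], and [e^(-t H1)] is [f_t(G)] for
    [f_t s = exp (- t (1/s - 1))].  Since [exp_semigroup] is a choice among all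
    strongly continuous semigroups with generator [- H1], uniqueness of the latter
    is needed, which rests on their local boundedness. *)
Require Import Defs.
From HB Require Import structures.
From mathcomp Require Import finmap.
From mathcomp Require Import all_boot all_order all_algebra.
From mathcomp Require Import ring lra.
From mathcomp Require Import all_classical all_reals all_analysis.
Import Order.TTheory GRing.Theory Num.Theory.
Import numFieldNormedType.Exports.
Set Implicit Arguments.
Unset Strict Implicit.
Unset Printing Implicit Defensive.
Local Open Scope classical_set_scope.
Local Open Scope ring_scope.

(** * Summation and square-summable functions *)

(** The potential has no sign, so constants are of no use as comparison functions; a positive
    superharmonic [v] takes their place, and dividing by it turns [h] into edge terms plus
    nonnegative killing. Only inequalities between finite sums survive the ultrafilter limit that
    produces [v], so it yields superharmonicity but no equation. Equations are recovered from
    criticality, which is why the form is lowered until it becomes critical. The factor 2 in the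
    lower bound for [g(x)] comes from splitting [phi x = 1] into an energy part and a remainder,
    [s + t = 1], and using [1 <= 2 (s^2 + t^2)] before Cauchy-Schwarz on each part. In the calculus,
    positivity on [0, 1] has to be certified algebraically in order to pass to operators: Bernstein
    polynomials of nonnegative functions are combinations of products of ['X] and [1 - 'X], and
    their error is controlled by a variance identity between polynomials. The function
    [exp (- t (1/s - 1))] extends continuously by 0 to [s = 0] only for [t > 0], so time 0 is
    treated apart throughout. *)

Section Summation.
Context {R : realType} {X : choiceType}.
Implicit Types (f g : X -> R) (K L : {fset X}).

Lemma fset_sum_esum f (S : set X) : (forall x, 0 <= f x) ->
  \esum_(x in S) (f x)%:E =
  ereal_sup [set (\sum_(x <- K) f x)%:E | K in [set K : {fset X} | [set` K] `<=` S]].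
Proof.
move=> f0; rewrite /esum; congr ereal_sup; apply/seteqP; split => [_ [A [finA AS] <-]|_ [K KS <-]] /=.
- exists (fset_set A); first by move=> x /=; rewrite in_fset_set// inE => /AS.
  by rewrite fsbig_finite//= sumEFin.
- exists [set` K]; first by split.
  by rewrite fsbig_finite//= set_fsetK sumEFin.
Qed.

Lemma abs_summableP f : abs_summable f <->
  exists M, forall K, \sum_(x <- K) `|f x| <= M.
Proof.
rewrite /abs_summable /summable; rewrite (_ : esum _ _ = \esum_(x in [set: X]) (`|f x|)%:E)//.
rewrite fset_sum_esum//; split => [fin|[M hM]].
- exists (fine (ereal_sup [set (\sum_(x <- K) `|f x|)%:E | K in [set K : {fset X} | [set` K] `<=` [set: X]]])) => K.
  have ub : ((\sum_(x <- K) `|f x|)%:E <= ereal_sup [set (\sum_(x <- K) `|f x|)%:E | K in [set K : {fset X} | [set` K] `<=` [set: X]]])%E.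
    by apply: ereal_sup_ubound; exists K.
  rewrite -lee_fin fineK// fin_numElt fin andbT (lt_le_trans _ ub)// ltNye//.
- apply: (@le_lt_trans _ _ M%:E); last by rewrite ltry.
  by apply: ge_ereal_sup => _ [K _ <-]; rewrite lee_fin.
Qed.

(** Unconditional convergence, along the directed set of finite subsets. Uniqueness of the limit
    makes it the tool for computing [rsum], whose definition by positive and negative parts is not
    visibly linear. *)
Definition hasum f (l : R) := forall e, 0 < e ->
  exists K, forall L, (K `<=` L)%fset -> `|\sum_(x <- L) f x - l| <= e.

Lemma big_fset_sub f K L : (K `<=` L)%fset ->
  \sum_(x <- L | x \in K) f x = \sum_(x <- K) f x.
Proof.
move=> KL; rewrite -big_filter; apply: perm_big.
apply: uniq_perm; rewrite ?filter_uniq ?fset_uniq// => x.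
rewrite mem_filter; case: (boolP (x \in K)) => //= xK.
by rewrite (fsubsetP KL).
Qed.

Lemma fset_sum_le f K L : (forall x, 0 <= f x) -> (K `<=` L)%fset ->
  \sum_(x <- K) f x <= \sum_(x <- L) f x.
Proof.
move=> f0 KL; rewrite -(big_fset_sub f KL) [leRHS](bigID (mem K))/=.
by rewrite lerDl sumr_ge0.
Qed.

Lemma hasum_unique f l m : hasum f l -> hasum f m -> l = m.
Proof.
move=> hl hm; apply/eqP/contraT => lm.
have e0 : 0 < `|l - m| / 3 by rewrite divr_gt0// normr_gt0 subr_eq0.
have [K hK] := hl _ e0; have [L hL] := hm _ e0.
have /(_ (fsubsetUl _ _)) A := hK (K `|` L)%fset.
have /(_ (fsubsetUr _ _)) B := hL (K `|` L)%fset.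
set s := \sum_(x <- _) _ in A B.
have : `|l - m| <= `|s - l| + `|s - m|.
  have -> : l - m = (s - m) - (s - l) by rewrite opprB [RHS]addrC addrA subrK.
  by rewrite [leRHS]addrC ler_normB.
by move: A B e0; lra.
Qed.

Lemma hasum_lin a f g l m : hasum f l -> hasum g m ->
  hasum (fun x => a * f x + g x) (a * l + m).
Proof.
move=> hl hm e e0.
have a0 : 0 < `|a| + 1 by rewrite ltr_wpDl.
have d0 : 0 < e / (`|a| + 1) / 2 by rewrite !divr_gt0.
have [K hK] := hl _ d0; have [L hL] := hm _ (divr_gt0 e0 (ltr0Sn _ 1)).
exists (K `|` L)%fset => M; rewrite fsubUset => /andP[/hK A /hL B].
rewrite big_split/= -mulr_sumr.
set s := \sum_(x <- _) _ in A *; set t := \sum_(x <- _) _ in B *.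
rewrite (_ : _ - _ = a * (s - l) + (t - m)); last by ring.
rewrite (le_trans (ler_normD _ _))// normrM.
have : `|a| * `|s - l| <= (`|a| + 1) * (e / (`|a| + 1) / 2).
  by rewrite ler_pM// lerDl.
rewrite mulrA mulrCA divff ?gt_eqF// mulr1.
by move: B; lra.
Qed.

Lemma hasum_ge0P f l : (forall x, 0 <= f x) ->
  (forall K, \sum_(x <- K) f x <= l) ->
  (forall e, 0 < e -> exists K, l - e <= \sum_(x <- K) f x) -> hasum f l.
Proof.
move=> f0 ub app e e0; have [K hK] := app _ e0; exists K => L KL.
have := fset_sum_le f0 KL; have := ub L; rewrite ler_norml.
by move: hK => *; apply/andP; split; lra.
Qed.

Lemma hasum_esum f : (forall x, 0 <= f x) ->
  (exists M, forall K, \sum_(x <- K) f x <= M) ->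
  hasum f (fine (\esum_(x in [set: X]) (f x)%:E)).
Proof.
move=> f0 [M hM]; rewrite fset_sum_esum//.
set S := [set _ | _ in _].
have fin : ereal_sup S \is a fin_num.
  rewrite fin_numElt; apply/andP; split.
    apply: (@lt_le_trans _ _ 0%E) => //.
    by apply: ereal_sup_ubound; exists fset0; rewrite ?big_seq_fset0.
  apply: (@le_lt_trans _ _ M%:E); last by rewrite ltry.
  by apply: ge_ereal_sup => _ [K _ <-]; rewrite lee_fin.
apply: hasum_ge0P => // [K|e e0].
  by rewrite -lee_fin fineK//; apply: ereal_sup_ubound; exists K.
have [_ [K _ <-]] := ub_ereal_sup_adherent e0 fin.
rewrite -{1}(fineK fin) -EFinB lte_fin => /ltW ?.
by exists K.
Qed.

(** Both parts of [f] are dominated by its absolute value, so each extended sum is finite and they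
    may be subtracted. *)
Lemma hasum_rsum f : abs_summable f -> hasum f (rsum f).
Proof.
move=> /abs_summableP[M hM]; rewrite /rsum.
have E1 x : ((EFin \o f)^\+ x)%E = (Num.max (f x) 0)%:E.
  by rewrite funeposE /= EFin_max.
have E2 x : ((EFin \o f)^\- x)%E = (Num.max (- f x) 0)%:E.
  by rewrite funenegE /= EFin_max.
rewrite (eq_esum (fun x _ => E1 x)) (eq_esum (fun x _ => E2 x)).
have h (g : X -> R) : (forall x, `|g x| <= `|f x|) -> exists M, forall K, \sum_(x <- K) g x <= M.
  move=> gf; exists M => K; apply: le_trans (hM K); apply: ler_sum => x _.
  exact: le_trans (ler_norm _) (gf x).
have p0 x : 0 <= Num.max (f x) 0 by rewrite le_max lexx orbT.
have n0 x : 0 <= Num.max (- f x) 0 by rewrite le_max lexx orbT.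
have hp : hasum _ _ := hasum_esum p0 (h _ _).
have hn : hasum _ _ := hasum_esum n0 (h _ _).
have := hasum_lin (-1) (hn _) (hp _).
rewrite mulN1r addrC => H.
rewrite [X in hasum X _](_ : _ = fun x => -1 * Num.max (- f x) 0 + Num.max (f x) 0); last first.
  apply/funext => x; rewrite mulN1r; case: (lerP 0 (f x)) => fx.
    by rewrite max_r ?oppr_le0// oppr0 add0r.
  by rewrite max_l ?oppr_ge0 ?ltW// opprK addr0.
apply: H => x.
  by rewrite ger0_norm// ge_max normr_ge0 andbT ler_normr lexx orbT.
by rewrite ger0_norm// ge_max normr_ge0 andbT ler_norm.
Qed.

Lemma rsumE f l : abs_summable f -> hasum f l -> rsum f = l.
Proof. by move=> /hasum_rsum; exact: hasum_unique. Qed.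

Lemma abs_summable_le f g : (forall x, `|f x| <= `|g x|) ->
  abs_summable g -> abs_summable f.
Proof.
move=> fg /abs_summableP[M hM]; apply/abs_summableP; exists M => K.
by apply: le_trans (hM K); apply: ler_sum.
Qed.

Lemma abs_summable_lin a f g : abs_summable f -> abs_summable g ->
  abs_summable (fun x => a * f x + g x).
Proof.
move=> /abs_summableP[M hM] /abs_summableP[N hN]; apply/abs_summableP.
exists (`|a| * M + N) => K.
apply: (@le_trans _ _ (\sum_(x <- K) (`|a| * `|f x| + `|g x|))).
  by apply: ler_sum => x _; rewrite -normrM ler_normD.
by rewrite big_split/= -mulr_sumr lerD// ler_wpM2l.
Qed.

Lemma rsum_lin a f g : abs_summable f -> abs_summable g ->
  rsum (fun x => a * f x + g x) = a * rsum f + rsum g.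
Proof.
move=> sf sg; apply: rsumE; first exact: abs_summable_lin.
by apply: hasum_lin; exact: hasum_rsum.
Qed.

Lemma finsuppE f K : (forall x, x \notin K -> f x = 0) -> hasum f (\sum_(x <- K) f x).
Proof.
move=> f0 e e0; exists K => L KL.
rewrite (bigID (mem K) xpredT f)/= addrC big1 ?add0r => [|x /f0//].
by rewrite big_fset_sub// subrr normr0 ltW.
Qed.

Lemma abs_summable_fin f K : (forall x, x \notin K -> f x = 0) -> abs_summable f.
Proof.
move=> f0; apply/abs_summableP; exists (\sum_(x <- K) `|f x|) => L.
apply: (@le_trans _ _ (\sum_(x <- (K `|` L)%fset) `|f x|)).
  by apply: fset_sum_le; rewrite ?fsubsetUr.
have f0' x : x \notin K -> `|f x| = 0 by move=> /f0 ->; rewrite normr0.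
apply/ler_addgt0Pr => e e0; have [M hM] := finsuppE f0' e0.
have := hM (M `|` (K `|` L))%fset (fsubsetUl _ _).
rewrite ler_norml => /andP[_].
have : \sum_(x <- (K `|` L)%fset) `|f x| <= \sum_(x <- (M `|` (K `|` L))%fset) `|f x|.
  by apply: fset_sum_le; rewrite ?fsubsetUr.
lra.
Qed.

Lemma rsum_fin f K : (forall x, x \notin K -> f x = 0) ->
  rsum f = \sum_(x <- K) f x.
Proof. by move=> f0; apply: rsumE; [exact: abs_summable_fin f0|exact: finsuppE]. Qed.

Lemma rsum_le f g : abs_summable f -> abs_summable g ->
  (forall x, f x <= g x) -> rsum f <= rsum g.
Proof.
move=> /hasum_rsum hf /hasum_rsum hg fg; apply/ler_addgt0Pr => e e0.
have e2 : 0 < e / 2 by rewrite divr_gt0.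
have [K hK] := hf _ e2; have [L hL] := hg _ e2.
have /(_ (fsubsetUl _ _)) := hK (K `|` L)%fset.
have /(_ (fsubsetUr _ _)) := hL (K `|` L)%fset.
rewrite !ler_norml => /andP[_ A] /andP[B _].
have : \sum_(x <- (K `|` L)%fset) f x <= \sum_(x <- (K `|` L)%fset) g x by apply: ler_sum.
by move: A B; lra.
Qed.

Lemma rsum_ge0 f : abs_summable f -> (forall x, 0 <= f x) -> 0 <= rsum f.
Proof.
move=> sf f0; have z : forall x : X, x \notin fset0 -> (fun=> 0 : R) x = 0 by [].
have := rsum_le (abs_summable_fin z) sf f0.
by rewrite (rsum_fin z) big_seq_fset0.
Qed.

Lemma rsum_ge_fin f K : abs_summable f -> (forall x, 0 <= f x) ->
  \sum_(x <- K) f x <= rsum f.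
Proof.
move=> /hasum_rsum hf f0; apply/ler_addgt0Pr => e e0.
have [L hL] := hf _ e0; have /(_ (fsubsetUl _ _)) := hL (L `|` K)%fset.
rewrite ler_norml => /andP[_ A]; have := fset_sum_le f0 (fsubsetUr L K).
by move: A; lra.
Qed.

Lemma rsum_le_fin f M : abs_summable f ->
  (forall K, \sum_(x <- K) f x <= M) -> rsum f <= M.
Proof.
move=> /hasum_rsum hf ub; apply/ler_addgt0Pr => e e0.
have [L hL] := hf _ e0; have := hL L (fsubset_refl _); have := ub L.
by rewrite ler_norml => A /andP[B _]; move: A B; lra.
Qed.

Lemma abs_summable_ge0 f M : (forall x, 0 <= f x) ->
  (forall K, \sum_(x <- K) f x <= M) -> abs_summable f.
Proof.
move=> f0 hM; apply/abs_summableP; exists M => K.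
by under eq_bigr do rewrite ger0_norm//.
Qed.

Lemma rsumZ a f : abs_summable f -> rsum (fun x => a * f x) = a * rsum f.
Proof.
move=> sf; have z : forall x : X, x \notin fset0 -> (fun=> 0 : R) x = 0 by [].
have Z : rsum (fun _ : X => 0 : R) = 0 by rewrite (rsum_fin z) big_seq_fset0.
rewrite -[RHS]addr0 -[X in _ + X]Z.
rewrite -rsum_lin//; last exact: abs_summable_fin z.
by congr rsum; apply/funext => x; rewrite addr0.
Qed.

Lemma rsumD f g : abs_summable f -> abs_summable g ->
  rsum (fun x => f x + g x) = rsum f + rsum g.
Proof.
move=> sf sg; rewrite -[X in _ = X + _]mul1r -rsum_lin//.
by congr rsum; apply/funext => x; rewrite mul1r.
Qed.

Lemma rsumB f g : abs_summable f -> abs_summable g ->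
  rsum (fun x => f x - g x) = rsum f - rsum g.
Proof.
move=> sf sg; rewrite addrC -mulN1r -rsum_lin//.
by congr rsum; apply/funext => x; rewrite mulN1r addrC.
Qed.

Lemma abs_summableD f g : abs_summable f -> abs_summable g ->
  abs_summable (fun x => f x + g x).
Proof.
move=> sf sg; have := abs_summable_lin 1 sf sg.
by congr abs_summable; apply/funext => x; rewrite mul1r.
Qed.

Lemma abs_summableZ a f : abs_summable f -> abs_summable (fun x => a * f x).
Proof.
move=> sf; have z : forall x : X, x \notin fset0 -> (fun=> 0 : R) x = 0 by [].
have := abs_summable_lin a sf (abs_summable_fin z).
by congr abs_summable; apply/funext => x; rewrite addr0.
Qed.

Lemma finsupp_funP f : finsupp_fun f <-> exists K, forall x, x \notin K -> f x = 0.
Proof.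
split=> [/= fin|[K hK]].
  exists (fset_set [set x | f x <> 0]) => x.
  by rewrite in_fset_set// notin_setE => /contrapT.
apply: (@sub_finite_set _ _ [set` K]) => // x /= fx.
by apply: contrapT => /negP/hK.
Qed.

Lemma fsum_fin f K : (forall x, x \notin K -> f x = 0) ->
  \sum_(x \in [set: X]) f x = \sum_(x <- K) f x.
Proof.
move=> f0; rewrite -(fsbig_widen [set` K] setT)//=.
  by rewrite fsbig_finite//= set_fsetK.
by move=> x /= [_ /negP]; exact: f0.
Qed.

End Summation.

(** The source of all Cauchy-Schwarz inequalities below and of the estimate on near-minimizers. The
    sign of [a] is not given: [a < 0], and [a = 0] with [b != 0], are refuted at explicit points. *)
Lemma discr_le (R : realType) (a b c : R) :
  (forall t, 0 <= a * t ^+ 2 + 2 * b * t + c) -> b ^+ 2 <= a * c.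
Proof.
move=> H; have c0 : 0 <= c by have := H 0; rewrite expr0n/= !mulr0 !add0r.
have [a0|a0] := eqVneq a 0.
  have [->|b0] := eqVneq b 0; first by rewrite a0 mul0r expr0n.
  have := H (- (c + 1) / (2 * b)).
  have -> : a * (- (c + 1) / (2 * b)) ^+ 2 + 2 * b * (- (c + 1) / (2 * b)) + c = -1.
    by rewrite a0; field.
  by rewrite ler0N1.
have ap : 0 < a.
  rewrite lt_neqAle eq_sym a0/= leNgt; apply/negP => an.
  pose s := (`|b| + c + 1) / - a + 1.
  have s1 : 1 <= s.
    by rewrite lerDr divr_ge0//; [rewrite !addr_ge0|rewrite oppr_ge0 ltW].
  have e : a * s = - (`|b| + c + 1) + a by rewrite /s; field.
  have := H s; have := H (- s).
  have -> : a * (- s) ^+ 2 = (a * s) * s by ring.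
  have -> : a * s ^+ 2 = (a * s) * s by ring.
  rewrite e; have : 0 <= `|b| by [].
  by move: s1 an c0; nra.
have := H (- b / a).
have -> : a * (- b / a) ^+ 2 + 2 * b * (- b / a) + c = (a * c - b ^+ 2) / a by field.
by rewrite pmulr_lge0 ?invr_gt0// subr_ge0.
Qed.

Lemma cvg_dist_le (R : realType) (s : nat -> R) (l : R) (B : nat -> R) :
  (forall n, `|s n - l| <= B n) -> B n @[n --> \oo] --> (0 : R) ->
  s n @[n --> \oo] --> l.
Proof.
move=> sB /cvgrPdist_lt B0; apply/cvgrPdist_lt => e /B0[N _ hN]; exists N => // n /hN.
rewrite sub0r normrN distrC => h; apply: le_lt_trans (sB n) _.
exact: le_lt_trans (ler_norm _) h.
Qed.

Lemma cvg_sumr (R : realType) (T : Type) (F : set_system T) (FF : Filter F)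
    (I : Type) (r : seq I) (f : I -> T -> R) (l : I -> R) :
  (forall i, f i t @[t --> F] --> l i) ->
  \sum_(i <- r) f i t @[t --> F] --> \sum_(i <- r) l i.
Proof.
move=> fl; elim: r => [|i r IH].
  by rewrite big_nil; under eq_fun do rewrite big_nil; exact: cvg_cst.
by rewrite big_cons; under eq_fun do rewrite big_cons; exact: cvgD.
Qed.

Section SquareSummable.
Context {R : realType} {X : choiceType}.
Implicit Types (f g u v : X -> R) (K L : {fset X}).

Lemma ell2P f : ell2 f <-> exists M, forall K, \sum_(x <- K) f x ^+ 2 <= M.
Proof.
rewrite /ell2 abs_summableP; split=> -[M hM]; exists M => K; have := hM K.
  by under eq_bigr do rewrite ger0_norm ?sqr_ge0//.
by under [in X in _ -> X]eq_bigr do rewrite ger0_norm ?sqr_ge0//.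
Qed.

Lemma ell2_lin a f g : ell2 f -> ell2 g -> ell2 (fun x => a * f x + g x).
Proof.
move=> hf hg.
have h2 := abs_summable_lin (2 * a ^+ 2) hf (abs_summableZ 2 hg).
apply: (abs_summable_le _ h2) => x.
rewrite !ger0_norm ?sqr_ge0//.
  by have := sqr_ge0 (a * f x - g x); lra.
by have := sqr_ge0 (a * f x); have := sqr_ge0 (g x); lra.
Qed.

Lemma ell2_fin f K : (forall x, x \notin K -> f x = 0) -> ell2 f.
Proof.
by move=> f0; apply: (@abs_summable_fin _ _ _ K) => x /f0 ->; rewrite expr0n.
Qed.

Lemma ell2_0 : ell2 (fun _ : X => 0 : R).
Proof. exact: (@ell2_fin _ fset0). Qed.

Lemma ell2D f g : ell2 f -> ell2 g -> ell2 (fun x => f x + g x).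
Proof.
move=> hf hg; have := ell2_lin 1 hf hg.
by congr ell2; apply/funext => x; rewrite mul1r.
Qed.

Lemma ell2B f g : ell2 f -> ell2 g -> ell2 (fun x => f x - g x).
Proof.
move=> hf hg; have := ell2_lin (-1) hg hf.
by congr ell2; apply/funext => x; rewrite mulN1r addrC.
Qed.

Lemma ell2Z a f : ell2 f -> ell2 (fun x => a * f x).
Proof.
move=> hf; have := ell2_lin a hf ell2_0.
by congr ell2; apply/funext => x; rewrite addr0.
Qed.

Lemma ell2_finsupp f : finsupp_fun f -> ell2 f.
Proof. by move=> /finsupp_funP[K]; exact: ell2_fin. Qed.

Lemma ell2_mul f g : ell2 f -> ell2 g -> abs_summable (fun x => f x * g x).
Proof.
move=> hf hg; apply: (abs_summable_le _ (abs_summableD hf hg)) => x.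
rewrite [leRHS]ger0_norm ?addr_ge0 ?sqr_ge0// ler_norml.
have := sqr_ge0 (f x - g x); have := sqr_ge0 (f x + g x).
have := sqr_ge0 (f x); have := sqr_ge0 (g x).
by move=> *; apply/andP; split; lra.
Qed.

Lemma inner2C f g : inner2 f g = inner2 g f.
Proof. by rewrite /inner2; congr rsum; apply/funext => x; rewrite mulrC. Qed.

Lemma inner2_linl a f g v : ell2 f -> ell2 g -> ell2 v ->
  inner2 (fun x => a * f x + g x) v = a * inner2 f v + inner2 g v.
Proof.
move=> hf hg hv; rewrite /inner2 -rsum_lin; [|exact: ell2_mul|exact: ell2_mul].
by congr rsum; apply/funext => x; ring.
Qed.

Lemma inner2Dl f g v : ell2 f -> ell2 g -> ell2 v ->
  inner2 (fun x => f x + g x) v = inner2 f v + inner2 g v.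
Proof.
move=> hf hg hv; have -> : (fun x => f x + g x) = (fun x => 1 * f x + g x).
  by apply/funext => x; rewrite mul1r.
by rewrite (inner2_linl 1 hf hg hv) mul1r.
Qed.

Lemma inner2Bl f g v : ell2 f -> ell2 g -> ell2 v ->
  inner2 (fun x => f x - g x) v = inner2 f v - inner2 g v.
Proof.
move=> hf hg hv; have -> : (fun x => f x - g x) = (fun x => -1 * g x + f x).
  by apply/funext => x; rewrite mulN1r addrC.
by rewrite (inner2_linl (-1) hg hf hv) mulN1r [LHS]addrC.
Qed.

Lemma inner2Zl a f v : ell2 f -> ell2 v -> inner2 (fun x => a * f x) v = a * inner2 f v.
Proof.
move=> hf hv; rewrite /inner2 -rsumZ; last exact: ell2_mul.
by congr rsum; apply/funext => x; rewrite mulrA.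
Qed.

Lemma inner2_ge0 f : ell2 f -> 0 <= inner2 f f.
Proof. by move=> hf; apply: rsum_ge0 => [|x]; [exact: ell2_mul|rewrite -expr2 sqr_ge0]. Qed.

Lemma sqr_le_inner2 f x : ell2 f -> f x ^+ 2 <= inner2 f f.
Proof.
move=> hf; have := @rsum_ge_fin _ _ (fun x => f x * f x) [fset x]%fset (ell2_mul hf hf).
by rewrite big_seq_fset1 -expr2; apply => y; rewrite -expr2 sqr_ge0.
Qed.

Lemma inner2_CS f g : ell2 f -> ell2 g ->
  inner2 f g ^+ 2 <= inner2 f f * inner2 g g.
Proof.
move=> hf hg; apply: discr_le => t.
have hh := ell2_lin t hf hg; have := inner2_ge0 hh.
rewrite inner2_linl// (inner2C f) (inner2C g) !inner2_linl// (inner2C g f).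
by congr (0 <= _); ring.
Qed.

Lemma norm2_ge0 f : 0 <= norm2 f.
Proof. exact: sqrtr_ge0. Qed.

Lemma sqr_norm2 f : ell2 f -> norm2 f ^+ 2 = inner2 f f.
Proof. by move=> hf; rewrite sqr_sqrtr// inner2_ge0. Qed.

Lemma ler_sqr_nneg (a c : R) : 0 <= c -> a ^+ 2 <= c ^+ 2 -> a <= c.
Proof.
move=> c0; case: (lerP 0 a) => a0; first by rewrite ler_sqr.
by move=> _; exact: le_trans (ltW a0) c0.
Qed.

Lemma inner2_le_norm f g : ell2 f -> ell2 g -> `|inner2 f g| <= norm2 f * norm2 g.
Proof.
move=> hf hg; apply: ler_sqr_nneg; first by rewrite mulr_ge0 ?norm2_ge0.
by rewrite exprMn !sqr_norm2// real_normK ?num_real// inner2_CS.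
Qed.

Lemma ler_norm2 f x : ell2 f -> `|f x| <= norm2 f.
Proof.
move=> hf; apply: ler_sqr_nneg; first exact: norm2_ge0.
by rewrite sqr_norm2// real_normK ?num_real// sqr_le_inner2.
Qed.

Lemma norm2D f g : ell2 f -> ell2 g ->
  norm2 (fun x => f x + g x) <= norm2 f + norm2 g.
Proof.
move=> hf hg; apply: ler_sqr_nneg; first by rewrite addr_ge0 ?norm2_ge0.
have hh := ell2D hf hg.
rewrite sqr_norm2// inner2Dl// (inner2C f) (inner2C g) !inner2Dl// (inner2C g f).
rewrite sqrrD !sqr_norm2//.
have := ler_norm (inner2 f g); have := inner2_le_norm hf hg; rewrite mulr2n; lra.
Qed.

Lemma norm2Z a f : ell2 f -> norm2 (fun x => a * f x) = `|a| * norm2 f.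
Proof.
move=> hf; have h := ell2Z a hf; rewrite /norm2 inner2Zl// inner2C inner2Zl// mulrA -expr2.
by rewrite sqrtrM ?sqr_ge0// sqrtr_sqr.
Qed.

Lemma norm2_le f M : 0 <= M -> ell2 f ->
  (forall K, \sum_(x <- K) f x ^+ 2 <= M ^+ 2) -> norm2 f <= M.
Proof.
move=> M0 hf hM; apply: ler_sqr_nneg => //; rewrite sqr_norm2//.
apply: rsum_le_fin; first exact: ell2_mul.
by move=> K; under eq_bigr do rewrite -expr2.
Qed.

Lemma fin_le_norm2 f K : ell2 f -> \sum_(x <- K) f x ^+ 2 <= norm2 f ^+ 2.
Proof.
move=> hf; rewrite sqr_norm2// /inner2.
have -> : (fun x => f x * f x) = (fun x => f x ^+ 2) by apply/funext => x; rewrite expr2.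
by apply: rsum_ge_fin => // x; rewrite sqr_ge0.
Qed.

Definition l2cvg (f : nat -> X -> R) (u : X -> R) : Prop :=
  norm2 (fun x => f n x - u x) @[n --> \oo] --> (0 : R).

Lemma l2cvgP (f : nat -> X -> R) u : l2cvg f u <->
  forall e, 0 < e -> exists N, forall n, (N <= n)%N -> norm2 (fun x => f n x - u x) < e.
Proof.
split=> [/cvgrPdist_lt h e e0|h]; last first.
  apply/cvgrPdist_lt => e /h[N hN]; exists N => // n /= /hN.
  by rewrite sub0r normrN ger0_norm ?norm2_ge0.
have [N _ hN] := h _ e0; exists N => n Nn; have := hN n Nn.
by rewrite sub0r normrN ger0_norm ?norm2_ge0.
Qed.

(** Coordinates are Cauchy since they are bounded by the norm, which gives a pointwise limit. *)
Lemma l2_complete (f : nat -> X -> R) : (forall n, ell2 (f n)) ->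
  (forall e, 0 < e -> exists N, forall n m, (N <= n)%N -> (N <= m)%N ->
    norm2 (fun x => f n x - f m x) < e) ->
  exists2 u, ell2 u & l2cvg f u.
Proof.
move=> hf hC.
have pw x : cvgn (fun n => f n x).
  apply/cauchy_cvgP/cauchy_exP => e e0.
  have [N hN] := hC e e0; exists (f N x), N => // n /= Nn.
  exact: le_lt_trans (ler_norm2 x (ell2B (hf N) (hf n))) (hN _ _ (leqnn N) Nn).
pose u x := limn (fun n => f n x).
have fu x : f n x @[n --> \oo] --> u x := pw x.
(* As in Fatou's lemma: for each finite set the bound passes to the limit in [m], and it is uniform
   over finite sets. *)
have key e : 0 < e -> exists N, forall n, (N <= n)%N -> forall K,
    \sum_(x <- K) (f n x - u x) ^+ 2 <= e ^+ 2.
  move=> e0; have [N hN] := hC e e0; exists N => n Nn K.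
  have cv : \sum_(x <- K) (f n x - f m x) ^+ 2 @[m --> \oo] --> \sum_(x <- K) (f n x - u x) ^+ 2.
    apply: cvg_sumr => x; rewrite expr2; under eq_fun do rewrite expr2.
    by apply: cvgM; apply: cvgB => //; exact: cvg_cst.
  rewrite -(cvg_lim _ cv)//; apply: limr_le; first by apply/cvg_ex; exists (\sum_(x <- K) (f n x - u x) ^+ 2).
  exists N => // m /= Nm; apply: le_trans (fin_le_norm2 _ (ell2B (hf n) (hf m))) _.
  by rewrite ler_sqr ?nnegrE ?norm2_ge0 ?ltW// hN.
have hu : ell2 u.
  have [N hN] := key _ ltr01.
  have : ell2 (fun x => f N x - u x) by apply/ell2P; exists (1 ^+ 2) => K; exact: hN.
  move=> /(ell2_lin (-1))/(_ (hf N)); congr ell2.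
  by apply/funext => x; rewrite mulN1r opprB subrK.
exists u => //; apply/l2cvgP => e e0; have e2 : 0 < e / 2 by rewrite divr_gt0.
have [N hN] := key _ e2; exists N => n Nn.
apply: (@le_lt_trans _ _ (e / 2)); last by lra.
by apply: norm2_le; [exact: ltW|exact: ell2B|exact: hN].
Qed.

Lemma l2cvg_pt (f : nat -> X -> R) u x : (forall n, ell2 (f n)) -> ell2 u -> l2cvg f u ->
  f n x @[n --> \oo] --> u x.
Proof.
move=> hf hu /l2cvgP h; apply/cvgrPdist_lt => e /h[N hN]; exists N => // n /= Nn.
by rewrite distrC; exact: le_lt_trans (ler_norm2 x (ell2B (hf n) hu)) (hN _ Nn).
Qed.

Lemma l2cvg_inner (f g : nat -> X -> R) u v : (forall n, ell2 (f n)) -> ell2 u -> l2cvg f u ->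
  (forall n, ell2 (g n)) -> ell2 v -> l2cvg g v ->
  inner2 (f n) (g n) @[n --> \oo] --> inner2 u v.
Proof.
move=> hf hu fu hg hv gv.
pose a n := norm2 (fun x => f n x - u x); pose c n := norm2 (fun x => g n x - v x).
apply: (@cvg_dist_le _ _ _ (fun n => a n * (c n + norm2 v) + norm2 u * c n)).
  move=> n; have hfu := ell2B (hf n) hu; have hgv := ell2B (hg n) hv.
  have -> : inner2 (f n) (g n) - inner2 u v =
      inner2 (fun x => f n x - u x) (g n) + inner2 u (fun x => g n x - v x).
    rewrite (inner2Bl (hf n) hu (hg n)) [X in _ = _ + X]inner2C.
    by rewrite (inner2Bl (hg n) hv hu) (inner2C (g n) u) (inner2C v u); ring.
  apply: le_trans (ler_normD _ _) _; apply: lerD; last exact: inner2_le_norm.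
  apply: le_trans (inner2_le_norm _ _) _ => //; apply: ler_wpM2l; first exact: norm2_ge0.
  have := norm2D hgv hv; congr (norm2 _ <= _).
  by apply/funext => x; rewrite subrK.
rewrite (_ : 0 = 0 * (0 + norm2 v) + norm2 u * 0); last by rewrite mul0r mulr0 addr0.
by apply: cvgD; apply: cvgM => //; first apply: cvgD => //; exact: cvg_cst.
Qed.

Lemma l2cvg_lin a (f g : nat -> X -> R) u v : (forall n, ell2 (f n)) -> ell2 u -> l2cvg f u ->
  (forall n, ell2 (g n)) -> ell2 v -> l2cvg g v ->
  l2cvg (fun n x => a * f n x + g n x) (fun x => a * u x + v x).
Proof.
move=> hf hu fu hg hv gv.
have h : `|a| * norm2 (fun x => f n x - u x) + norm2 (fun x => g n x - v x)
    @[n --> \oo] --> (0 : R).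
  rewrite -[X in _ --> X]addr0 -[X in _ --> X + _](mulr0 `|a|).
  by apply: cvgD => //; apply: cvgM => //; exact: cvg_cst.
apply: (squeeze_cvgr _ (cvg_cst 0) h); near=> n; rewrite norm2_ge0/=.
have := norm2D (ell2Z a (ell2B (hf n) hu)) (ell2B (hg n) hv).
rewrite norm2Z; last exact: ell2B.
by congr (norm2 _ <= _); apply/funext => x; ring.
Unshelve. all: by end_near. Qed.

Lemma l2cvg_cst u : l2cvg (fun=> u) u.
Proof.
have E : norm2 (fun x => u x - u x) = 0.
  rewrite /norm2 /inner2 (_ : (fun _ => _) = fun _ => 0); last first.
    by apply/funext => x; rewrite subrr mul0r.
  by rewrite (@rsum_fin _ _ _ fset0)// big_seq_fset0 sqrtr0.
by rewrite /l2cvg E; exact: cvg_cst.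
Qed.

Lemma indic1E (x y : X) : \1_[set x] y = (y == x)%:R :> R.
Proof. by rewrite indicE; congr ((_ : bool)%:R); apply/idP/eqP; rewrite inE. Qed.

Lemma ell2_indic (x : X) : ell2 (\1_[set x] : X -> R).
Proof.
apply: (@ell2_fin _ [fset x]%fset) => y; rewrite inE indic1E => /negPf ->//.
Qed.

Lemma inner2_indic f (x : X) : inner2 f (\1_[set x]) = f x.
Proof.
rewrite /inner2 (@rsum_fin _ _ _ [fset x]%fset) => [|y]; last first.
  by rewrite inE indic1E => /negPf ->; rewrite mulr0.
by rewrite big_seq_fset1 indic1E eqxx mulr1.
Qed.

End SquareSummable.

(** * The form and its closure *)

Section SummationMore.
Context {R : realType} {X : choiceType}.
Implicit Types (f g : X -> R) (K L : {fset X}).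

Lemma esum_rsum f : (forall x, 0 <= f x) -> abs_summable f ->
  \esum_(x in [set: X]) (f x)%:E = (rsum f)%:E.
Proof.
move=> f0 sf; have /abs_summableP[M hM] := sf.
have ub : exists M, forall K, \sum_(x <- K) f x <= M.
  exists M => K; apply: le_trans (hM K); apply: ler_sum => x _; exact: ler_norm.
rewrite -(hasum_unique (hasum_esum f0 ub) (hasum_rsum sf)) fineK//.
have e0 : (0 <= \esum_(x in [set: X]) (f x)%:E)%E by apply: esum_ge0 => x _; rewrite lee_fin.
rewrite fin_numElt (lt_le_trans (ltNyr 0) e0)/=.
move: sf; rewrite /abs_summable /summable; congr (_ < _)%E.
by apply: eq_esum => x _; rewrite /= ger0_norm.
Qed.

Lemma rsum_sum (I : eqType) (r : seq I) (F : I -> X -> R) :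
  (forall i, abs_summable (F i)) ->
  abs_summable (fun x => \sum_(i <- r) F i x) /\
  rsum (fun x => \sum_(i <- r) F i x) = \sum_(i <- r) rsum (F i).
Proof.
move=> h; elim: r => [|i r [s e]].
  have z : forall x, x \notin fset0 -> \sum_(i <- [::]) F i x = 0 by move=> x _; rewrite big_nil.
  by split; [exact: abs_summable_fin z|rewrite (rsum_fin z) big_seq_fset0 big_nil].
have E : (fun x => \sum_(j <- i :: r) F j x) = fun x => F i x + \sum_(j <- r) F j x.
  by apply/funext => x; rewrite big_cons.
by rewrite E big_cons -e rsumD//; split=> //; exact: abs_summableD.
Qed.

(** Tonelli's theorem, which opens up the sum over pairs in [hform]. *)
Lemma esum_pair (F : X -> X -> R) : (forall x y, 0 <= F x y) ->
  (forall x, abs_summable (F x)) -> abs_summable (fun x => rsum (F x)) ->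
  \esum_(p in [set: X * X]) (F p.1 p.2)%:E = (rsum (fun x => rsum (F x)))%:E.
Proof.
move=> F0 s1 s2.
have -> : [set: X * X] = [set: X] `*`` (fun=> [set: X]) by apply/seteqP.
rewrite -(@esum_esum _ _ _ _ _ (fun x y => (F x y)%:E)); last first.
  by move=> x y _ _; rewrite lee_fin.
under eq_esum => x _ do rewrite esum_rsum//.
by rewrite esum_rsum// => x; exact: rsum_ge0.
Qed.

End SummationMore.

Section FormMatrix.
Context {R : realType} {X : choiceType} (b : X -> X -> R) (q : X -> R).
Hypothesis bgraph : is_graph b.
Implicit Types (f g u v phi psi : X -> R) (K L : {fset X}).

Let b0 x y : 0 <= b x y. Proof. by case: bgraph. Qed.
Let bsym x y : b x y = b y x. Proof. by case: bgraph. Qed.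
Let bsum x : abs_summable (b x). Proof. by case: bgraph. Qed.

(** The diagonal entry of the matrix of [H]; the off-diagonal entries are [- b x y]. *)
Definition vdeg x := rsum (b x) + q x.

Definition supp_in K phi := forall x, x \notin K -> phi x = 0.

(** The bilinear form of the matrix of [H] cut down to [K]. The diagonal keeps the whole degree,
    including edges that leave [K], so no infinite sum over edges remains to be manipulated. *)
Definition mform K phi psi : R :=
  \sum_(x <- K) (vdeg x * phi x * psi x - \sum_(y <- K) b x y * phi x * psi y).

Let sqrb_summable x : abs_summable (fun y => b x y ^+ 2).
Proof.
have /abs_summableP[M hM] := bsum x; apply/abs_summableP; exists (M ^+ 2) => K.
have M0 : 0 <= M by have := hM fset0; rewrite big_seq_fset0.
apply: (@le_trans _ _ (\sum_(y <- K) M * b x y)).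
  apply: ler_sum => y _; rewrite ger0_norm ?sqr_ge0// expr2 ler_wpM2r//.
  have := hM [fset y]%fset; rewrite big_seq_fset1; exact: le_trans (ler_norm _).
rewrite -mulr_sumr expr2 ler_wpM2l//; apply: le_trans (hM K).
by apply: ler_sum => y _; exact: ler_norm.
Qed.

(** Summable weights are bounded, hence square-summable. This makes the value of [H u] at a vertex a
    continuous functional of [u] in l^2, which is what closability rests on. *)
Lemma ell2_edge x : ell2 (b x).
Proof. exact: sqrb_summable. Qed.

(** The square is expanded into [A x y + A y x - 2 b x y * c x y]. Extended sums are additive only
    for nonnegative terms, so the cross term is split into [P - N] and [P] is moved to the other
    side. *)
Lemma hform_mform K phi : supp_in K phi -> hform b q phi = mform K phi phi.
Proof.
move=> sK.
pose c (x y : X) := phi x * phi y.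
pose F x y := b x y * (phi x - phi y) ^+ 2.
pose A x y := b x y * phi x ^+ 2.
pose P x y := 2 * (b x y * Num.max (c x y) 0).
pose N x y := 2 * (b x y * Num.max (- c x y) 0).
have A0 x y : 0 <= A x y by rewrite mulr_ge0 ?sqr_ge0.
have A'0 x y : 0 <= A y x by [].
have F0 x y : 0 <= F x y by rewrite mulr_ge0 ?sqr_ge0.
have P0 x y : 0 <= P x y by rewrite !mulr_ge0// le_max lexx orbT.
have N0 x y : 0 <= N x y by rewrite !mulr_ge0// le_max lexx orbT.
have c0l x y : x \notin K -> c x y = 0 by move=> /sK h; rewrite /c h mul0r.
have c0r x y : y \notin K -> c x y = 0 by move=> /sK h; rewrite /c h mulr0.
have P0l x : x \notin K -> P x = fun=> 0.
  by move=> xK; apply/funext => y; rewrite /P c0l// maxxx !mulr0.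
have N0l x : x \notin K -> N x = fun=> 0.
  by move=> xK; apply/funext => y; rewrite /N c0l// oppr0 maxxx !mulr0.
have P0r x y : y \notin K -> P x y = 0 by move=> yK; rewrite /P c0r// maxxx !mulr0.
have N0r x y : y \notin K -> N x y = 0 by move=> yK; rewrite /N c0r// oppr0 maxxx !mulr0.
have r0 : rsum (fun _ : X => 0 : R) = 0 by rewrite (@rsum_fin _ _ _ fset0)// big_seq_fset0.
have sA x : abs_summable (A x).
  have := abs_summableZ (phi x ^+ 2) (bsum x); congr abs_summable.
  by apply/funext => y; rewrite mulrC.
have rA x : rsum (A x) = phi x ^+ 2 * rsum (b x).
  by rewrite -rsumZ//; congr rsum; apply/funext => y; rewrite mulrC.
have rA0 x : x \notin K -> rsum (A x) = 0 by move=> /sK h; rewrite rA h expr0n mul0r.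
have eA : (\esum_(p in [set: X * X]) (A p.1 p.2)%:E = (\sum_(x <- K) phi x ^+ 2 * rsum (b x))%:E)%E.
  rewrite esum_pair//; last exact: abs_summable_fin rA0.
  by rewrite (rsum_fin rA0); under eq_bigr do rewrite rA.
have A'0r x y : y \notin K -> A y x = 0 by move=> /sK h; rewrite /A h expr0n mulr0.
have [sA' rA'] := @rsum_sum _ _ _ (enum_fset K) (fun y x => A y x) sA.
have eA' : (\esum_(p in [set: X * X]) (A p.2 p.1)%:E = (\sum_(x <- K) phi x ^+ 2 * rsum (b x))%:E)%E.
  have e : (fun x => rsum (fun y => A y x)) = (fun x => \sum_(y <- K) A y x).
    by apply/funext => x; rewrite (@rsum_fin _ _ _ K)//; exact: A'0r.
  rewrite (@esum_pair _ _ (fun x y => A y x))//.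
  - by rewrite e rA'; under eq_bigr do rewrite rA.
  - by move=> x; apply: (@abs_summable_fin _ _ _ K); exact: A'0r.
  - by rewrite e.
have eG (G : X -> X -> R) : (forall x y, 0 <= G x y) -> (forall x, x \notin K -> G x = fun=> 0) ->
    (forall x y, y \notin K -> G x y = 0) ->
    (\esum_(p in [set: X * X]) (G p.1 p.2)%:E = (\sum_(x <- K) \sum_(y <- K) G x y)%:E)%E.
  move=> G0 Gl Gr.
  have rG x : rsum (G x) = \sum_(y <- K) G x y by rewrite (@rsum_fin _ _ _ K)//; exact: Gr.
  have z x : x \notin K -> rsum (G x) = 0 by move=> xK; rewrite Gl// r0.
  rewrite esum_pair//.
  - by rewrite (rsum_fin z); under eq_bigr do rewrite rG.
  - by move=> x; apply: (@abs_summable_fin _ _ _ K); exact: Gr.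
  - exact: abs_summable_fin z.
have eP := eG P P0 P0l P0r; have eN := eG N N0 N0l N0r.
have : (\esum_(p in [set: X * X]) (F p.1 p.2)%:E + \esum_(p in [set: X * X]) (P p.1 p.2)%:E
  = (\esum_(p in [set: X * X]) (A p.1 p.2)%:E + \esum_(p in [set: X * X]) (A p.2 p.1)%:E)
     + \esum_(p in [set: X * X]) (N p.1 p.2)%:E)%E.
  rewrite -!esumD//; try by move=> p _; rewrite lee_fin// addr_ge0.
  apply: eq_esum => -[x y] _ /=; rewrite -!EFinD; congr EFin.
  rewrite /F /P /A /N (bsym y x).
  have : Num.max (c x y) 0 - Num.max (- c x y) 0 = c x y.
    case: (lerP 0 (c x y)) => h; first by rewrite max_r ?oppr_le0// subr0.
    by rewrite max_l ?oppr_ge0 ?ltW// sub0r opprK.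
  move=> h; have -> : Num.max (c x y) 0 = c x y + Num.max (- c x y) 0 by rewrite -[X in X + _]h subrK.
  by rewrite /c; ring.
rewrite eA eA' eP eN -!EFinD.
case EF : (\esum_(p in [set: X * X]) (F p.1 p.2)%:E) => [r||]//= [er].
rewrite /hform -[\esum_(p in _) _]/(\esum_(p in [set: X * X]) (F p.1 p.2)%:E) EF /=.
have z x : x \notin K -> q x * phi x ^+ 2 = 0 by move=> /sK ->; rewrite expr0n mulr0.
rewrite (fsum_fin z) /mform.
have {er} -> : r = (\sum_(x <- K) phi x ^+ 2 * rsum (b x)) *+ 2 - 2 * \sum_(x <- K) \sum_(y <- K) b x y * c x y.
  move/(canRL (addrK _)) : er ->; rewrite mulr2n -addrA; congr (_ + _).
  rewrite -sumrB mulr_sumr -sumrN; apply: eq_bigr => x _.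
  rewrite -sumrB mulr_sumr -sumrN; apply: eq_bigr => y _.
  rewrite /N /P.
  have -> : Num.max (- c x y) 0 = Num.max (c x y) 0 - c x y; last by ring.
  case: (lerP 0 (c x y)) => h; first by rewrite max_r ?oppr_le0// subrr.
  by rewrite max_l ?oppr_ge0 ?ltW// sub0r.
have -> : forall s t : R, 2^-1 * (s *+ 2 - 2 * t) = s - t by move=> s t; field.
rewrite addrAC -big_split/= -sumrB; apply: eq_bigr => x _.
rewrite /vdeg /c; congr (_ - _); first by ring.
by apply: eq_bigr => y _; rewrite mulrA.
Qed.

Lemma finsupp_supp phi : finsupp_fun phi <-> exists K, supp_in K phi.
Proof. exact: finsupp_funP. Qed.

Lemma supp_inS K L phi : (K `<=` L)%fset -> supp_in K phi -> supp_in L phi.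
Proof. by move=> KL h x xL; apply: h; apply: contra xL => /(fsubsetP KL). Qed.

Lemma supp_in_lin K a phi psi : supp_in K phi -> supp_in K psi ->
  supp_in K (fun x => a * phi x + psi x).
Proof. by move=> h1 h2 x xK; rewrite h1// h2// mulr0 addr0. Qed.

Lemma finsupp2 phi psi : finsupp_fun phi -> finsupp_fun psi ->
  exists K, supp_in K phi /\ supp_in K psi.
Proof.
move=> /finsupp_supp[K hK] /finsupp_supp[L hL]; exists (K `|` L)%fset.
by split; [exact: supp_inS (fsubsetUl _ _) hK|exact: supp_inS (fsubsetUr _ _) hL].
Qed.

Lemma finsupp_lin a phi psi : finsupp_fun phi -> finsupp_fun psi ->
  finsupp_fun (fun x => a * phi x + psi x).
Proof.
move=> h1 h2; have [K [sK tK]] := finsupp2 h1 h2; apply/finsupp_supp.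
by exists K; exact: supp_in_lin.
Qed.

Lemma finsuppB phi psi : finsupp_fun phi -> finsupp_fun psi ->
  finsupp_fun (fun x => phi x - psi x).
Proof.
move=> h1 h2; have := finsupp_lin (-1) h2 h1; congr finsupp_fun.
by apply/funext => x; rewrite mulN1r addrC.
Qed.

Lemma finsuppZ a phi : finsupp_fun phi -> finsupp_fun (fun x => a * phi x).
Proof.
move=> /finsupp_supp[K h]; apply/finsupp_supp; exists K => x xK.
by rewrite h// mulr0.
Qed.

Lemma finsupp_indic x : finsupp_fun (\1_[set x] : X -> R).
Proof.
apply/finsupp_supp; exists [fset x]%fset => y.
by rewrite inE indic1E => /negPf ->.
Qed.

Lemma mform_linl K a phi psi f :
  mform K (fun x => a * phi x + psi x) f = a * mform K phi f + mform K psi f.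
Proof.
rewrite /mform mulr_sumr -big_split/=; apply: eq_bigr => x _.
rewrite (_ : \sum_(y <- K) b x y * (a * phi x + psi x) * f y =
  a * (\sum_(y <- K) b x y * phi x * f y) + \sum_(y <- K) b x y * psi x * f y); first by ring.
by rewrite mulr_sumr -big_split/=; apply: eq_bigr => y _; ring.
Qed.

Lemma mformC K phi psi : mform K phi psi = mform K psi phi.
Proof.
rewrite /mform !sumrB; congr (_ - _); first by apply: eq_bigr => x _; ring.
rewrite exchange_big/=; apply: eq_bigr => x _; apply: eq_bigr => y _.
by rewrite bsym; ring.
Qed.

(** Polarization, with the same shape as [closure_bform], so that the one converges to the other
    termwise. *)
Definition hB phi psi : R :=
  (hform b q (fun x => phi x + psi x) - hform b q (fun x => phi x - psi x)) / 4.

Lemma hB_mform K phi psi : supp_in K phi -> supp_in K psi ->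
  hB phi psi = mform K phi psi.
Proof.
move=> h1 h2; rewrite /hB.
have -> : (fun x => phi x + psi x) = (fun x => 1 * phi x + psi x).
  by apply/funext => x; rewrite mul1r.
have -> : (fun x => phi x - psi x) = (fun x => -1 * psi x + phi x).
  by apply/funext => x; rewrite mulN1r addrC.
rewrite !(@hform_mform K); [|exact: supp_in_lin..].
rewrite !mform_linl !(mformC K _ (fun x => _ + _)) !mform_linl (mformC K psi phi).
by field.
Qed.

Lemma hB_diag phi : finsupp_fun phi -> hB phi phi = hform b q phi.
Proof.
by move=> /finsupp_supp[K h]; rewrite (@hB_mform K)// (@hform_mform K).
Qed.

Lemma hBC phi psi : finsupp_fun phi -> finsupp_fun psi -> hB phi psi = hB psi phi.
Proof.
move=> h1 h2; have [K [sK tK]] := finsupp2 h1 h2.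
by rewrite !(@hB_mform K)// mformC.
Qed.

Lemma hB_linl a phi psi f : finsupp_fun phi -> finsupp_fun psi -> finsupp_fun f ->
  hB (fun x => a * phi x + psi x) f = a * hB phi f + hB psi f.
Proof.
move=> h1 h2 /finsupp_supp[L hL]; have [K [sK tK]] := finsupp2 h1 h2.
have s1 := supp_inS (fsubsetUl K L) sK; have s2 := supp_inS (fsubsetUl K L) tK.
have s3 := supp_inS (fsubsetUr K L) hL.
by rewrite !(@hB_mform (K `|` L)%fset)// ?mform_linl//; exact: supp_in_lin.
Qed.

Lemma hform_lin a phi psi : finsupp_fun phi -> finsupp_fun psi ->
  hform b q (fun x => a * phi x + psi x) =
  a ^+ 2 * hform b q phi + 2 * a * hB phi psi + hform b q psi.
Proof.
move=> h1 h2; have h := finsupp_lin a h1 h2.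
rewrite -!hB_diag// hB_linl// (hBC h1 h) (hBC h2 h) !hB_linl// (hBC h2 h1); ring.
Qed.

Lemma hformZ a phi : finsupp_fun phi ->
  hform b q (fun x => a * phi x) = a ^+ 2 * hform b q phi.
Proof.
move=> h; have z : finsupp_fun (fun _ : X => 0 : R) by apply/finsupp_supp; exists fset0.
have e0 : hform b q (fun _ : X => 0 : R) = 0.
  by rewrite (@hform_mform fset0)// /mform big_seq_fset0.
have e1 : hB phi (fun _ : X => 0 : R) = 0.
  have [K [h1 h2]] := finsupp2 h z; rewrite (@hB_mform K)// /mform big1// => x _.
  by rewrite mulr0 big1 ?subr0// => y _; rewrite mulr0.
have := hform_lin a h z; rewrite e0 e1 mulr0 !addr0 => <-.
by congr hform; apply/funext => x; rewrite addr0.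
Qed.

Lemma hB_indic phi x : finsupp_fun phi ->
  hB phi (\1_[set x]) = vdeg x * phi x - rsum (fun y => b x y * phi y).
Proof.
move=> h; have [K [sK tK]] := finsupp2 h (finsupp_indic x).
have xK : x \in K.
  by apply: contraT => /tK/eqP; rewrite indic1E eqxx oner_eq0.
rewrite hBC//; last exact: finsupp_indic.
rewrite (@hB_mform K)// /mform (bigD1_seq x)//= [X in _ + X]big1 => [|y yx]; last first.
  by rewrite indic1E (negPf yx) !mulr0 mul0r big1 ?subr0// => z _; rewrite mulr0 mul0r.
rewrite addr0 indic1E eqxx mulr1; congr (_ - _).
rewrite (@rsum_fin _ _ _ K) => [|y yK]; last by rewrite sK// mulr0.
by apply: eq_bigr => y _; rewrite mulr1.
Qed.

Lemma formalHE f x : in_F b f ->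
  formalH b q f x = vdeg x * f x - rsum (fun y => b x y * f y).
Proof.
move=> /(_ x) hf; rewrite /formalH /vdeg.
have -> : (fun y => b x y * (f x - f y)) = (fun y => f x * b x y - b x y * f y).
  by apply/funext => y; ring.
by rewrite rsumB ?rsumZ//; [ring|exact: abs_summableZ].
Qed.

(** The diagonal terms do not change, and the products subtracted with the weights [b x y >= 0] can
    only grow. *)
Lemma hform_norm phi : finsupp_fun phi ->
  hform b q (fun x => `|phi x|) <= hform b q phi.
Proof.
move=> /finsupp_supp[K h]; rewrite !(@hform_mform K)//; last by move=> x /h ->; rewrite normr0.
apply: ler_sum => x _; rewrite -!mulrA -!expr2 real_normK ?num_real// lerB//.
apply: ler_sum => y _; rewrite -!mulrA ler_wpM2l//.
by rewrite -normrM ler_norm.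
Qed.

Section Ground.
Variable v : X -> R.
Hypotheses (v0 : forall x, 0 < v x) (vF : in_F b v)
  (vH : forall x, 0 <= formalH b q v x).

(** Ground state transform: symmetrizing [b x y * v y / v x * phi x ^+ 2] in [x] and [y] completes
    the squares of the increments of [phi / v]. The killing coefficient sums over [K] only, so the
    identity is finite. *)
Lemma ground_mform K phi : mform K phi phi =
  \sum_(x <- K) (vdeg x * v x - \sum_(y <- K) b x y * v y) / v x * phi x ^+ 2
  + 2^-1 * \sum_(x <- K) \sum_(y <- K)
      b x y * v x * v y * (phi x / v x - phi y / v y) ^+ 2.
Proof.
have E : \sum_(x <- K) \sum_(y <- K) b x y * v x * v y * (phi x / v x - phi y / v y) ^+ 2 =
    2 * \sum_(x <- K) \sum_(y <- K) (b x y * v y / v x * phi x ^+ 2 - b x y * phi x * phi y).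
  transitivity (\sum_(x <- K) \sum_(y <- K) (b x y * v y / v x * phi x ^+ 2 - b x y * phi x * phi y)
     + \sum_(x <- K) \sum_(y <- K) (b y x * v x / v y * phi y ^+ 2 - b y x * phi y * phi x)).
    rewrite -big_split/=; apply: eq_bigr => x _; rewrite -big_split/=; apply: eq_bigr => y _.
    by rewrite (bsym y x); field; rewrite !gt_eqF.
  by rewrite [X in _ + X]exchange_big/= mulr_natl mulr2n.
rewrite E mulrA mulVf ?pnatr_eq0// mul1r /mform -big_split/=; apply: eq_bigr => x _.
rewrite sumrB addrA -mulr_suml -mulr_suml.
by congr (_ - _); field; rewrite gt_eqF.
Qed.

(** Dropping the neighbours outside [K] raises the coefficient, so the finite killing terms inherit
    the sign of [H v]. *)
Lemma killing_ge K x : formalH b q v x <= vdeg x * v x - \sum_(y <- K) b x y * v y.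
Proof.
rewrite formalHE// lerB// rsum_ge_fin// => y; rewrite mulr_ge0// ltW//.
Qed.

Let kill0 K x : 0 <= (vdeg x * v x - \sum_(y <- K) b x y * v y) / v x.
Proof. by apply: divr_ge0; [exact: le_trans (vH x) (killing_ge K x)|exact: ltW]. Qed.

Let edge0 phi x y : 0 <= b x y * v x * v y * (phi x / v x - phi y / v y) ^+ 2.
Proof.
apply: mulr_ge0; last exact: sqr_ge0.
by apply: mulr_ge0; [apply: mulr_ge0; last exact: ltW|exact: ltW].
Qed.

Lemma big_ge0_fset (F : X -> R) K x : (forall x, 0 <= F x) -> x \in K ->
  F x <= \sum_(x <- K) F x.
Proof. by move=> F0 xK; rewrite (bigD1_seq x)//= lerDl sumr_ge0. Qed.

Lemma big_ge0_fset2 (F : X -> R) K x y : (forall x, 0 <= F x) -> x != y ->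
  x \in K -> y \in K -> F x + F y <= \sum_(x <- K) F x.
Proof.
move=> F0 xy xK yK; rewrite (bigD1_seq x)//= lerD2l -big_filter (bigD1_seq y)/=.
- by rewrite lerDl sumr_ge0.
- by rewrite mem_filter eq_sym xy.
- by rewrite filter_uniq.
Qed.

Lemma ground_kill phi x : finsupp_fun phi ->
  formalH b q v x / v x * phi x ^+ 2 <= hform b q phi.
Proof.
move=> h; have [K [sK tK]] := finsupp2 h (finsupp_indic x).
have xK : x \in K by apply: contraT => /tK/eqP; rewrite indic1E eqxx oner_eq0.
rewrite (@hform_mform K)// ground_mform.
apply: (@le_trans _ _ ((vdeg x * v x - \sum_(y <- K) b x y * v y) / v x * phi x ^+ 2)).
  by rewrite ler_wpM2r ?sqr_ge0// ler_pM2r ?invr_gt0// killing_ge.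
apply: (@le_trans _ _ (\sum_(x <- K) (vdeg x * v x - \sum_(y <- K) b x y * v y) / v x * phi x ^+ 2)).
  apply: (@big_ge0_fset (fun x => (vdeg x * v x - \sum_(y <- K) b x y * v y) / v x * phi x ^+ 2)) => // y.
  by rewrite mulr_ge0 ?sqr_ge0.
rewrite lerDl mulr_ge0 ?invr_ge0// sumr_ge0// => y _; rewrite sumr_ge0//.
Qed.

(** The factor 1/2 is absorbed because the edge occurs twice, in the row of [x] and in the row of
    [y]. *)
Lemma ground_edge phi x y : finsupp_fun phi ->
  b x y * v x * v y * (phi x / v x - phi y / v y) ^+ 2 <= hform b q phi.
Proof.
move=> h; have [K0 [sK0 tK0]] := finsupp2 h (finsupp_indic x).
set K := (K0 `|` [fset x; y])%fset.
have sK : supp_in K phi by exact: supp_inS (fsubsetUl _ _) sK0.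
have xK : x \in K by rewrite !inE eqxx orbT.
have yK : y \in K by rewrite !inE eqxx !orbT.
rewrite (@hform_mform K)// ground_mform.
apply: ler_wpDl; first by apply: sumr_ge0 => z _; rewrite mulr_ge0 ?sqr_ge0.
have [<-|xy] := eqVneq x y.
  rewrite subrr expr0n mulr0 mulr_ge0 ?invr_ge0// sumr_ge0// => z _; exact: sumr_ge0.
have h1 := @big_ge0_fset (fun z => b x z * v x * v z * (phi x / v x - phi z / v z) ^+ 2) K y (edge0 phi x) yK.
have h2 := @big_ge0_fset (fun z => b y z * v y * v z * (phi y / v y - phi z / v z) ^+ 2) K x (edge0 phi y) xK.
have h3 := @big_ge0_fset2 (fun z => \sum_(i <- K) b z i * v z * v i * (phi z / v z - phi i / v i) ^+ 2)
  K x y (fun z => sumr_ge0 _ (fun i _ => edge0 phi z i)) xy xK yK.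
move: h1 h2 h3; rewrite /= (bsym y x).
have -> : b x y * v y * v x * (phi y / v y - phi x / v x) ^+ 2 =
  b x y * v x * v y * (phi x / v x - phi y / v y) ^+ 2 by ring.
lra.
Qed.

(** In terms of [f = phi / v] the truncation is [min f 1], which shrinks both [f^2] and every
    increment of [f]. *)
Lemma ground_min phi : finsupp_fun phi -> (forall x, 0 <= phi x) ->
  hform b q (fun x => Num.min (phi x) (v x)) <= hform b q phi.
Proof.
move=> /finsupp_supp[K h] p0.
have hm : supp_in K (fun x => Num.min (phi x) (v x)).
  by move=> x /h ->; rewrite min_l// ltW.
rewrite !(@hform_mform K)// !ground_mform.
have e x : Num.min (phi x) (v x) / v x = Num.min (phi x / v x) 1.
  by rewrite minr_pMl ?invr_ge0 ?(ltW (v0 x))// divff ?gt_eqF.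
apply: lerD.
  apply: ler_sum => x _; apply: ler_wpM2l => //.
  by rewrite ler_sqr ?nnegrE ?ge_min ?lexx// le_min p0 ltW.
rewrite ler_wpM2l ?invr_ge0//; apply: ler_sum => x _; apply: ler_sum => y _.
rewrite ler_wpM2l ?mulr_ge0 ?(ltW (v0 _))// !e.
set s := phi x / v x; set t := phi y / v y.
rewrite -(real_normK (num_real (_ - _))) -[leRHS](real_normK (num_real _)).
rewrite ler_sqr ?nnegrE//.
case: (lerP s 1) => s1; case: (lerP t 1) => t1 //.
- rewrite !ler0_norm; lra.
- rewrite !ger0_norm; lra.
- by rewrite subrr normr0.
Qed.

End Ground.

End FormMatrix.

Lemma cvgr_unique (R : realType) (s : nat -> R) (l m : R) :
  s n @[n --> \oo] --> l -> s n @[n --> \oo] --> m -> l = m.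
Proof. by move=> c1 c2; rewrite -(cvg_lim _ c1)// (cvg_lim _ c2). Qed.

Section FormClosure.
Context {R : realType} {X : choiceType} (b : X -> X -> R) (q : X -> R).
Hypotheses (bgraph : is_graph b) (hge0 : hform_ge0 b q).
Implicit Types (f g u v phi psi : X -> R) (K L : {fset X}).

Local Notation h := (hform b q).
Local Notation B := (hB b q).
Local Notation E := (closure_bform b q).
Local Notation D := (closure_dom b q).

Let hn phi : R := Num.sqrt (h phi).

Lemma hB_CS phi psi : finsupp_fun phi -> finsupp_fun psi ->
  B phi psi ^+ 2 <= h phi * h psi.
Proof.
move=> f1 f2; apply: discr_le => t.
have := hge0 (finsupp_lin t f1 f2); rewrite (hform_lin q bgraph)//.
by congr (0 <= _); ring.
Qed.

Lemma hform_sub phi psi : finsupp_fun phi -> finsupp_fun psi ->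
  h (fun x => phi x - psi x) = h phi - 2 * B phi psi + h psi.
Proof.
move=> f1 f2; have -> : (fun x => phi x - psi x) = (fun x => -1 * psi x + phi x).
  by apply/funext => x; rewrite mulN1r addrC.
by rewrite (hform_lin q bgraph)// (hBC q bgraph f2 f1); ring.
Qed.

Let hn_ge0 phi : 0 <= hn phi. Proof. exact: sqrtr_ge0. Qed.

Let hn_sqr phi : finsupp_fun phi -> hn phi ^+ 2 = h phi.
Proof. by move=> f1; rewrite sqr_sqrtr// hge0. Qed.

Let hn_dist phi psi : finsupp_fun phi -> finsupp_fun psi ->
  `|hn phi - hn psi| <= hn (fun x => phi x - psi x).
Proof.
move=> f1 f2; apply: ler_sqr_nneg => //; have f3 := finsuppB f1 f2.
rewrite real_normK ?num_real// hn_sqr// hform_sub// -!hn_sqr//.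
suff : B phi psi <= hn phi * hn psi by lra.
apply: ler_sqr_nneg; first by rewrite mulr_ge0.
by rewrite [leRHS]exprMn !hn_sqr// hB_CS.
Qed.

(** The operator [H] on l^2, written with an inner product so that convergence in l^2 applies
    directly. *)
Definition Hop u x := vdeg b q x * u x - inner2 (b x) u.

(** Summation by parts; for a fixed test function only finitely many values of [H phi] enter. *)
Lemma hB_test K phi psi : finsupp_fun phi -> supp_in K psi ->
  B phi psi = \sum_(x <- K) psi x * Hop phi x.
Proof.
move=> f1 s2; have f2 : finsupp_fun psi by apply/finsupp_supp; exists K.
have [L [sL tL]] := finsupp2 f1 f2.
have e : B phi psi = \sum_(x <- (K `|` L)%fset) psi x * Hop phi x.
  rewrite (hBC q bgraph f1 f2) (@hB_mform _ _ _ _ bgraph (K `|` L)%fset); last first.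
  - exact: supp_inS (fsubsetUr _ _) sL.
  - exact: supp_inS (fsubsetUl _ _) s2.
  rewrite /mform; apply: eq_bigr => x _; rewrite /Hop mulrBr; congr (_ - _); first by ring.
  rewrite /inner2 (@rsum_fin _ _ _ (K `|` L)%fset) => [|y yKL]; last first.
    by rewrite (supp_inS (fsubsetUr K L) sL)// mulr0.
  by rewrite mulr_sumr; apply: eq_bigr => y _; ring.
have z x : x \notin K -> psi x * Hop phi x = 0 by move=> /s2 ->; rewrite mul0r.
have z' : supp_in (K `|` L)%fset (fun x => psi x * Hop phi x).
  exact: supp_inS (fsubsetUl K L) z.
by rewrite e (hasum_unique (finsuppE z') (finsuppE z)).
Qed.

Lemma Hop_cvg (phi : nat -> X -> R) u x : (forall n, ell2 (phi n)) -> ell2 u ->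
  l2cvg phi u -> Hop (phi n) x @[n --> \oo] --> Hop u x.
Proof.
move=> l lu c; apply: cvgB; first by apply: cvgM; [exact: cvg_cst|exact: l2cvg_pt].
have lb := ell2_edge bgraph x.
by apply: (@l2cvg_inner _ _ (fun=> b x) phi (b x) u) => //; exact: l2cvg_cst.
Qed.

Definition hcauchy (phi : nat -> X -> R) :=
  forall eps : R, 0 < eps -> exists N, forall n m, (N <= n)%N -> (N <= m)%N ->
    h (fun x => phi n x - phi m x) < eps.

(** For fixed [n], [B (phi m) (phi n)] tends to 0 as [m] grows, being a finite sum of values of
    [H (phi m)]. Since [h (phi m) >= 0], [h (phi n)] is at most
    [h (phi n - phi m) + 2 B (phi m) (phi n)]. *)
Lemma form_closable (phi : nat -> X -> R) : (forall n, finsupp_fun (phi n)) ->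
  l2cvg phi (fun=> 0) -> hcauchy phi -> h (phi n) @[n --> \oo] --> (0 : R).
Proof.
move=> fp c0 hc; apply/cvgrPdist_le => e e0; have [N hN] := hc e e0.
exists N => // n /= Nn; rewrite sub0r normrN ger0_norm ?hge0//.
have /finsupp_supp[K sK] := fp n.
have cB : B (phi m) (phi n) @[m --> \oo] --> (0 : R).
  rewrite (_ : 0 = \sum_(x <- K) phi n x * Hop (fun=> 0) x); last first.
    rewrite big1// => x _; rewrite /Hop /inner2 (@rsum_fin _ _ _ fset0) => [|y _]; last by rewrite mulr0.
    by rewrite big_seq_fset0 mulr0 subr0 mulr0.
  under eq_fun => m do rewrite (hB_test (fp m) sK).
  apply: cvg_sumr => x; apply: cvgM; first exact: cvg_cst.
  by apply: Hop_cvg => //; [move=> m; exact: ell2_finsupp|exact: ell2_0].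
apply/ler_addgt0Pr => d d0.
move/cvgrPdist_lt : cB => /(_ (d / 2)) []; first by rewrite divr_gt0.
move=> M _ hM; have := hM (maxn N M) (leq_maxr _ _); rewrite sub0r normrN => /ltW /ler_normlP[_ hm].
have := hN n (maxn N M) Nn (leq_maxl _ _).
rewrite hform_sub// (hBC q bgraph)//; have := hge0 (fp (maxn N M)).
by move: hm; lra.
Qed.

Local Notation approx := (closure_approx b q).

Lemma approx_lin a u v (phi psi : nat -> X -> R) : approx u phi -> approx v psi ->
  approx (fun x => a * u x + v x) (fun n x => a * phi n x + psi n x).
Proof.
move=> au av; have [u2 fu cu hu] := au; have [v2 fv cv hv] := av; split.
- exact: ell2_lin.
- by move=> n; exact: (finsupp_lin).
- by apply: l2cvg_lin => // n; exact: ell2_finsupp.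
move=> e e0; have a1 : 0 < a ^+ 2 + 1 by rewrite ltr_wpDl ?sqr_ge0.
have e1 : 0 < e / 4 / (a ^+ 2 + 1) by rewrite !divr_gt0.
have [N hN] := hu _ e1; have [M hM] := hv (e / 4) (divr_gt0 e0 (ltr0Sn _ 3)).
exists (maxn N M) => n m; rewrite !geq_max => /andP[Nn Mn] /andP[Nm Mm].
have f1 := finsuppB (fu n) (fu m); have f2 := finsuppB (fv n) (fv m).
have -> : (fun x => a * phi n x + psi n x - (a * phi m x + psi m x)) =
  (fun x => a * (phi n x - phi m x) + (psi n x - psi m x)) by apply/funext => x; ring.
(* Nonnegativity at [- a] bounds the mixed term and gives [h (a f + g) <= 2 (a^2 h f + h g)], which
   the choice of [e / 4] anticipates. *)
have := hge0 (finsupp_lin (- a) f1 f2).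
have := hN n m Nn Nm; have := hM n m Mn Mm.
rewrite !(hform_lin q bgraph)//; set s := h _; set t := h _ => hs.
rewrite ltr_pdivlMr// => ht; have := hge0 f1; rewrite -/t => t0.
rewrite sqrrN; move: ht hs t0; set w := B _ _.
by move=> *; nra.
Qed.

Lemma approx_fin phi : finsupp_fun phi -> approx phi (fun=> phi).
Proof.
move=> f1; split => //; first exact: ell2_finsupp.
  exact: l2cvg_cst.
move=> e e0; exists 0%N => n m _ _; rewrite hform_sub// hB_diag//.
by rewrite (_ : _ + _ = 0)//; ring.
Qed.

(** The square root of [h] is a seminorm, so it is Cauchy along an approximation. *)
Lemma approx_is_cvg u (phi : nat -> X -> R) : approx u phi -> cvgn (fun n => h (phi n)).
Proof.
move=> [u2 fu cu hu].
have cn : cvgn (fun n => hn (phi n)).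
  apply/cauchy_cvgP/cauchy_exP => e e0.
  have [N hN] := hu (e ^+ 2) (exprn_gt0 2 e0); exists (hn (phi N)), N => // n /= Nn.
  apply: le_lt_trans (hn_dist (fu N) (fu n)) _.
  rewrite -(ltr_pXn2r (ltn0Sn 1)) ?nnegrE ?hn_ge0 ?ltW// hn_sqr; last exact: finsuppB.
  exact: hN.
apply/cvg_ex; exists (limn (fun n => hn (phi n)) * limn (fun n => hn (phi n))).
under eq_fun => n do rewrite -(hn_sqr (fu n)) expr2.
by apply: cvgM.
Qed.

(** The difference of two approximations of [u] is an [h]-Cauchy sequence tending to 0 in l^2, so
    closability applies. This determines the value chosen by [get] in [closure_form]. *)
Lemma approx_unique u (phi psi : nat -> X -> R) (l m : R) : approx u phi -> approx u psi ->
  h (phi n) @[n --> \oo] --> l -> h (psi n) @[n --> \oo] --> m -> l = m.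
Proof.
move=> au av cl cm; have [u2 fu cu hu] := au; have [v2 fv cv hv] := av.
have ac := approx_lin (-1) au av; have [w2 fw cw hw] := ac.
have c0 : h (fun x => -1 * phi n x + psi n x) @[n --> \oo] --> (0 : R).
  have cw' : l2cvg (fun n x => -1 * phi n x + psi n x) (fun=> 0).
    have : l2cvg (fun n x => -1 * phi n x + psi n x) (fun x => -1 * u x + u x) := cw.
    by congr l2cvg; apply/funext => x; rewrite mulN1r addNr.
  exact: (form_closable fw cw' hw).
have cs (s : nat -> R) (r : R) : s n @[n --> \oo] --> r ->
    Num.sqrt (s n) @[n --> \oo] --> Num.sqrt r.
  by move=> sr; apply: continuous_cvg => //; exact: sqrt_continuous.
have l0 : 0 <= l.
  rewrite -(cvg_lim _ cl)//; apply: limr_ge; first by apply/cvg_ex; exists l.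
  by apply: nearW => n; exact: hge0.
have m0 : 0 <= m.
  rewrite -(cvg_lim _ cm)//; apply: limr_ge; first by apply/cvg_ex; exists m.
  by apply: nearW => n; exact: hge0.
suff : Num.sqrt l = Num.sqrt m.
  by move=> /(congr1 (fun x => x ^+ 2)); rewrite !sqr_sqrtr.
have c1 : hn (phi n) @[n --> \oo] --> Num.sqrt l := cs _ _ cl.
have c2 : hn (psi n) @[n --> \oo] --> Num.sqrt m := cs _ _ cm.
have c3 : Num.sqrt (h (fun x => -1 * phi n x + psi n x)) @[n --> \oo] --> (0 : R).
  by rewrite -sqrtr0; exact: cs.
have c4 : hn (phi n) - hn (psi n) @[n --> \oo] --> (0 : R).
  apply: (cvg_dist_le _ c3) => n; rewrite subr0 distrC.
  have := hn_dist (fv n) (fu n); rewrite /hn; congr (_ <= Num.sqrt (h _)).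
  by apply/funext => x; rewrite mulN1r addrC.
apply/eqP; rewrite -subr_eq0; apply/eqP.
have c5 : hn (phi n) - hn (psi n) @[n --> \oo] --> Num.sqrt l - Num.sqrt m by exact: cvgB.
by rewrite -(cvg_lim _ c5)// (cvg_lim _ c4).
Qed.

Lemma closure_form_cvg u (phi : nat -> X -> R) : approx u phi ->
  h (phi n) @[n --> \oo] --> closure_form b q u.
Proof.
move=> au; have cv := approx_is_cvg au.
set S := [set a : R | exists2 phi, approx u phi & h (phi n) @[n --> \oo] --> a].
have : S (closure_form b q u).
  rewrite /closure_form; apply: getPex; exists (limn (fun n => h (phi n))).
  by exists phi.
move=> [psi ap cp]; by rewrite -(approx_unique au ap cv cp).
Qed.

Lemma closure_bform_cvg u v (phi psi : nat -> X -> R) : approx u phi -> approx v psi ->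
  B (phi n) (psi n) @[n --> \oo] --> E u v.
Proof.
move=> au av; rewrite /hB /closure_bform; apply: cvgM; last exact: cvg_cst.
have a1 : approx (fun x => u x + v x) (fun n x => phi n x + psi n x).
  have := approx_lin 1 au av; congr closure_approx; apply/funext => x.
    by rewrite mul1r.
  by apply/funext => y; rewrite mul1r.
have a2 : approx (fun x => u x - v x) (fun n x => phi n x - psi n x).
  have := approx_lin (-1) av au; congr closure_approx; apply/funext => x.
    by rewrite mulN1r addrC.
  by apply/funext => y; rewrite mulN1r addrC.
by apply: cvgB; exact: closure_form_cvg.
Qed.

Lemma closure_dom_ell2 u : D u -> ell2 u.
Proof. by move=> [phi []]. Qed.

Lemma closure_dom_fin phi : finsupp_fun phi -> D phi.
Proof. by move=> /approx_fin; exists (fun=> phi). Qed.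

Lemma closure_dom_lin a u v : D u -> D v -> D (fun x => a * u x + v x).
Proof.
move=> [phi au] [psi av]; exists (fun n x => a * phi n x + psi n x).
exact: approx_lin.
Qed.

Lemma closure_bformC u v : D u -> D v -> E u v = E v u.
Proof.
move=> [phi au] [psi av].
have c1 := closure_bform_cvg au av; apply: cvgr_unique (closure_bform_cvg av au).
have [_ fu _ _] := au; have [_ fv _ _] := av; move: c1.
by under eq_fun => n do rewrite (hBC q bgraph (fu n) (fv n)).
Qed.

Lemma closure_bform_linl a u v f : D u -> D v -> D f ->
  E (fun x => a * u x + v x) f = a * E u f + E v f.
Proof.
move=> [phi au] [psi av] [g af].
have c1 := closure_bform_cvg (approx_lin a au av) af.
apply: cvgr_unique c1 _.
have -> : (fun n => B (fun x => a * phi n x + psi n x) (g n)) =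
  (fun n => a * B (phi n) (g n) + B (psi n) (g n)).
  apply/funext => n; rewrite (hB_linl q bgraph)//.
  - by case: au.
  - by case: av.
  - by case: af.
apply: cvgD; last exact: closure_bform_cvg.
by apply: cvgM; [exact: cvg_cst|exact: closure_bform_cvg].
Qed.

(** Transfers two pointwise lower bounds from finitely supported functions to the form domain: the
    edge term, with [s] and [t] the reciprocals of [v] up to sign, and the capacity, with
    [t = 0]. *)
Lemma closure_bform_ge (c s t : R) x y u : D u ->
  (forall phi, finsupp_fun phi -> c * (s * phi x + t * phi y) ^+ 2 <= h phi) ->
  c * (s * u x + t * u y) ^+ 2 <= E u u.
Proof.
move=> [phi au] hc; have [u2 fu cu _] := au.
have c1 : c * (s * phi n x + t * phi n y) ^+ 2 @[n --> \oo] --> c * (s * u x + t * u y) ^+ 2.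
  have cp z : phi n z @[n --> \oo] --> u z by apply: l2cvg_pt => // n; exact: ell2_finsupp.
  apply: cvgM; first exact: cvg_cst.
  have c2 : s * phi n x + t * phi n y @[n --> \oo] --> s * u x + t * u y.
    by apply: cvgD; apply: cvgM => //; exact: cvg_cst.
  by rewrite expr2; under eq_fun do rewrite expr2; exact: cvgM.
apply: (ler_cvg_to c1 (closure_bform_cvg au au)).
by apply: nearW => n; rewrite (hB_diag q bgraph)//; exact: hc.
Qed.

Lemma closure_bform_ge0 u : D u -> 0 <= E u u.
Proof.
move=> [phi au]; have [_ fu _ _] := au.
apply: (ler_cvg_to (cvg_cst 0) (closure_bform_cvg au au)).
by apply: nearW => n; rewrite (hB_diag q bgraph)//; exact: hge0.
Qed.

Lemma closure_bform_fin phi psi : finsupp_fun phi -> finsupp_fun psi ->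
  E phi psi = B phi psi.
Proof.
move=> f1 f2; have c := closure_bform_cvg (approx_fin f1) (approx_fin f2).
by apply: cvgr_unique c _; exact: cvg_cst.
Qed.

Lemma closure_bform_indic u x : D u -> E u (\1_[set x]) = Hop u x.
Proof.
move=> [phi au]; have [u2 fu cu _] := au; have fx := @finsupp_indic R X x.
have c := closure_bform_cvg au (approx_fin fx).
apply: cvgr_unique c _.
under eq_fun => n do rewrite (hB_indic q bgraph x (fu n)).
exact: (@Hop_cvg phi u x (fun n => ell2_finsupp (fu n)) u2 cu).
Qed.

Lemma closure_bform_CS u v : D u -> D v -> E u v ^+ 2 <= E u u * E v v.
Proof.
move=> du dv; apply: discr_le => t; have dw := closure_dom_lin t du dv.
have := closure_bform_ge0 dw; rewrite (closure_bform_linl t du dv dw) (closure_bformC du dw).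
rewrite (closure_bformC dv dw) (closure_bform_linl t du dv du) (closure_bform_linl t du dv dv).
rewrite (closure_bformC dv du); move: (E u u) (E u v) (E v v) => a c d.
by congr (0 <= _); ring.
Qed.

End FormClosure.

(** * Variational construction of the resolvent *)

Section Resolvent.
Context {R : realType} {X : choiceType} (b : X -> X -> R) (q : X -> R).
Hypotheses (bgraph : is_graph b) (hge0 : hform_ge0 b q).
Implicit Types (f g u v phi psi : X -> R) (K L : {fset X}).

Local Notation h := (hform b q).
Local Notation B := (hB b q).
Local Notation E := (closure_bform b q).
Local Notation D := (closure_dom b q).

(** The equation [(H1 + mu) u = f] in weak form. *)
Definition weak_resolvent (mu : R) f u :=
  D u /\ forall v, D v -> E u v + mu * inner2 u v = inner2 f v.

Lemma inner2_eq0 u : ell2 u -> inner2 u u <= 0 -> u = fun=> 0.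
Proof.
move=> hu u0; apply/funext => x; apply/eqP; rewrite -sqrf_eq0 eq_le sqr_ge0 andbT.
exact: le_trans (sqr_le_inner2 x hu) u0.
Qed.

Lemma weak_resolvent_unique mu f u v : 0 < mu ->
  weak_resolvent mu f u -> weak_resolvent mu f v -> u = v.
Proof.
move=> mu0 [du hu] [dv hv].
have dw := closure_dom_lin bgraph hge0 (-1) dv du.
have w2 := closure_dom_ell2 dw; have u2 := closure_dom_ell2 du; have v2 := closure_dom_ell2 dv.
set w := (fun x => _) in dw w2.
have : E w w + mu * inner2 w w = 0.
  rewrite {1}/w (closure_bform_linl bgraph hge0)// {2}/w inner2_linl//.
  rewrite (_ : _ + _ = (E u w + mu * inner2 u w) - (E v w + mu * inner2 v w)); last by ring.
  by rewrite hu// hv// subrr.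
have := closure_bform_ge0 bgraph hge0 dw => e0 e1.
have : w = fun=> 0.
  apply: inner2_eq0 => //; rewrite -(pmulr_rle0 _ mu0).
  by move: e0 e1; lra.
move=> w0; apply/funext => x; have := congr1 (fun k => k x) w0.
by rewrite /w mulN1r addrC => /eqP; rewrite subr_eq0 => /eqP.
Qed.

Section Existence.
Variables (mu : R) (f : X -> R).
Hypotheses (mu0 : 0 < mu) (f2 : ell2 f).

Let J phi := h phi + mu * inner2 phi phi - 2 * inner2 f phi.
Let hm phi := h phi + mu * inner2 phi phi.

Let JD t phi psi : finsupp_fun phi -> finsupp_fun psi ->
  J (fun x => t * psi x + phi x) =
  J phi + 2 * t * (B phi psi + mu * inner2 phi psi - inner2 f psi) + t ^+ 2 * hm psi.
Proof.
move=> f1 f3; have l1 := ell2_finsupp f1; have l3 := ell2_finsupp f3.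
have l4 := ell2_lin t l3 l1.
rewrite /J /hm (hform_lin q bgraph)// (hBC q bgraph f3 f1).
rewrite (inner2C f) !inner2_linl// (inner2C psi (fun _ => _)) (inner2C phi (fun _ => _)).
by rewrite !inner2_linl// (inner2C psi phi) (inner2C psi f) (inner2C phi f); ring.
Qed.

(** Completing the square: [- mu phi + f] has nonnegative squared norm. *)
Let J_lb phi : finsupp_fun phi -> - (inner2 f f / mu) <= J phi.
Proof.
move=> f1; have l1 := ell2_finsupp f1; have := inner2_ge0 (ell2_lin (- mu) l1 f2).
have l4 := ell2_lin (- mu) l1 f2.
rewrite inner2_linl// (inner2C phi (fun _ => _)) (inner2C f (fun _ => _)) !inner2_linl//.
rewrite (inner2C phi f) => H; have h0 := hge0 f1.
rewrite /J -(ler_pM2l mu0) mulrN mulrC divfK ?gt_eqF//.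
by move: H (mulr_ge0 (ltW mu0) h0); lra.
Qed.

Let S := [set J phi | phi in [set phi | finsupp_fun phi]].

Let S_inf : has_inf S.
Proof.
split; first by exists (J (fun=> 0)), (fun=> 0) => //; apply/finsupp_supp; exists fset0.
by exists (- (inner2 f f / mu)) => _ [phi f1 <-]; exact: J_lb.
Qed.

Let J_norm phi : finsupp_fun phi -> (forall x, 0 <= f x) ->
  J (fun x => `|phi x|) <= J phi.
Proof.
move=> f1 f0; have l1 := ell2_finsupp f1.
have f3 : finsupp_fun (fun x => `|phi x|).
  move/finsupp_supp : f1 => [K hK]; apply/finsupp_supp; exists K => x /hK ->.
  by rewrite normr0.
have l3 := ell2_finsupp f3.
apply: lerB; first apply: lerD; first exact: hform_norm.
  have -> : inner2 (fun x => `|phi x|) (fun x => `|phi x|) = inner2 phi phi => //.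
  by congr rsum; apply/funext => x; rewrite -normrM -expr2 ger0_norm ?sqr_ge0.
rewrite ler_wpM2l// /inner2; apply: rsum_le; [exact: ell2_mul|exact: ell2_mul|].
by move=> x; rewrite ler_wpM2l// ler_norm.
Qed.

(** [J] is minimized over finitely supported functions, where the infimum need not be attained; a
    minimizing sequence is shown to be Cauchy in the form norm. For [f >= 0] it may be taken
    nonnegative, since passing to absolute values does not increase [J]. *)
Lemma weak_resolvent_ex : exists2 u, weak_resolvent mu f u &
  (forall x, 0 <= f x) -> forall x, 0 <= u x.
Proof.
pose d n : R := n.+1%:R^-1.
have d0 n : 0 < d n by rewrite invr_gt0.
have dcvg : d n @[n --> \oo] --> (0 : R) by exact: cvg_harmonic.
have ex n : exists phi, [/\ finsupp_fun phi, J phi <= inf S + d n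
    & (forall x, 0 <= f x) -> forall x, 0 <= phi x].
  have [_ [phi f1 <-] lt] := inf_adherent (d0 n) S_inf.
  have [f0|f0] := pselect (forall x, 0 <= f x); last by exists phi; split=> //; exact: ltW.
  exists (fun x => `|phi x|); split => //.
    move/finsupp_supp : f1 => [K hK]; apply/finsupp_supp; exists K => x /hK ->.
    by rewrite normr0.
  exact: le_trans (J_norm f1 f0) (ltW lt).
have [phi hphi] := choice ex.
have fp n : finsupp_fun (phi n) by case: (hphi n).
(* If [J (phi n)] is within [d n] of the infimum, the quadratic [t^2 hm psi + 2 t D + d n] in [t] is
   nonnegative, where [D] is the first variation; its discriminant bounds [D]. *)
have nearly n psi : finsupp_fun psi ->
    (B (phi n) psi + mu * inner2 (phi n) psi - inner2 f psi) ^+ 2 <= d n * hm psi.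
  move=> f3; rewrite [leRHS]mulrC; apply: discr_le => t.
  have : inf S <= J (fun x => t * psi x + phi n x).
    apply: ge_inf; first by case: S_inf.
    by eexists; last reflexivity; exact: finsupp_lin.
  rewrite JD//; have [_ le _] := hphi n => H.
  have {}H := le_trans H (lerD (lerD le (lexx _)) (lexx _)).
  move: H; rewrite -!addrA lerDl; congr (0 <= _); ring.
have hm_ge0 psi : finsupp_fun psi -> 0 <= hm psi.
  move=> f3; apply: addr_ge0; first exact: hge0.
  by apply: mulr_ge0; [exact: ltW|apply: inner2_ge0; exact: ell2_finsupp].
(* [hm psi] is the difference of the first variations at [phi n] and [phi m], each of square at most
   [d * hm psi]; one factor [hm psi] cancels. *)
have C n m : hm (fun x => phi n x - phi m x) <= 2 * (d n + d m).
  set psi := (fun x => _); have f3 : finsupp_fun psi by exact: finsuppB.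
  have e : hm psi = (B (phi n) psi + mu * inner2 (phi n) psi - inner2 f psi)
                   - (B (phi m) psi + mu * inner2 (phi m) psi - inner2 f psi).
    have e1 : h psi = B (phi n) psi - B (phi m) psi.
      rewrite -(hB_diag q bgraph f3) {1}/psi.
      have -> : (fun x => phi n x - phi m x) = (fun x => -1 * phi m x + phi n x).
        by apply/funext => x; rewrite mulN1r addrC.
      by rewrite (hB_linl q bgraph)// mulN1r addrC.
    have e2 : inner2 psi psi = inner2 (phi n) psi - inner2 (phi m) psi.
      by rewrite {1}/psi inner2Bl//; exact: ell2_finsupp.
    by rewrite /hm e1 e2; ring.
  have [hm0|hm0] := eqVneq (hm psi) 0.
    by rewrite hm0 mulr_ge0// addr_ge0// ltW.
  have hp : 0 < hm psi by rewrite lt_neqAle eq_sym hm0 hm_ge0.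
  rewrite -(ler_pM2r hp); have := nearly n psi f3; have := nearly m psi f3.
  move: e; set a := (B (phi n) psi + _ - _); set c := (B (phi m) psi + _ - _) => e.
  have -> : hm psi * hm psi = (a - c) ^+ 2 by rewrite -e expr2.
  by move: (hm psi) => Y; have := sqr_ge0 (a + c); lra.
have Cc e : 0 < e -> exists N, forall n m, (N <= n)%N -> (N <= m)%N ->
    hm (fun x => phi n x - phi m x) < e.
  move=> e0; move/cvgrPdist_lt : dcvg => /(_ (e / 4)) []; first by rewrite divr_gt0.
  move=> N _ hN; exists N => n m /hN + /hN; rewrite !sub0r !normrN !ger0_norm ?ltW// => h1 h2.
  by apply: le_lt_trans (C n m) _; lra.
have fd n m : finsupp_fun (fun x => phi n x - phi m x) by exact: finsuppB.
have [u u2 cu] : exists2 u, ell2 u & l2cvg phi u.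
  apply: l2_complete => [n|e e0]; first exact: ell2_finsupp.
  have [N hN] := Cc (mu * e ^+ 2) (mulr_gt0 mu0 (exprn_gt0 2 e0)).
  exists N => n m Nn Nm; have := hN n m Nn Nm.
  have l3 := ell2_finsupp (fd n m).
  rewrite /hm -(sqr_norm2 l3) => H; have h0 := hge0 (fd n m).
  rewrite -(ltr_pXn2r (ltn0Sn 1)) ?nnegrE ?norm2_ge0 ?ltW//.
  rewrite -(ltr_pM2l mu0); apply: le_lt_trans H; by rewrite lerDr.
have au : closure_approx b q u phi.
  split=> // e e0; have [N hN] := Cc e e0; exists N => n m Nn Nm.
  apply: le_lt_trans (hN n m Nn Nm); rewrite lerDl.
  by apply: mulr_ge0; [exact: ltW|apply: inner2_ge0; exact: ell2_finsupp].
exists u; last first.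
  move=> f0 x; have c : phi n x @[n --> \oo] --> u x.
    by apply: l2cvg_pt => // n; exact: ell2_finsupp.
  apply: (ler_cvg_to (cvg_cst 0) c); apply: nearW => n.
  by have [_ _ /(_ f0)] := hphi n.
split; first by exists phi.
move=> v [psi av]; have [v2 fv cv _] := av.
have lp n : ell2 (phi n) by exact: ell2_finsupp.
have lv n : ell2 (psi n) by exact: ell2_finsupp.
have cI : inner2 (phi n) (psi n) @[n --> \oo] --> inner2 u v by exact: l2cvg_inner.
have cf : inner2 f (psi n) @[n --> \oo] --> inner2 f v.
  by apply: (@l2cvg_inner _ _ (fun=> f)) => //; exact: l2cvg_cst.
have cN : inner2 (psi n) (psi n) @[n --> \oo] --> inner2 v v by exact: l2cvg_inner.
have cB := closure_bform_cvg bgraph hge0 au av.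
have cH := closure_bform_cvg bgraph hge0 av av.
pose s n := B (phi n) (psi n) + mu * inner2 (phi n) (psi n) - inner2 f (psi n).
have c1 : s n @[n --> \oo] --> E u v + mu * inner2 u v - inner2 f v.
  exact: (cvgB (cvgD cB (cvgM (cvg_cst mu) cI)) cf).
have c2 : s n ^+ 2 @[n --> \oo] --> (E u v + mu * inner2 u v - inner2 f v) ^+ 2.
  by rewrite expr2; under eq_fun do rewrite expr2; exact: cvgM.
have c3 : d n * (B (psi n) (psi n) + mu * inner2 (psi n) (psi n)) @[n --> \oo]
    --> 0 * (E v v + mu * inner2 v v).
  exact: (cvgM dcvg (cvgD cH (cvgM (cvg_cst mu) cN))).
have : (E u v + mu * inner2 u v - inner2 f v) ^+ 2 <= 0.
  rewrite -[leRHS](mul0r (E v v + mu * inner2 v v)).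
  apply: (ler_cvg_to c2 c3); apply: nearW => n.
  by have := nearly n _ (fv n); rewrite /hm (hB_diag q bgraph).
move=> le0; apply/eqP; rewrite -subr_eq0 -sqrf_eq0 eq_le le0 sqr_ge0//.
Qed.

End Existence.

Lemma weak_resolvent_H1 mu f u : ell2 f ->
  weak_resolvent mu f u <-> H1 b q u (fun x => f x + - mu * u x).
Proof.
move=> f2; split=> [[du hu]|[du l hu]]; split=> //.
- have u2 := closure_dom_ell2 du; have := ell2_lin (- mu) u2 f2.
  by congr ell2; apply/funext => x; rewrite addrC.
- move=> v dv; have u2 := closure_dom_ell2 du; have v2 := closure_dom_ell2 dv.
  have -> : (fun x => f x + - mu * u x) = (fun x => - mu * u x + f x).
    by apply/funext => x; rewrite addrC.
  by rewrite inner2_linl// -hu//; ring.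
- move=> v dv; have u2 := closure_dom_ell2 du; have v2 := closure_dom_ell2 dv.
  have -> := hu v dv.
  have -> : (fun x => f x + - mu * u x) = (fun x => - mu * u x + f x).
    by apply/funext => x; rewrite addrC.
  by rewrite inner2_linl//; ring.
Qed.

Lemma resolventP mu f : 0 < mu -> ell2 f ->
  weak_resolvent mu f (resolvent (H1 b q) (- mu) f).
Proof.
move=> mu0 f2; apply/weak_resolvent_H1 => //.
have [u /(weak_resolvent_H1 mu u f2) hu _] := weak_resolvent_ex mu0 f2.
rewrite /resolvent; set S := [set u | _].
have : S (get S) by apply: getPex; exists u.
by [].
Qed.

End Resolvent.

(** * Superharmonic functions and capacity *)

Lemma ltr_norm_sqr (R : realType) (a d : R) : 0 < d -> a ^+ 2 < d ^+ 2 -> `|a| < d.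
Proof.
move=> d0; rewrite -(real_normK (num_real a)) ltr_sqr ?nnegrE// ltW//.
Qed.

Lemma ultra_image_filter (S T : Type) (U : set_system S) (e : S -> T) :
  UltraFilter U -> UltraFilter (e @ U).
Proof.
move=> uU; split=> [|G GP UG]; first exact: fmap_proper_filter.
apply/seteqP; split=> // A GA; have [//|UC] := in_ultra_setVsetC (e @^-1` A) uU.
have GC : G (~` A) by exact: UG.
by have [t []] := filter_ex (filterI GA GC).
Qed.

Lemma bounded_ultra_cvg (R : realType) (T : Type) (U : set_system T) (e : T -> R)
    (a c : R) : UltraFilter U -> (forall t, a <= e t <= c) ->
  exists l : R, e t @[t --> U] --> l.
Proof.
move=> uU he; have := @segment_compact R a c; rewrite compact_ultra.
have uE : UltraFilter (e @ U) by exact: ultra_image_filter.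
move=> /(_ (e @ U) uE) []; last by move=> l [_ cl]; exists l.
by apply: (@filterE _ U) => t; rewrite /= in_itv /= he.
Qed.

Section PotentialTheory.
Context {R : realType} {X : choiceType} (b : X -> X -> R).
Hypotheses (bgraph : is_graph b) (bconn : graph_connected b).
Implicit Types (q f g u v phi psi : X -> R) (K L : {fset X}).

Let b0 x y : 0 <= b x y. Proof. by case: bgraph. Qed.
Let bsym x y : b x y = b y x. Proof. by case: bgraph. Qed.

Lemma connected_ind (P : X -> Prop) x :
  (forall y z, 0 < b y z -> P y -> P z) -> P x -> forall y, P y.
Proof.
move=> hP Px y; have [s] := bconn x y.
elim: s x Px => [|z s IH] x Px /=; first by move=> _ <-.
by move=> /andP[/hP/(_ Px) Pz]; exact: IH.
Qed.

(** Minimum principle: at a zero of [u] the value of [H u] is minus the weighted sum of [u] over the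
    neighbours, so they all vanish too; connectedness spreads this. *)
Lemma superharmonic_gt0 q u : positive_fun u -> H_superharmonic b q u ->
  forall x, 0 < u x.
Proof.
move=> [u0 [x ux]] [uF uH] y.
have P z : u z <> 0 -> 0 < u z by move=> /eqP uz; rewrite lt_neqAle eq_sym uz u0.
apply: P; apply: (connected_ind (P := fun z => u z <> 0) (x := x)) => // {}y z byz uy uz.
have := uH z; rewrite formalHE// uz mulr0 sub0r oppr_ge0 => le0.
have h0 t : 0 <= b z t * u t by rewrite mulr_ge0.
have := rsum_ge_fin [fset y]%fset (uF z) h0; rewrite big_seq_fset1 => /le_trans/(_ le0).
rewrite bsym pmulr_rle0// => uy0; apply: uy; apply/eqP.
by rewrite eq_le uy0 u0.
Qed.

(** The edge term bounds the squared difference of [e t / v] across an edge by a multiple of the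
    energy, so the limit at [x] propagates along paths. The filter is arbitrary because sequences,
    the spectral parameter and time all occur. *)
Lemma null_family_cvg q (hge0 : hform_ge0 b q) v (T : Type) (F : set_system T)
    {FF : Filter F} (e : T -> X -> R) (x : X) (a : R) :
  positive_fun v -> H_superharmonic b q v ->
  (\forall t \near F, closure_dom b q (e t)) ->
  closure_bform b q (e t) (e t) @[t --> F] --> (0 : R) ->
  e t x @[t --> F] --> a ->
  forall y, e t y @[t --> F] --> a * v y / v x.
Proof.
move=> vp vs eD e0 ea; have v0 := superharmonic_gt0 vp vs; have [vF vH] := vs.
have main : forall y, e t y / v y @[t --> F] --> a / v x.
  apply: (connected_ind (P := fun y => e t y / v y @[t --> F] --> a / v x) (x := x)); last first.
    by apply: cvgM => //; exact: cvg_cst.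
  move=> y z byz cy; rewrite -[a / v x]addr0.
  have -> : (fun t => e t z / v z) = (fun t => e t y / v y + (e t z / v z - e t y / v y)).
    by apply/funext => t; rewrite addrC subrK.
  apply: cvgD => //; apply/cvgrPdist_lt => d d0.
  have c0 : 0 < b y z * v y * v z by rewrite !mulr_gt0.
  move/cvgrPdist_lt : e0 => /(_ _ (mulr_gt0 c0 (exprn_gt0 2 d0))).
  apply: filterS2 eD => t eDt; rewrite sub0r normrN => lt; rewrite sub0r normrN.
  have := @closure_bform_ge _ _ _ _ bgraph hge0 (b y z * v y * v z) (v y)^-1 (- (v z)^-1) y z _ eDt.
  move=> /(_ _)/le_lt_trans; set E := closure_bform _ _ _ _ in lt *.
  have lt' : E < b y z * v y * v z * d ^+ 2 by exact: le_lt_trans (ler_norm _) lt.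
  move=> /(_ _ _ lt'); rewrite ltr_pM2l// => hlt.
  apply: ltr_norm_sqr => //; apply: le_lt_trans (hlt _); first by rewrite le_eqVlt; apply/orP; left; apply/eqP; ring.
  move=> phi fp; apply: le_trans (ground_edge bgraph v0 vF vH y z fp).
  by rewrite le_eqVlt; apply/orP; left; apply/eqP; congr (_ * _ ^+ 2); ring.
move=> y; have -> : (fun t => e t y) = (fun t => (e t y / v y) * v y).
  by apply/funext => t; rewrite divfK ?gt_eqF.
by rewrite mulrAC; apply: cvgM => //; exact: cvg_cst.
Qed.

(** The ultrafilter takes the limits at all vertices at once, without enumerating [X] and extracting
    diagonal subsequences. Normalization at [o] keeps the limit nonzero. *)
Lemma positive_superharmonic_ex q : hform_ge0 b q -> forall o : X,
  exists v, positive_fun v /\ H_superharmonic b q v.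
Proof.
move=> hge0 o; pose mu (n : nat) : R := n.+1%:R^-1.
have mu0 n : 0 < mu n by rewrite invr_gt0.
have o0 x : 0 <= (\1_[set o] : X -> R) x by rewrite indic1E ler0n.
have ex n := weak_resolvent_ex bgraph hge0 (mu0 n) (@ell2_indic R X o).
have [u_ hu_] := choice (fun n => let: ex_intro2 u h1 h2 := ex n in
   ex_intro (fun u => weak_resolvent b q (mu n) (\1_[set o]) u /\ forall x, 0 <= u x) u (conj h1 (h2 o0))).
have u0 n x : 0 <= u_ n x by case: (hu_ n).
have eqn n x : (vdeg b q x + mu n) * u_ n x = inner2 (b x) (u_ n) + (x == o)%:R.
  have [[du hu] _] := hu_ n; have := hu _ (closure_dom_fin q bgraph (@finsupp_indic R X x)).
  rewrite closure_bform_indic// !inner2_indic indic1E /Hop => <-; ring.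
have l2u n : ell2 (u_ n) by case: (hu_ n) => -[/closure_dom_ell2].
have bu n x : abs_summable (fun y => b x y * u_ n y) by apply: ell2_mul => //; exact: ell2_edge.
have buK n x K : \sum_(y <- K) b x y * u_ n y <= (vdeg b q x + mu n) * u_ n x.
  rewrite eqn; apply: ler_wpDr; first exact: ler0n.
  by apply: rsum_ge_fin => // y; rewrite mulr_ge0.
have uo n : 0 < u_ n o.
  rewrite lt_neqAle u0 andbT eq_sym; apply/eqP => uo; have := eqn n o.
  rewrite uo mulr0 eqxx => /eqP; rewrite eq_sym gt_eqF// ltr_wpDl//.
  by apply: rsum_ge0 => // y; rewrite mulr_ge0.
pose e n x := u_ n x / u_ n o.
have e0 n x : 0 <= e n x by rewrite divr_ge0// ltW.
have eo n : e n o = 1 by rewrite /e divff// gt_eqF.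
have eK n x K : \sum_(y <- K) b x y * e n y <= (vdeg b q x + mu n) * e n x.
  rewrite /e mulrA; under eq_bigr do rewrite mulrA.
  by rewrite -mulr_suml ler_pM2r ?invr_gt0.
have mu1 n : mu n <= 1 by rewrite invf_le1// ler1n.
(* Harnack inequality: a single term of the sum in [eK] bounds the value at a neighbour, uniformly
   in [n] as [mu n <= 1]. *)
have bd x : exists C, forall n, e n x <= C.
  apply: (connected_ind (P := fun x => exists C, forall n, e n x <= C) (x := o)); last by exists 1 => n; rewrite eo.
  move=> y z byz [C hC]; exists ((`|vdeg b q y| + 1) * C / b y z) => n.
  rewrite ler_pdivlMr// mulrC; have := eK n y [fset z]%fset; rewrite big_seq_fset1.
  move=> /le_trans; apply; apply: (@le_trans _ _ ((`|vdeg b q y| + 1) * e n y)).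
    by apply: ler_wpM2r => //; apply: lerD => //; exact: ler_norm.
  by apply: ler_wpM2l => //; rewrite addr_ge0.
have [U [uU sU]] := ultraFilterLemma (eventually_filter).
have exl x : exists l : R, e n x @[n --> U] --> l.
  have [C hC] := bd x.
  by apply: (@bounded_ultra_cvg _ _ _ _ 0 C) => n; rewrite e0 hC.
have [v hv] := choice exl.
have v0 x : 0 <= v x.
  by apply: (ler_cvg_to (cvg_cst 0) (hv x)); apply: filterE => n; exact: e0.
have vo : v o = 1.
  have := hv o; under eq_fun do rewrite eo; move=> c.
  by rewrite -(cvg_lim _ c)// lim_cst.
have cmu : mu n @[n --> U] --> (0 : R).
  exact: (cvg_trans (cvg_app mu (sU : U --> \oo)) (@cvg_harmonic R)).
(* Finite sums pass to the limit, which settles both membership in [F(X)] and superharmonicity. *)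
have vK x K : \sum_(y <- K) b x y * v y <= vdeg b q x * v x.
  have c1 : \sum_(y <- K) b x y * e n y @[n --> U] --> \sum_(y <- K) b x y * v y.
    by apply: cvg_sumr => y; apply: cvgM => //; exact: cvg_cst.
  have c2 : (vdeg b q x + mu n) * e n x @[n --> U] --> (vdeg b q x + 0) * v x.
    by apply: cvgM => //; apply: cvgD => //; exact: cvg_cst.
  rewrite addr0 in c2; apply: (ler_cvg_to c1 c2); apply: filterE => n; exact: eK.
have vF : in_F b v.
  by move=> x; apply: (abs_summable_ge0 _ (vK x)) => y; rewrite mulr_ge0.
exists v; split; first by split => //; exists o; rewrite vo; exact/eqP/oner_neq0.
split => // x; rewrite formalHE// subr_ge0; apply: rsum_le_fin => //.
Qed.

Section Capacity.
Variable q : X -> R.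
Hypothesis hge0 : hform_ge0 b q.
Local Notation h := (hform b q).

Lemma hcap_lbound x : has_lbound [set h phi | phi in [set phi | finsupp_fun phi /\ phi x = 1]].
Proof. by exists 0 => _ [phi [fp _] <-]; exact: hge0. Qed.

Lemma hcap_ne x : [set h phi | phi in [set phi | finsupp_fun phi /\ phi x = 1]] !=set0.
Proof.
exists (h (\1_[set x])), (\1_[set x]) => //; split; first exact: finsupp_indic.
by rewrite indic1E eqxx.
Qed.

Lemma hcap_ge0 x : 0 <= hcap b q x.
Proof. by apply: lb_le_inf; [exact: hcap_ne|move=> _ [phi [fp _] <-]; exact: hge0]. Qed.

Lemma hcap_le x phi : finsupp_fun phi -> hcap b q x * phi x ^+ 2 <= h phi.
Proof.
move=> fp; have [p0|p0] := eqVneq (phi x) 0.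
  by rewrite p0 expr0n mulr0 hge0.
have fp1 := finsuppZ (phi x)^-1 fp.
have : hcap b q x <= h (fun y => (phi x)^-1 * phi y).
  apply: ge_inf; first exact: hcap_lbound.
  by eexists; last reflexivity; split=> //; rewrite mulVf.
by rewrite (hformZ q bgraph)// exprVn mulrC ler_pdivlMr// exprn_even_gt0//= p0.
Qed.

Lemma hcap0_null x : hcap b q x = 0 -> exists e : nat -> X -> R,
  [/\ forall n, finsupp_fun (e n), forall n y, 0 <= e n y, forall n, e n x = 1
    & h (e n) @[n --> \oo] --> (0 : R)].
Proof.
move=> c0; have ex n : exists phi, [/\ finsupp_fun phi, forall y, 0 <= phi y, phi x = 1
    & h phi <= (n.+1%:R^-1 : R)].
  have n0 : 0 < (n.+1%:R^-1 : R) by rewrite invr_gt0.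
  have [_ [phi [fp px] <-]] := inf_adherent n0 (conj (hcap_ne x) (hcap_lbound x)).
  rewrite -/(hcap b q x) c0 add0r => lt; exists (fun y => `|phi y|); split => //.
  - move/finsupp_supp : fp => [K hK]; apply/finsupp_supp; exists K => y /hK ->.
    by rewrite normr0.
  - by rewrite px normr1.
  - exact: le_trans (hform_norm q bgraph fp) (ltW lt).
have [e he] := choice ex; exists e; split.
- by move=> n; case: (he n).
- by move=> n; case: (he n).
- by move=> n; case: (he n).
apply: (squeeze_cvgr _ (cvg_cst 0) (@cvg_harmonic R)); apply: nearW => n.
by have [fp _ _ le] := he n; rewrite hge0// le.
Qed.

Lemma null_seq_cvg v (e : nat -> X -> R) x (a : R) :
  positive_fun v -> H_superharmonic b q v -> (forall n, finsupp_fun (e n)) ->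
  h (e n) @[n --> \oo] --> (0 : R) -> e n x @[n --> \oo] --> a ->
  forall y, e n y @[n --> \oo] --> a * v y / v x.
Proof.
move=> vp vs fe e0 ea; apply: (null_family_cvg hge0 vp vs _ _ ea).
  by apply: nearW => n; exact: (closure_dom_fin q bgraph (fe n)).
under eq_fun => n do rewrite (closure_bform_fin bgraph hge0 (fe n) (fe n)) (hB_diag q bgraph (fe n)).
exact: e0.
Qed.

(** A null sequence normalized at [x] tends at [y] to [v y / v x > 0], while the capacity of [y]
    times the square of its value there is bounded by its energy. *)
Lemma hcap0_all x : hcap b q x = 0 -> forall y, hcap b q y = 0.
Proof.
move=> c0 y; have [v [vp vs]] := positive_superharmonic_ex hge0 x.
have v0 := superharmonic_gt0 vp vs.
have [e [fe ep ex e0]] := hcap0_null c0.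
have ec : e n x @[n --> \oo] --> (1 : R) by under eq_fun do rewrite ex; exact: cvg_cst.
have ey : e n y @[n --> \oo] --> 1 * v y / v x by exact: null_seq_cvg vp vs fe e0 ec _.
have c : hcap b q y * e n y ^+ 2 @[n --> \oo] --> hcap b q y * (1 * v y / v x) ^+ 2.
  apply: cvgM; first exact: cvg_cst.
  by rewrite expr2; under eq_fun do rewrite expr2; exact: cvgM.
have : hcap b q y * (1 * v y / v x) ^+ 2 <= 0.
  by apply: (ler_cvg_to c e0); apply: nearW => n; exact: hcap_le.
rewrite pmulr_lle0 ?exprn_gt0// ?divr_gt0 ?mul1r// => le0.
by apply/eqP; rewrite eq_le le0 hcap_ge0.
Qed.

(** A positive capacity at [x] is itself a weight [w] supported at [x]; conversely a weight with
    [w x > 0] is contradicted by a null sequence normalized at [x]. *)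
Lemma critical_hcap : h_critical b q <-> forall x, hcap b q x = 0.
Proof.
split=> [hc x|hc [w [[w0 [x /eqP wx]] hw]]].
  apply: contrapT => /eqP c0; apply: hc; exists (fun y => hcap b q x * \1_[set x] y).
  split.
    split=> [y|]; first by rewrite mulr_ge0 ?hcap_ge0// indic1E ler0n.
    by exists x; rewrite indic1E eqxx mulr1; exact/eqP.
  move=> phi fp; rewrite (@fsum_fin _ _ _ [fset x]%fset) => [|y]; last first.
    by rewrite inE indic1E => /negPf ->; rewrite mulr0 mul0r.
  by rewrite big_seq_fset1 indic1E eqxx mulr1 hcap_le.
have wp : 0 < w x by rewrite lt_neqAle eq_sym wx w0.
have [e [fe ep ex e0]] := hcap0_null (hc x).
have : w x <= 0.
  apply: (ler_cvg_to (cvg_cst (w x)) e0); apply: nearW => n.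
  apply: le_trans (hw _ (fe n)); have /finsupp_supp[K hK] := fe n.
  rewrite (@fsum_fin _ _ _ K) => [|y /hK ->]; last by rewrite expr0n mulr0.
  have xK : x \in K by apply: contraT => /hK/eqP; rewrite ex oner_eq0.
  rewrite (bigD1_seq x)//= ex expr1n mulr1 lerDl sumr_ge0// => y _.
  by rewrite mulr_ge0 ?sqr_ge0.
by rewrite leNgt wp.
Qed.

(** The killing term at [x] alone bounds [h (e n)] from below by [H v x / v x]. *)
Lemma critical_harmonic v : h_critical b q -> positive_fun v ->
  H_superharmonic b q v -> H_harmonic b q v.
Proof.
move=> /critical_hcap hc vp vs; have v0 := superharmonic_gt0 vp vs.
have [vF vH] := vs; split=> // x; apply/eqP; rewrite eq_le vH andbT.
have [e [fe ep ex e0]] := hcap0_null (hc x).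
have : formalH b q v x / v x <= 0.
  apply: (ler_cvg_to (cvg_cst _) e0); apply: nearW => n.
  by have := ground_kill bgraph v0 vF vH x (fe n); rewrite ex expr1n mulr1.
by rewrite pmulr_lle0 ?invr_gt0.
Qed.

(** One null sequence converges to a multiple of [u] and to a multiple of [v]. *)
Lemma critical_unique u v : h_critical b q -> positive_fun u ->
  H_superharmonic b q u -> positive_fun v -> H_superharmonic b q v ->
  exists c : R, forall x, v x = c * u x.
Proof.
move=> /critical_hcap hc up us vp vs; have u0 := superharmonic_gt0 up us.
have v0 := superharmonic_gt0 vp vs.
have [z _] : exists z : X, True by case: up => _ [z _]; exists z.
have [e [fe ep ex e0]] := hcap0_null (hc z).
have ec : e n z @[n --> \oo] --> (1 : R) by under eq_fun do rewrite ex; exact: cvg_cst.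
exists (v z / u z) => x.
have cvu : e n x @[n --> \oo] --> 1 * u x / u z by apply: null_seq_cvg up us fe e0 ec _.
have cvv : e n x @[n --> \oo] --> 1 * v x / v z by exact: null_seq_cvg vp vs fe e0 ec _.
have := cvgr_unique cvu cvv.
rewrite !mul1r => /(congr1 (fun t => t * v z)).
rewrite divfK ?gt_eqF// => <-.
by rewrite mulrC mulrA mulrAC.
Qed.

End Capacity.

End PotentialTheory.

(** * Functional calculus for a selfadjoint contraction *)

(** The calculus and the semigroup theory run over an abstract real Hilbert space, with [l2]
    substituted at the end; completeness is expressed through [dot] alone. *)
Record hilbert (R : realType) (V : lmodType R) (dot : V -> V -> R) : Prop := Hilbert {
  dotC : forall u v, dot u v = dot v u;
  dot_linl : forall a u v w, dot (a *: u + v) w = a * dot u w + dot v w;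
  dot_ge0 : forall u, 0 <= dot u u;
  dot_eq0 : forall u, dot u u = 0 -> u = 0;
  dot_complete : forall u : nat -> V,
    (forall e, 0 < e -> exists N, forall n m, (N <= n)%N -> (N <= m)%N ->
      dot (u n - u m) (u n - u m) < e ^+ 2) ->
    exists l, dot (u n - l) (u n - l) @[n --> \oo] --> (0 : R) }.

Section HilbertBasics.
Context {R : realType} {V : lmodType R} (dot : V -> V -> R) (Hd : hilbert dot).
Implicit Types (u v w : V).

Definition nrm u : R := Num.sqrt (dot u u).

Lemma dotDl u v w : dot (u + v) w = dot u w + dot v w.
Proof. by rewrite -[u]scale1r (dot_linl Hd) mul1r scale1r. Qed.

Lemma dotZl a u w : dot (a *: u) w = a * dot u w.
Proof.
have d0 : dot 0 w = 0.
  by have /eqP := dotDl 0 0 w; rewrite addr0 addrC -subr_eq subrr => /eqP <-.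
by rewrite -[a *: u]addr0 (dot_linl Hd) d0 addr0.
Qed.

Lemma dot0l w : dot 0 w = 0.
Proof. by rewrite -(scale0r (0 : V)) dotZl mul0r. Qed.

Lemma dotNl u w : dot (- u) w = - dot u w.
Proof. by rewrite -scaleN1r dotZl mulN1r. Qed.

Lemma dotBl u v w : dot (u - v) w = dot u w - dot v w.
Proof. by rewrite dotDl dotNl. Qed.

Lemma dotDr u v w : dot w (u + v) = dot w u + dot w v.
Proof. by rewrite (dotC Hd) dotDl !(dotC Hd w). Qed.

Lemma dotZr a u w : dot w (a *: u) = a * dot w u.
Proof. by rewrite (dotC Hd) dotZl (dotC Hd w). Qed.

Lemma dotBr u v w : dot w (u - v) = dot w u - dot w v.
Proof. by rewrite (dotC Hd) dotBl !(dotC Hd w). Qed.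

Lemma dot_CS u v : dot u v ^+ 2 <= dot u u * dot v v.
Proof.
apply: discr_le => t; have := dot_ge0 Hd (t *: u + v).
rewrite (dot_linl Hd) !dotDr !dotZr (dotC Hd v u); congr (0 <= _); ring.
Qed.

Lemma nrm_ge0 u : 0 <= nrm u. Proof. exact: sqrtr_ge0. Qed.

Lemma nrm_sqr u : nrm u ^+ 2 = dot u u.
Proof. by rewrite sqr_sqrtr// (dot_ge0 Hd). Qed.

Lemma dot_le_nrm u v : `|dot u v| <= nrm u * nrm v.
Proof.
apply: ler_sqr_nneg; first by rewrite mulr_ge0 ?nrm_ge0.
by rewrite exprMn !nrm_sqr real_normK ?num_real// dot_CS.
Qed.

Lemma nrmD u v : nrm (u + v) <= nrm u + nrm v.
Proof.
apply: ler_sqr_nneg; first by rewrite addr_ge0 ?nrm_ge0.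
rewrite sqrrD !nrm_sqr dotDl !dotDr (dotC Hd v u).
have := ler_norm (dot u v); have := dot_le_nrm u v; rewrite mulr2n; lra.
Qed.

Lemma nrmZ a u : nrm (a *: u) = `|a| * nrm u.
Proof. by rewrite /nrm dotZl dotZr mulrA -expr2 sqrtrM ?sqr_ge0// sqrtr_sqr. Qed.

Lemma nrmN u : nrm (- u) = nrm u.
Proof. by rewrite -scaleN1r nrmZ normrN1 mul1r. Qed.

Lemma nrmB u v : nrm (u - v) <= nrm u + nrm v.
Proof. by rewrite -(nrmN v) nrmD. Qed.

Lemma nrm_distC u v : nrm (u - v) = nrm (v - u).
Proof. by rewrite -nrmN opprB. Qed.

Lemma nrm_eq0 u : nrm u <= 0 -> u = 0.
Proof.
move=> n0; apply: (dot_eq0 Hd); rewrite -nrm_sqr.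
by rewrite (_ : nrm u = 0) ?expr0n//; apply/eqP; rewrite eq_le n0 nrm_ge0.
Qed.

Lemma nrm0 : nrm 0 = 0. Proof. by rewrite /nrm dot0l sqrtr0. Qed.

Definition vcvg (u : nat -> V) l := nrm (u n - l) @[n --> \oo] --> (0 : R).

Lemma vcvgP (u : nat -> V) l : vcvg u l <->
  forall e, 0 < e -> exists N, forall n, (N <= n)%N -> nrm (u n - l) < e.
Proof.
split=> [/cvgrPdist_lt h e e0|h]; last first.
  apply/cvgrPdist_lt => e /h[N hN]; exists N => // n /= /hN.
  by rewrite sub0r normrN ger0_norm ?nrm_ge0.
have [N _ hN] := h _ e0; exists N => n Nn; have := hN n Nn.
by rewrite sub0r normrN ger0_norm ?nrm_ge0.
Qed.

Lemma vcvg_bound (u : nat -> V) l (B : nat -> R) : (forall n, nrm (u n - l) <= B n) ->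
  B n @[n --> \oo] --> (0 : R) -> vcvg u l.
Proof.
move=> h c; apply: (squeeze_cvgr _ (cvg_cst 0) c); apply: nearW => n.
by rewrite nrm_ge0 h.
Qed.

Lemma vcvg_unique (u : nat -> V) l m : vcvg u l -> vcvg u m -> l = m.
Proof.
move=> ul um; apply/eqP; rewrite -subr_eq0; apply/eqP/nrm_eq0.
have c : nrm (u n - m) + nrm (u n - l) @[n --> \oo] --> (0 : R).
  by rewrite -[X in _ --> X]addr0; exact: cvgD.
apply: (ler_cvg_to (cvg_cst _) c); apply: nearW => n.
apply: le_trans (nrmB _ _); rewrite le_eqVlt; apply/orP; left; apply/eqP; congr nrm.
by rewrite opprB [RHS]addrC addrA subrK.
Qed.

Lemma vcvg_lin a (u v : nat -> V) l m : vcvg u l -> vcvg v m ->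
  vcvg (fun n => a *: u n + v n) (a *: l + m).
Proof.
move=> ul vm; apply: (vcvg_bound (B := fun n => `|a| * nrm (u n - l) + nrm (v n - m))).
  move=> n; rewrite -nrmZ (le_trans _ (nrmD _ _))// le_eqVlt; apply/orP; left; apply/eqP.
  by congr nrm; rewrite scalerBr opprD addrACA.
rewrite -[X in _ --> X]addr0 -[X in _ --> X + _](mulr0 `|a|).
by apply: cvgD => //; apply: cvgM => //; exact: cvg_cst.
Qed.

Lemma vcvg_cst l : vcvg (fun=> l) l.
Proof. by rewrite /vcvg subrr nrm0; exact: cvg_cst. Qed.

Lemma vcvg_dot (u v : nat -> V) l m : vcvg u l -> vcvg v m ->
  dot (u n) (v n) @[n --> \oo] --> dot l m.
Proof.
move=> ul vm.
apply: (cvg_dist_le (B := fun n => nrm (u n - l) * (nrm (v n - m) + nrm m) + nrm l * nrm (v n - m))).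
  move=> n; have -> : dot (u n) (v n) - dot l m = dot (u n - l) (v n) + dot l (v n - m).
    by rewrite dotBl dotBr addrA subrK.
  apply: le_trans (ler_normD _ _) _; apply: lerD; last exact: dot_le_nrm.
  apply: le_trans (dot_le_nrm _ _) _; apply: ler_wpM2l; first exact: nrm_ge0.
  by rewrite -[X in nrm X <= _](subrK m) nrmD.
rewrite (_ : 0 = 0 * (0 + nrm m) + nrm l * 0); last by rewrite mul0r mulr0 addr0.
by apply: cvgD; apply: cvgM => //; first apply: cvgD => //; exact: cvg_cst.
Qed.

Lemma vcvg_nrm (u : nat -> V) l : vcvg u l -> nrm (u n) @[n --> \oo] --> nrm l.
Proof.
move=> ul; apply: (cvg_dist_le (B := fun n => nrm (u n - l))) => // n.
have := nrmD (u n - l) l; have := nrmD (l - u n) (u n).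
rewrite !subrK (nrm_distC l) ler_norml => h1 h2; apply/andP; split; lra.
Qed.

Lemma hilbert_complete (u : nat -> V) :
  (forall e, 0 < e -> exists N, forall n m, (N <= n)%N -> (N <= m)%N ->
    nrm (u n - u m) < e) -> exists l, vcvg u l.
Proof.
move=> h; have [] := dot_complete Hd (u := u).
  move=> e e0; have [N hN] := h e e0; exists N => n m Nn Nm.
  by rewrite -nrm_sqr ltr_sqr ?nnegrE ?nrm_ge0 ?ltW// hN.
move=> l c; exists l; rewrite /vcvg -sqrtr0 /nrm.
by apply: continuous_cvg => //; exact: sqrt_continuous.
Qed.

End HilbertBasics.

(** Certificates of nonnegativity on [0, 1]. Unlike pointwise nonnegativity, membership transfers to
    operators [0 <= G <= 1] by induction, without knowledge of the spectrum. *)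
Inductive cone (R : realType) : {poly R} -> Prop :=
| cone_const c : 0 <= c -> cone c%:P
| cone_add p r : cone p -> cone r -> cone (p + r)
| cone_X p : cone p -> cone ('X * p)
| cone_1X p : cone p -> cone ((1 - 'X) * p).

(** * Bernstein polynomials as binomial means *)

Section BernsteinCone.
Context {R : realType}.
Implicit Types (p r : {poly R}) (f g : nat -> {poly R}).

Lemma coneM p r : cone p -> cone r -> cone (p * r).
Proof.
move=> cp cr; elim: p / cp => [c c0|p1 p2 _ h1 _ h2|p _ h|p _ h].
- elim: r / cr => [d d0|p1 p2 _ h1 _ h2|p _ h|p _ h].
  + by rewrite -polyCM; apply: cone_const; rewrite mulr_ge0.
  + by rewrite mulrDr; exact: cone_add.
  + by rewrite mulrCA; exact: cone_X.
  + by rewrite mulrCA; exact: cone_1X.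
- by rewrite mulrDl; exact: cone_add.
- by rewrite -mulrA; exact: cone_X.
- by rewrite -mulrA; exact: cone_1X.
Qed.

Lemma cone1 : cone (1 : {poly R}).
Proof. by rewrite -polyC1; exact: cone_const. Qed.

(* Expectation of [f] at the number of successes in [n] independent trials with
   success probability ['X]; for [f k = (g (k / n))%:P] it is the Bernstein
   polynomial of [g]. *)
Fixpoint bernoulli_mean n f : {poly R} :=
  if n is m.+1 then
    (1 - 'X) * bernoulli_mean m f + 'X * bernoulli_mean m (fun k => f k.+1)
  else f 0%N.

Local Notation W := bernoulli_mean.

Lemma bernoulli_mean_lin n p f g :
  W n (fun k => p * f k + g k) = p * W n f + W n g.
Proof. by elim: n f g => [|n IH] f g //=; rewrite !IH; ring. Qed.

Lemma bernoulli_meanM n p f : W n (fun k => p * f k) = p * W n f.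
Proof. by elim: n f => [|n IH] f //=; rewrite !IH; ring. Qed.

Lemma bernoulli_meanMr n p f : W n (fun k => f k * p) = W n f * p.
Proof. by elim: n f => [|n IH] f //=; rewrite !IH; ring. Qed.

Lemma bernoulli_meanD n f g : W n (fun k => f k + g k) = W n f + W n g.
Proof. by elim: n f g => [|n IH] f g //=; rewrite !IH; ring. Qed.

Lemma bernoulli_meanB n f g : W n (fun k => f k - g k) = W n f - W n g.
Proof. by elim: n f g => [|n IH] f g //=; rewrite !IH; ring. Qed.

Lemma bernoulli_mean_cst n p : W n (fun=> p) = p.
Proof. by elim: n => [|n IH] //=; rewrite !IH; ring. Qed.

Lemma eq_bernoulli_mean n f g : (forall k, (k <= n)%N -> f k = g k) -> W n f = W n g.
Proof.
elim: n f g => [|n IH] f g h /=; first exact: h.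
by rewrite (IH f g) => [|k kn]; [rewrite (IH (fun k => f k.+1) (fun k => g k.+1)) => [//|k kn]; exact: h|apply: h; exact: leqW].
Qed.

Lemma cone_bernoulli_mean n f : (forall k, (k <= n)%N -> cone (f k)) -> cone (W n f).
Proof.
elim: n f => [|n IH] f h /=; first exact: h.
apply: cone_add; [apply: cone_1X|apply: cone_X]; apply: IH => k kn; apply: h => //.
exact: leqW.
Qed.

Lemma bernoulli_mean1 n : W n (fun k => k%:R) = n%:R * 'X.
Proof.
elim: n => [|n IH] /=; first by rewrite mul0r.
rewrite (_ : (fun k => k.+1%:R) = (fun k => k%:R + 1)); last by apply/funext => k; rewrite natr1.
by rewrite bernoulli_meanD IH bernoulli_mean_cst -[in RHS]natr1; ring.
Qed.

Lemma bernoulli_mean2 n :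
  W n (fun k => k%:R ^+ 2) = n%:R ^+ 2 * 'X ^+ 2 + n%:R * ('X * (1 - 'X)).
Proof.
elim: n => [|n IH] /=; first by rewrite expr0n/= !mul0r addr0.
rewrite (_ : (fun k => k.+1%:R ^+ 2) = (fun k => k%:R ^+ 2 + (2 * k%:R + 1))); last first.
  by apply/funext => k; rewrite -natr1; ring.
rewrite bernoulli_meanD IH bernoulli_mean_lin bernoulli_mean1 bernoulli_mean_cst.
by rewrite -[in RHS]natr1; ring.
Qed.

(** For independent binomial variables [K] and [L] with [n] and [m] trials, [K/n - L/m] has mean 0
    and its variance is the sum of the two variances. *)
Lemma bernoulli_variance n m (n0 : (0 < n)%N) (m0 : (0 < m)%N) :
  W n (fun k => W m (fun l => ((k%:R / n%:R - l%:R / m%:R) ^+ 2)%:P)) =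
  (n%:R^-1 + m%:R^-1)%:P * ('X * (1 - 'X)).
Proof.
have e (k : nat) (c : R) : (k%:R * c)%:P = k%:R * c%:P :> {poly R}.
  by rewrite polyCM polyC_natr.
have inner k : W m (fun l => ((k%:R / n%:R - l%:R / m%:R) ^+ 2)%:P) =
   (n%:R^-1 ^+ 2)%:P * k%:R ^+ 2 + ((- 2 * n%:R^-1)%:P * 'X) * k%:R
    + ('X ^+ 2 + m%:R^-1%:P * ('X * (1 - 'X))).
  rewrite (@eq_bernoulli_mean _ _ (fun l => (n%:R^-1 ^+ 2)%:P * k%:R ^+ 2 + ((- 2 * k%:R / n%:R / m%:R)%:P * l%:R
     + (m%:R^-1 ^+ 2)%:P * l%:R ^+ 2))) => [|l _]; last first.
    by rewrite -!polyC_natr -!polyC_exp -!polyCM -!polyCD; congr polyC; ring.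
  rewrite bernoulli_meanD bernoulli_mean_cst bernoulli_mean_lin bernoulli_meanM bernoulli_mean1 bernoulli_mean2.
  have mm : (m%:R : {poly R}) * m%:R^-1%:P = 1.
    by rewrite -polyC_natr -polyCM divff ?pnatr_eq0 ?gtn_eqF.
  rewrite !polyC_exp !polyCM !polyC_natr polyCN.
  set M := m%:R^-1%:P in mm *; set N := n%:R^-1%:P.
  have -> : - 2%:P * k%:R * N * M * (m%:R * 'X) = - 2%:P * k%:R * N * 'X * (m%:R * M) by ring.
  have -> : M ^+ 2 * (m%:R ^+ 2 * 'X^2 + m%:R * ('X * (1 - 'X))) =
     (m%:R * M) ^+ 2 * 'X^2 + (m%:R * M) * M * ('X * (1 - 'X)) by ring.
  by rewrite mm; ring.
under eq_bernoulli_mean => k _ do rewrite inner.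
rewrite bernoulli_meanD bernoulli_mean_cst bernoulli_mean_lin bernoulli_meanM bernoulli_mean1 bernoulli_mean2.
have nn : (n%:R : {poly R}) * n%:R^-1%:P = 1.
  by rewrite -polyC_natr -polyCM divff ?pnatr_eq0 ?gtn_eqF.
rewrite !polyC_exp !polyCD !polyCM polyCN.
set N := n%:R^-1%:P in nn *; set M := m%:R^-1%:P.
have -> : N ^+ 2 * (n%:R ^+ 2 * 'X^2 + n%:R * ('X * (1 - 'X))) =
   (n%:R * N) ^+ 2 * 'X^2 + (n%:R * N) * N * ('X * (1 - 'X)) by ring.
have -> : - 2%:P * N * 'X * (n%:R * 'X) = - 2%:P * 'X ^+ 2 * (n%:R * N) by ring.
rewrite nn (_ : 2%:P = 2) ?polyC_natr//; ring.
Qed.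

(** A certificate that [p] is bounded by [c] in absolute value on [0, 1]. *)
Definition pbound p (c : R) := cone (c%:P - p) /\ cone (c%:P + p).

Lemma pbound_mean n f c : (forall k, (k <= n)%N -> pbound (f k) c) -> pbound (W n f) c.
Proof.
move=> h; split; rewrite -(bernoulli_mean_cst n c%:P).
  by rewrite -bernoulli_meanB; apply: cone_bernoulli_mean => k /h [].
by rewrite -bernoulli_meanD; apply: cone_bernoulli_mean => k /h [].
Qed.

Lemma cone_sub_le p r s : cone (r - p) -> cone (s - r) -> cone (s - p).
Proof.
move=> h1 h2; rewrite (_ : s - p = (s - r) + (r - p)); last by ring.
exact: cone_add.
Qed.

(* A continuous [f] satisfies this on [0, 1]; it is what turns the variance
   bound into a uniform estimate on Bernstein polynomials. *)
Definition qmodulus (f : R -> R) := forall e, 0 < e -> exists2 C, 0 <= C &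
  forall s t, 0 <= s <= 1 -> 0 <= t <= 1 -> `|f s - f t| <= e + C * (s - t) ^+ 2.

Lemma ratio01 k n : (k <= n)%N -> 0 <= (k%:R / n%:R : R) <= 1.
Proof.
move=> kn; case: n kn => [|n] kn; first by rewrite invr0 mulr0 lexx ler01.
by rewrite divr_ge0//= ler_pdivrMr ?ltr0n// mul1r ler_nat.
Qed.

(** Chebyshev's argument: the pointwise bound is averaged over two independent binomial variables,
    and the squared distance becomes the variance. *)
Lemma double_mean_bound (F : R -> R -> R) e C : 0 <= C ->
  (forall s t, 0 <= s <= 1 -> 0 <= t <= 1 -> `|F s t| <= e + C * (s - t) ^+ 2) ->
  forall n m, (0 < n)%N -> (0 < m)%N ->
  pbound (W n (fun k => W m (fun l => (F (k%:R / n%:R) (l%:R / m%:R))%:P)))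
    (e + C * (n%:R^-1 + m%:R^-1)).
Proof.
move=> C0 hF n m n0 m0.
pose Q : {poly R} := (n%:R^-1 + m%:R^-1)%:P * ('X * (1 - 'X)).
set S := W n _.
have q0 : 0 <= n%:R^-1 + m%:R^-1 :> R by rewrite addr_ge0.
(* ['X (1 - 'X) <= 1] in the cone, because the difference is ['X^2 + (1 - 'X)]. *)
have cQ : cone ((e + C * (n%:R^-1 + m%:R^-1))%:P - (e%:P + C%:P * Q)).
  rewrite (_ : _ - _ = (C * (n%:R^-1 + m%:R^-1))%:P * ('X * 'X * 1 + (1 - 'X) * 1)); last first.
    by rewrite /Q !polyCD !polyCM !polyCD; ring.
  apply: coneM; first by apply: cone_const; rewrite mulr_ge0.
  by apply: cone_add; [rewrite -mulrA; do 2!apply: cone_X|apply: cone_1X]; exact: cone1.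
have eQ : e%:P + C%:P * Q = W n (fun k => W m (fun l => (e + C * (k%:R / n%:R - l%:R / m%:R) ^+ 2)%:P)).
  rewrite /Q -(bernoulli_variance n0 m0) -bernoulli_meanM -(bernoulli_mean_cst n e%:P) -bernoulli_meanD.
  apply: eq_bernoulli_mean => k _; rewrite -bernoulli_meanM -{1}(bernoulli_mean_cst m e%:P) -bernoulli_meanD.
  by apply: eq_bernoulli_mean => l _; rewrite -polyCM -polyCD.
have hle s t : 0 <= s <= 1 -> 0 <= t <= 1 ->
    0 <= e + C * (s - t) ^+ 2 - F s t /\ 0 <= e + C * (s - t) ^+ 2 + F s t.
  by move=> s1 t1; have := hF s t s1 t1; rewrite ler_norml => /andP[]; split; lra.
split.
  apply: (cone_sub_le _ cQ); rewrite eQ -bernoulli_meanB.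
  apply: cone_bernoulli_mean => k kn; rewrite -bernoulli_meanB.
  apply: cone_bernoulli_mean => l lm; rewrite -polyCB; apply: cone_const.
  by have [] := hle _ _ (ratio01 kn) (ratio01 lm).
rewrite -[S]opprK; apply: (cone_sub_le _ cQ); rewrite opprK eQ -bernoulli_meanD.
apply: cone_bernoulli_mean => k kn; rewrite -bernoulli_meanD.
apply: cone_bernoulli_mean => l lm; rewrite -polyCD; apply: cone_const.
by have [] := hle _ _ (ratio01 kn) (ratio01 lm).
Qed.

Definition bernstein (f : R -> R) n := W n (fun k => (f (k%:R / n%:R))%:P).

Lemma bernstein_dist (f : R -> R) (e C : R) n m : 0 <= C ->
  (forall s t, 0 <= s <= 1 -> 0 <= t <= 1 -> `|f s - f t| <= e + C * (s - t) ^+ 2) ->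
  (0 < n)%N -> (0 < m)%N ->
  pbound (bernstein f n - bernstein f m) (e + C * (n%:R^-1 + m%:R^-1)).
Proof.
move=> C0 hf n0 m0.
have := double_mean_bound (F := fun s t => f s - f t) C0 hf n0 m0.
congr (pbound _ _); rewrite /bernstein -[X in _ = _ - X](bernoulli_mean_cst n) -bernoulli_meanB.
apply: eq_bernoulli_mean => k _; rewrite -[X in _ = X - _](bernoulli_mean_cst m) -bernoulli_meanB.
by apply: eq_bernoulli_mean => l _; rewrite polyCB.
Qed.

(** A product of Bernstein polynomials is the double mean of [f s * g t], so the defect of
    multiplicativity is the double mean of [f s * (g t - g s)]. *)
Lemma bernsteinM_dist (f g : R -> R) (M e C : R) n : 0 <= C -> 0 <= M ->
  (forall s, 0 <= s <= 1 -> `|f s| <= M) ->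
  (forall s t, 0 <= s <= 1 -> 0 <= t <= 1 -> `|g s - g t| <= e + C * (s - t) ^+ 2) ->
  (0 < n)%N ->
  pbound (bernstein f n * bernstein g n - bernstein (fun s => f s * g s) n)
    (M * e + M * C * (n%:R^-1 + n%:R^-1)).
Proof.
move=> C0 M0 hf hg n0.
have := @double_mean_bound (fun s t => f s * (g t - g s)) (M * e) (M * C) _ _ n n n0 n0.
rewrite (_ : W n _ = bernstein f n * bernstein g n - bernstein (fun s => f s * g s) n).
  apply; first exact: mulr_ge0.
  move=> s t s1 t1; rewrite normrM -mulrA -mulrDr distrC ler_pM//; first exact: hf.
  exact: hg.
rewrite /bernstein -bernoulli_meanMr -bernoulli_meanB; apply: eq_bernoulli_mean => k _.
rewrite -bernoulli_meanM -[X in _ = _ - X](bernoulli_mean_cst n) -bernoulli_meanB.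
by apply: eq_bernoulli_mean => l _; rewrite mulrBr polyCB !polyCM.
Qed.

Lemma bernstein_bound (f : R -> R) (M : R) n : (forall s, 0 <= s <= 1 -> `|f s| <= M) ->
  pbound (bernstein f n) M.
Proof.
move=> hf; apply: pbound_mean => k kn.
have := hf _ (ratio01 kn); rewrite ler_norml => /andP[h1 h2].
by split; rewrite -?polyCB -?polyCD; apply: cone_const; lra.
Qed.

Lemma bernstein_cone (f : R -> R) n : (forall s, 0 <= s <= 1 -> 0 <= f s) -> cone (bernstein f n).
Proof.
move=> hf; apply: cone_bernoulli_mean => k kn; apply: cone_const.
exact: hf (ratio01 kn).
Qed.

End BernsteinCone.

(** * Polynomials and continuous functions of an operator *)

Section PolyAction.
Context {R : realType} {V : lmodType R} (dot : V -> V -> R) (Hd : hilbert dot).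
Context (G : {linear V -> V}).
Hypotheses (Gsym : forall u v, dot (G u) v = dot u (G v))
  (G0 : forall u, 0 <= dot (G u) u) (G1 : forall u, dot (G u) u <= dot u u).
Implicit Types (p r : {poly R}) (u v w : V) (f g : R -> R).

Local Notation nrm := (nrm dot).

Definition pact p v := \sum_(i < size p) p`_i *: iter i G v.

Lemma pact_widen N p v : (size p <= N)%N -> pact p v = \sum_(i < N) p`_i *: iter i G v.
Proof.
move=> pN; rewrite /pact (big_ord_widen _ (fun i => p`_i *: iter i G v) pN) big_mkcond.
apply: eq_bigr => i _; case: ltnP => // h; by rewrite nth_default// scale0r.
Qed.

Lemma pactD p r v : pact (p + r) v = pact p v + pact r v.
Proof.
set N := maxn (size p) (size r).
rewrite (@pact_widen N (p + r)) ?(leq_trans (size_polyD _ _))//.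
rewrite (@pact_widen N p) ?leq_maxl// (@pact_widen N r) ?leq_maxr// -big_split/=.
by apply: eq_bigr => i _; rewrite coefD scalerDl.
Qed.

Lemma pactC c v : pact c%:P v = c *: v.
Proof.
by rewrite (@pact_widen 1) ?size_polyC_leq1// big_ord1 coefC.
Qed.

Lemma pactX p v : pact ('X * p) v = G (pact p v).
Proof.
rewrite (@pact_widen (size p).+1); last first.
  by rewrite (leq_trans (size_polyMleq _ _))// size_polyX.
rewrite big_ord_recl coefXM/= scale0r add0r /pact linear_sum.
by apply: eq_bigr => i _; rewrite coefXM/= linearZ.
Qed.

Lemma pact_linear p a u v : pact p (a *: u + v) = a *: pact p u + pact p v.
Proof.
rewrite /pact scaler_sumr -big_split/=; apply: eq_bigr => i _.
have -> : iter i G (a *: u + v) = a *: iter i G u + iter i G v.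
  by elim: (nat_of_ord i) => [//|j /= ->]; rewrite linearP.
by rewrite scalerDr !scalerA mulrC.
Qed.

Lemma pactZ c p v : pact (c *: p) v = c *: pact p v.
Proof.
rewrite (pact_widen _ (size_scale_leq c p)) /pact scaler_sumr.
by apply: eq_bigr => i _; rewrite coefZ scalerA.
Qed.

Lemma pact1 v : pact 1 v = v.
Proof. by rewrite -polyC1 pactC scale1r. Qed.

Lemma pactG v : pact 'X v = G v.
Proof. by rewrite -['X]mulr1 pactX pact1. Qed.

Lemma pactM p r v : pact (p * r) v = pact p (pact r v).
Proof.
elim/poly_ind: p r v => [|p c IH] r v.
  rewrite mul0r -polyC0 !pactC !scale0r//.
have -> : (p * 'X + c%:P) * r = p * ('X * r) + c%:P * r by ring.
rewrite !pactD IH pactX IH pactG pactC mul_polyC pactZ//.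
Qed.

Lemma pactN p v : pact (- p) v = - pact p v.
Proof. by rewrite -(scaleN1r p) pactZ scaleN1r. Qed.

Lemma pactB p r v : pact (p - r) v = pact p v - pact r v.
Proof. by rewrite pactD pactN. Qed.

Lemma pact_sym p u v : dot (pact p u) v = dot u (pact p v).
Proof.
elim/poly_ind: p u v => [|p c IH] u v.
  by rewrite -polyC0 !pactC !scale0r (dot0l Hd) (dotC Hd) (dot0l Hd).
rewrite !pactD !pactC (dotDl Hd) (dotDr Hd) (dotZl Hd) (dotZr Hd); congr (_ + _).
by rewrite pactM mulrC pactX IH pactG Gsym -!pactG -!pactM mulrC.
Qed.

Lemma pact_sqr p r v : dot (pact (r ^+ 2 * p) v) v = dot (pact p (pact r v)) (pact r v).
Proof. by rewrite -pact_sym -!pactM; congr (dot (pact _ v) v); ring. Qed.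

(** Squares of ['X] and of [1 - 'X] are moved onto the vector by symmetry of [G]. What remains is 1,
    ['X], [1 - 'X], and their product ['X (1 - 'X) = (1 - 'X)^2 'X + 'X^2 (1 - 'X)], which is
    reduced to squares again. *)
Lemma pact_mono a c v : 0 <= dot (pact ('X ^+ a * (1 - 'X) ^+ c) v) v.
Proof.
have [n] := ubnP (a + c)%N; elim: n a c v => // n IH a c v; rewrite ltnS => ac.
have base1 u : 0 <= dot (pact (1 - 'X) u) u.
  by rewrite pactB pact1 pactG (dotBl Hd) subr_ge0.
case: a ac => [|[|a]] ac; last first.
- rewrite (_ : _ * _ = 'X ^+ 2 * ('X ^+ a * (1 - 'X) ^+ c)); last by rewrite !exprS; ring.
  by rewrite pact_sqr; apply: IH; move: ac; rewrite addSn => /ltnW.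
- case: c ac => [|[|c]] ac; last first.
  + rewrite (_ : _ * _ = (1 - 'X) ^+ 2 * ('X ^+ 1 * (1 - 'X) ^+ c)); last by rewrite !exprS; ring.
    by rewrite pact_sqr; apply: IH; move: ac; rewrite !addnS => /ltnW.
  + rewrite (_ : _ * _ = (1 - 'X) ^+ 2 * 'X + 'X ^+ 2 * (1 - 'X)); last by ring.
    by rewrite pactD (dotDl Hd) !pact_sqr addr_ge0// pactG.
  + by rewrite expr0 mulr1 expr1 pactG.
- case: c ac => [|[|c]] ac; last first.
  + rewrite (_ : _ * _ = (1 - 'X) ^+ 2 * ('X ^+ 0 * (1 - 'X) ^+ c)); last by rewrite !exprS; ring.
    by rewrite pact_sqr; apply: IH; move: ac; rewrite !addnS => /ltnW.
  + by rewrite expr0 mul1r expr1.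
  + by rewrite !expr0 mulr1 pact1 (dot_ge0 Hd).
Qed.

Lemma pact_cone p v : cone p -> 0 <= dot (pact p v) v.
Proof.
(* The induction carries a monomial factor, which absorbs the multiplications by ['X] and
   [1 - 'X]. *)
move=> cp; suff : forall a c, 0 <= dot (pact ('X ^+ a * (1 - 'X) ^+ c * p) v) v.
  by move=> /(_ 0%N 0%N); rewrite !expr0 !mul1r.
elim: p / cp => [d d0|p1 p2 _ h1 _ h2|p _ h|p _ h] a c.
- rewrite mulrC mul_polyC pactZ (dotZl Hd) mulr_ge0//; exact: pact_mono.
- by rewrite mulrDr pactD (dotDl Hd) addr_ge0.
- rewrite (_ : _ * _ = 'X ^+ a.+1 * (1 - 'X) ^+ c * p)//; rewrite exprS; ring.
- rewrite (_ : _ * _ = 'X ^+ a * (1 - 'X) ^+ c.+1 * p)//; rewrite exprS; ring.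
Qed.

(** [c^2 - p^2 = (c - p) (c + p)] is a product of two cone elements. *)
Lemma pbound_nrm p c v : 0 <= c -> pbound p c -> nrm (pact p v) <= c * nrm v.
Proof.
move=> c0 [h1 h2]; have := pact_cone v (coneM h1 h2).
rewrite (_ : _ * _ = (c ^+ 2)%:P - p ^+ 2 * 1); last by rewrite polyC_exp; ring.
rewrite pactB (dotBl Hd) pact_sqr pact1 pactC (dotZl Hd) subr_ge0 => h.
apply: ler_sqr_nneg; first by rewrite mulr_ge0 ?nrm_ge0.
by rewrite exprMn !(nrm_sqr Hd).
Qed.

Section Calculus.

(** The operator [f(G)] as a strong limit. The index is shifted because the estimates divide by the
    number of trials; the default 0 is not reached when [qmodulus f] holds. *)
Definition fcalc f v := xget 0 [set l | vcvg dot (fun n => pact (bernstein f n.+1) v) l].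

Lemma harmonic_pair_small (C e : R) : 0 <= C -> 0 < e -> exists N : nat,
  forall n m, (N <= n)%N -> (N <= m)%N -> C * (n.+1%:R^-1 + m.+1%:R^-1) < e.
Proof.
move=> C0 e0; have d0 : 0 < e / 2 / (C + 1) by rewrite !divr_gt0// ltr_wpDl.
move/cvgrPdist_lt : (@cvg_harmonic R) => /(_ _ d0)[N _ hN].
exists N => n m /hN + /hN; rewrite /harmonic /= !sub0r !normrN !ger0_norm// => h1 h2.
have C1 : 0 < C + 1 by rewrite ltr_wpDl.
apply: (@le_lt_trans _ _ ((C + 1) * (n.+1%:R^-1 + m.+1%:R^-1))).
  by rewrite ler_wpM2r ?addr_ge0// lerDl.
move: h1 h2; rewrite !ltr_pdivlMr//; set s := n.+1%:R^-1; set t := m.+1%:R^-1; lra.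
Qed.

Lemma fcalc_cvg f v : qmodulus f -> vcvg dot (fun n => pact (bernstein f n.+1) v) (fcalc f v).
Proof.
move=> qf; rewrite /fcalc; case: xgetP => [l _ //|/= none]; exfalso.
have [l hl] : exists l, vcvg dot (fun n => pact (bernstein f n.+1) v) l.
  apply: (hilbert_complete Hd) => e e0.
  pose d := e / 2 / (nrm v + 1).
  have v1 : 0 < nrm v + 1 by rewrite ltr_wpDl ?nrm_ge0.
  have d0 : 0 < d by rewrite !divr_gt0.
  have [C C0 hC] := qf d d0; have [N hN] := harmonic_pair_small C0 d0.
  exists N => n m Nn Nm; rewrite -pactB.
  have := pbound_nrm v _ (bernstein_dist C0 hC (ltn0Sn n) (ltn0Sn m)).
  have q0 : 0 <= C * (n.+1%:R^-1 + m.+1%:R^-1) by rewrite mulr_ge0// addr_ge0.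
  move=> /(_ (addr_ge0 (ltW d0) q0)) /le_lt_trans; apply.
  have := hN n m Nn Nm; set s := C * _ in q0 * => sd.
  apply: (@lt_le_trans _ _ (2 * d * (nrm v + 1))).
    apply: (@le_lt_trans _ _ ((d + s) * (nrm v + 1))).
      by rewrite ler_wpM2l ?lerDl// addr_ge0// ltW.
    by rewrite ltr_pM2r//; lra.
  by rewrite /d; rewrite (_ : 2 * (e / 2 / (nrm v + 1)) * (nrm v + 1) = e)//; field; rewrite gt_eqF.
exact: (none l hl).
Qed.

Lemma fcalcE f v l : qmodulus f -> vcvg dot (fun n => pact (bernstein f n.+1) v) l ->
  fcalc f v = l.
Proof. by move=> qf; apply: vcvg_unique => //; exact: fcalc_cvg. Qed.

Lemma eq_fcalc f g v : qmodulus f -> (forall s, 0 <= s <= 1 -> f s = g s) ->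
  fcalc f v = fcalc g v.
Proof.
move=> qf fg.
suff E : (fun n => pact (bernstein f n.+1) v) = (fun n => pact (bernstein g n.+1) v).
  by rewrite /fcalc E.
apply/funext => n; congr pact; apply: eq_bernoulli_mean => k kn.
by rewrite fg// ratio01.
Qed.

Lemma qmodulus_lin a f g : qmodulus f -> qmodulus g -> qmodulus (fun s => a * f s + g s).
Proof.
move=> qf qg e e0; have a1 : 0 < `|a| + 1 by rewrite ltr_wpDl.
have [C C0 hC] := qf (e / 2 / (`|a| + 1)) (divr_gt0 (divr_gt0 e0 (ltr0Sn _ 1)) a1).
have [D D0 hD] := qg (e / 2) (divr_gt0 e0 (ltr0Sn _ 1)).
exists ((`|a| + 1) * C + D) => [|s t s1 t1].
  by rewrite addr_ge0// mulr_ge0// ltW.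
rewrite (_ : _ - _ = a * (f s - f t) + (g s - g t)); last by ring.
apply: le_trans (ler_normD _ _) _; rewrite normrM.
have h1 := hC s t s1 t1; have h2 := hD s t s1 t1.
have : `|a| * `|f s - f t| <= (`|a| + 1) * (e / 2 / (`|a| + 1) + C * (s - t) ^+ 2).
  by rewrite ler_pM// lerDl.
rewrite mulrDr mulrCA divff ?gt_eqF// mulr1; lra.
Qed.

Lemma qmodulus_bounded f : qmodulus f -> exists2 M, 0 <= M & forall s, 0 <= s <= 1 -> `|f s| <= M.
Proof.
move=> qf; have [C C0 hC] := qf 1 ltr01; exists (`|f 0| + (1 + C)) => [|s s1].
  by rewrite !addr_ge0.
have h01 : 0 <= (0 : R) <= 1 by rewrite lexx ler01.
rewrite -[X in `|X|](subrK (f 0)) addrC (le_trans (ler_normD _ _))// lerD2l.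
apply: le_trans (hC s 0 s1 h01) _; rewrite subr0 lerD2l ler_piMr// exprn_ile1//.
  by case/andP: s1.
by case/andP: s1.
Qed.

Lemma qmodulusM f g : qmodulus f -> qmodulus g -> qmodulus (fun s => f s * g s).
Proof.
move=> qf qg e e0; have [M M0 hM] := qmodulus_bounded qf.
have [N N0 hN] := qmodulus_bounded qg.
pose K := M + N + 1; have K0 : 0 < K by rewrite ltr_wpDl// addr_ge0.
have [C C0 hC] := qf (e / 2 / K) (divr_gt0 (divr_gt0 e0 (ltr0Sn _ 1)) K0).
have [D D0 hD] := qg (e / 2 / K) (divr_gt0 (divr_gt0 e0 (ltr0Sn _ 1)) K0).
exists (K * (C + D)) => [|s t s1 t1]; first by rewrite mulr_ge0 ?addr_ge0// ltW.
rewrite (_ : _ - _ = f s * (g s - g t) + (f s - f t) * g t); last by ring.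
apply: le_trans (ler_normD _ _) _; rewrite !normrM.
have h1 := hC s t s1 t1; have h2 := hD s t s1 t1.
have : `|f s| * `|g s - g t| <= K * (e / 2 / K + D * (s - t) ^+ 2).
  by apply: ler_pM => //; apply: le_trans (hM s s1) _; rewrite /K; lra.
have : `|f s - f t| * `|g t| <= (e / 2 / K + C * (s - t) ^+ 2) * K.
  by apply: ler_pM => //; apply: le_trans (hN t t1) _; rewrite /K; lra.
set y := (s - t) ^+ 2.
have -> : K * (e / 2 / K + D * y) = e / 2 + K * D * y by field; rewrite gt_eqF.
have -> : (e / 2 / K + C * y) * K = e / 2 + K * C * y by field; rewrite gt_eqF.
lra.
Qed.

(** Arithmetic-geometric mean inequality: [L d <= e + (L^2 / e) d^2]. *)
Lemma lipschitz_qmodulus f L : 0 <= L ->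
  (forall s t, 0 <= s -> s < t -> t <= 1 -> `|f s - f t| <= L * (t - s)) -> qmodulus f.
Proof.
move=> L0 h e e0; exists (L ^+ 2 / e) => [|s t s1 t1]; first by rewrite divr_ge0 ?sqr_ge0// ltW.
have key (d : R) : L * d <= e + L ^+ 2 / e * d ^+ 2.
  rewrite -(ler_pM2l e0).
  have -> : e * (e + L ^+ 2 / e * d ^+ 2) = e ^+ 2 + (L * d) ^+ 2 by field; rewrite gt_eqF.
  by have := sqr_ge0 (e - L * d); have := sqr_ge0 e; have := sqr_ge0 (L * d); lra.
case/andP: s1 => s0 s1; case/andP: t1 => t0 t1.
case: (ltgtP s t) => st.
- by apply: le_trans (h s t s0 st t1) _; rewrite -(sqrrN (s - t)) opprB.
- by rewrite distrC; apply: le_trans (h t s t0 st s1) _.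
- by rewrite st !subrr normr0 expr0n mulr0 addr0 ltW.
Qed.

Lemma unif_qmodulus f : (forall e, 0 < e -> exists2 g, qmodulus g &
  forall s, 0 <= s <= 1 -> `|f s - g s| <= e) -> qmodulus f.
Proof.
move=> h e e0; have e3 : 0 < e / 3 by rewrite divr_gt0.
have [g qg fg] := h _ e3; have [C C0 hC] := qg _ e3; exists C => // s t s1 t1.
have -> : f s - f t = (f s - g s) + ((g s - g t) - (f t - g t)) by ring.
have h1 := fg s s1; have h2 := fg t t1; have h3 := hC s t s1 t1.
apply: le_trans (ler_normD _ _) _; have := ler_normB (g s - g t) (f t - g t).
move: h1 h2 h3; lra.
Qed.

Lemma qmodulus_cst (c : R) : qmodulus (fun=> c).
Proof. by move=> e e0; exists 0 => // s t _ _; rewrite subrr normr0 mul0r addr0 ltW. Qed.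

Lemma qmodulus_id : qmodulus (id : R -> R).
Proof.
apply: (@lipschitz_qmodulus _ 1) => // s t _ st _.
by rewrite mul1r distrC ger0_norm// subr_ge0 ltW.
Qed.

Lemma fcalc_linear f a u v : qmodulus f ->
  fcalc f (a *: u + v) = a *: fcalc f u + fcalc f v.
Proof.
move=> qf; apply: fcalcE => //; under eq_fun do rewrite pact_linear.
by apply: (vcvg_lin Hd); exact: fcalc_cvg.
Qed.

Lemma fcalc_lin a f g v : qmodulus f -> qmodulus g ->
  fcalc (fun s => a * f s + g s) v = a *: fcalc f v + fcalc g v.
Proof.
move=> qf qg; apply: fcalcE; first exact: qmodulus_lin.
have e n : bernstein (fun s => a * f s + g s) n = a *: bernstein f n + bernstein g n.
  rewrite -mul_polyC /bernstein -bernoulli_mean_lin; apply: eq_bernoulli_mean => k _.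
  by rewrite polyCD polyCM.
under eq_fun do rewrite e pactD pactZ.
by apply: (vcvg_lin Hd); exact: fcalc_cvg.
Qed.

Lemma fcalc_bound f M v : qmodulus f -> 0 <= M ->
  (forall s, 0 <= s <= 1 -> `|f s| <= M) -> nrm (fcalc f v) <= M * nrm v.
Proof.
move=> qf M0 hM; have c := vcvg_nrm Hd (fcalc_cvg v qf).
apply: (ler_cvg_to c (cvg_cst _)); apply: nearW => n.
by apply: pbound_nrm => //; exact: bernstein_bound.
Qed.

(** The uniform bound on the polynomials of [f] lets both limits be taken along the same [n]; the
    product of the two polynomials then differs from that of [f g] by an operator of small norm. *)
Lemma fcalcM f g v : qmodulus f -> qmodulus g ->
  fcalc (fun s => f s * g s) v = fcalc f (fcalc g v).
Proof.
move=> qf qg; have [M M0 hM] := qmodulus_bounded qf.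
have c1 : vcvg dot (fun n => pact (bernstein f n.+1) (pact (bernstein g n.+1) v))
    (fcalc f (fcalc g v)).
  pose gv n := pact (bernstein g n.+1) v - fcalc g v.
  have e n : pact (bernstein f n.+1) (pact (bernstein g n.+1) v) =
     1 *: pact (bernstein f n.+1) (gv n) + pact (bernstein f n.+1) (fcalc g v).
    by rewrite -pact_linear scale1r subrK.
  have c2 : vcvg dot (fun n => pact (bernstein f n.+1) (gv n)) 0.
    apply: (vcvg_bound (B := fun n => M * nrm (gv n))) => [n|].
      by rewrite subr0; apply: pbound_nrm => //; exact: bernstein_bound.
    rewrite -[X in _ --> X](mulr0 M); apply: cvgM; first exact: cvg_cst.
    exact: (fcalc_cvg v qg).
  have := vcvg_lin Hd 1 c2 (fcalc_cvg (fcalc g v) qf).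
  by rewrite scaler0 add0r; under eq_fun do rewrite -e.
apply: fcalcE; first exact: qmodulusM.
apply/vcvgP => e e0; have e2 : 0 < e / 2 by rewrite divr_gt0.
move/vcvgP : c1 => /(_ _ e2)[N1 hN1].
pose d := e / 4 / (nrm v + 1) / (M + 1).
have v1 : 0 < nrm v + 1 by rewrite ltr_wpDl ?nrm_ge0.
have M1 : 0 < M + 1 by rewrite ltr_wpDl.
have d0 : 0 < d by rewrite !divr_gt0.
have [C C0 hC] := qg d d0; have [N2 hN2] := harmonic_pair_small C0 d0.
exists (maxn N1 N2) => n; rewrite geq_max => /andP[n1 n2].
have := pbound_nrm v _ (bernsteinM_dist C0 M0 hM hC (ltn0Sn n)).
have q0 : 0 <= C * (n.+1%:R^-1 + n.+1%:R^-1) by rewrite mulr_ge0// addr_ge0.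
rewrite -mulrA -mulrDr => /(_ (mulr_ge0 M0 (addr_ge0 (ltW d0) q0))).
have := hN2 n n n2 n2; set s := C * _ in q0 * => sd.
rewrite pactB pactM; have := hN1 n n1.
set A := pact _ (pact _ _); set B := pact _ v; set l := fcalc f _ => h1 h2.
have h3 : M * (d + s) * nrm v <= e / 2.
  apply: (@le_trans _ _ ((M + 1) * (2 * d) * (nrm v + 1))).
    apply: ler_pM; rewrite ?nrm_ge0 ?lerDl//.
      by rewrite mulr_ge0// addr_ge0// ltW.
    by apply: ler_pM; rewrite ?lerDl// ?addr_ge0// ?ltW//; lra.
  rewrite (_ : _ * _ * _ = e / 2)// /d; field.
  by rewrite !gt_eqF.
have := nrmD Hd (B - A) (A - l); rewrite addrA subrK (nrm_distC Hd B A) => h4.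
by move: h1 h2 h3 h4; lra.
Qed.

Lemma fcalc_id v : fcalc id v = G v.
Proof.
apply: fcalcE; first exact: qmodulus_id.
have e n : bernstein id n.+1 = 'X :> {poly R}.
  rewrite /bernstein (@eq_bernoulli_mean _ _ _ (fun k => (n.+1%:R^-1)%:P * k%:R)) => [|k _].
    by rewrite bernoulli_meanM bernoulli_mean1 mulrA -polyC_natr -polyCM mulVf ?mul1r.
  by rewrite mulrC polyCM polyC_natr.
under eq_fun do rewrite e pactG; exact: vcvg_cst.
Qed.

Lemma fcalc_cst c v : fcalc (fun=> c) v = c *: v.
Proof.
apply: fcalcE; first exact: qmodulus_cst.
have e n : bernstein (fun=> c) n = c%:P by rewrite /bernstein bernoulli_mean_cst.
under eq_fun do rewrite e pactC; exact: vcvg_cst.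
Qed.

Lemma fcalc_ge0 f v : qmodulus f -> (forall s, 0 <= s <= 1 -> 0 <= f s) ->
  0 <= dot (fcalc f v) v.
Proof.
move=> qf f0; have c := vcvg_dot Hd (fcalc_cvg v qf) (vcvg_cst Hd v).
apply: (ler_cvg_to (cvg_cst 0) c); apply: nearW => n.
by apply: pact_cone; exact: bernstein_cone.
Qed.

Lemma fcalc_sym f u v : qmodulus f -> dot (fcalc f u) v = dot u (fcalc f v).
Proof.
move=> qf; have c1 := vcvg_dot Hd (fcalc_cvg u qf) (vcvg_cst Hd v).
have c2 := vcvg_dot Hd (vcvg_cst Hd u) (fcalc_cvg v qf).
rewrite -(cvg_lim _ c1)//; apply/cvg_lim => //.
by under eq_fun do rewrite pact_sym.
Qed.

(** A bounded operator that commutes with [G] commutes with its polynomials, hence with their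
    limits. It need not be symmetric, as it will be the time evolution of an unknown semigroup. *)
Lemma fcalc_comm f (T : V -> V) M v : qmodulus f ->
  (forall a u w, T (a *: u + w) = a *: T u + T w) ->
  (forall u, nrm (T u) <= M * nrm u) -> (forall u, T (G u) = G (T u)) ->
  T (fcalc f v) = fcalc f (T v).
Proof.
move=> qf Tl Tb TG; apply/esym/fcalcE => //.
have T0 : T 0 = 0 by have := Tl (-1) 0 0; rewrite !scaleN1r oppr0 addr0 addNr.
have TB x y : T (x - y) = T x - T y by rewrite addrC -scaleN1r Tl scaleN1r addrC.
have Ti i u : T (iter i G u) = iter i G (T u).
  by elim: i => [//|i IH] /=; rewrite TG IH.
have Tp p u : T (pact p u) = pact p (T u).
  rewrite /pact; elim: (index_enum _) => [|i r IH]; first by rewrite !big_nil.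
  by rewrite !big_cons Tl IH Ti.
apply: (vcvg_bound (B := fun n => M * nrm (pact (bernstein f n.+1) v - fcalc f v))) => [n|].
  by rewrite -Tp -TB Tb.
rewrite -[X in _ --> X](mulr0 M); apply: cvgM; first exact: cvg_cst.
exact: (fcalc_cvg v qf).
Qed.

End Calculus.

End PolyAction.

(** * The semigroup of a resolvent *)

Section HeatFunctions.
Context {R : realType}.
Implicit Types (s t r h : R).

(* With [s = 1 / (1 + x)], these are [exp (- t x)] and its integral in time. *)
Definition heat t s : R := if s <= 0 then 0 else expR (- t * (s^-1 - 1)).

Definition heat_int t s : R :=
  if s <= 0 then 0 else
  let a := s^-1 - 1 in if a == 0 then t else (1 - expR (- t * a)) / a.

Lemma invr_sub1_ge0 s : 0 < s -> s <= 1 -> 0 <= s^-1 - 1.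
Proof. by move=> s0 s1; rewrite subr_ge0 invf_ge1. Qed.

Lemma heat_ge0 t s : 0 <= heat t s.
Proof. by rewrite /heat; case: ifP => // _; exact: expR_ge0. Qed.

Lemma heat_le1 t s : 0 <= t -> s <= 1 -> heat t s <= 1.
Proof.
move=> t0 s1; rewrite /heat; case: (lerP s 0) => // sp.
by rewrite expR_le1 mulNr oppr_le0 mulr_ge0// invr_sub1_ge0.
Qed.

Lemma heatD t r s : heat (t + r) s = heat t s * heat r s.
Proof.
rewrite /heat; case: ifP => _; first by rewrite mulr0.
by rewrite -expRD; congr expR; ring.
Qed.

Lemma heat_norm_le1 t s : 0 <= t -> 0 <= s <= 1 -> `|heat t s| <= 1.
Proof. by move=> t0 /andP[_ s1]; rewrite ger0_norm ?heat_ge0 ?heat_le1. Qed.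

Lemma expRN_le (y : R) : 0 <= y -> expR (- y) <= (1 + y)^-1.
Proof.
move=> y0; rewrite expRN lef_pV2 ?posrE ?expR_gt0//; first exact: expR_ge1Dx.
by rewrite ltr_pwDl.
Qed.

(** If [s < r / 2], then [r <= 2 (r - s)] and [heat t r <= exp t * r / t] suffices. Otherwise the
    bound [exp (- t/r) <= 4 r^2 / t^2] beats the slope of [1/s], at most [2 / r^2] per unit; the
    constant 8 is the product of 4 and 2. *)
Lemma heat_lipschitz t : 0 < t -> forall s r, 0 <= s -> s < r -> r <= 1 ->
  `|heat t s - heat t r| <= 8 * expR t / t * (r - s).
Proof.
move=> t0 s r s0 sr r1; have r0 : 0 < r by exact: le_lt_trans sr.
have L0 : 0 < expR t := expR_gt0 t.
have er : heat t r = expR t * expR (- (t / r)).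
  by rewrite /heat leNgt r0/= -expRD; congr expR; ring.
have tr : 0 < t / r by rewrite divr_gt0.
have mono : heat t s <= heat t r.
  rewrite {1}/heat; case: (lerP s 0) => [_|sp]; first exact: heat_ge0.
  rewrite /heat (leNgt r) r0/= ler_expR !mulNr lerN2 ler_pM2l// lerB// lef_pV2//.
  exact: ltW.
rewrite distrC ger0_norm ?subr_ge0//.
have [sh|hs] := ltP s (r / 2).
  apply: (@le_trans _ _ (heat t r)); first by rewrite gerBl heat_ge0.
  rewrite er; have h1 : expR (- (t / r)) <= r / t.
    apply: le_trans (expRN_le (ltW tr)) _; rewrite -[leRHS]invf_div lef_pV2 ?posrE//; lra.
  apply: (@le_trans _ _ (expR t * (r / t))); first by rewrite ler_pM2l.
  rewrite -subr_ge0 (_ : _ - _ = expR t / t * (8 * (r - s) - r)); last by ring.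
  by apply: mulr_ge0; [rewrite divr_ge0// ltW|lra].
have sp : 0 < s by apply: lt_le_trans hs; rewrite divr_gt0.
have es : heat t s = heat t r * expR (- (t * (s^-1 - r^-1))).
  by rewrite /heat !leNgt r0 sp/= -expRD; congr expR; ring.
have d0 : 0 <= s^-1 - r^-1 by rewrite subr_ge0 lef_pV2 ?posrE// ltW.
have h1 : 1 - expR (- (t * (s^-1 - r^-1))) <= t * (s^-1 - r^-1).
  by have := expR_ge1Dx (- (t * (s^-1 - r^-1))); lra.
have h2 : s^-1 - r^-1 <= 2 * (r - s) / r ^+ 2.
  have -> : s^-1 - r^-1 = (r - s) / r * s^-1 by field; rewrite !gt_eqF.
  have -> : 2 * (r - s) / r ^+ 2 = (r - s) / r * (2 / r) by field; rewrite gt_eqF.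
  apply: ler_wpM2l; first by rewrite divr_ge0 ?subr_ge0 ?ltW.
  rewrite -[leRHS]invf_div lef_pV2 ?posrE//; by rewrite divr_gt0.
have h3 : expR (- (t / r)) <= 4 * r ^+ 2 / t ^+ 2.
  have e2 : expR (t / r) = expR (t / r / 2) ^+ 2 by rewrite expr2 -expRD; congr expR; field; rewrite gt_eqF.
  have q0 : 0 < t / r / 2 by rewrite divr_gt0.
  have : (t / r / 2) ^+ 2 <= expR (t / r).
    rewrite e2 ler_sqr ?nnegrE ?expR_ge0 ?ltW//.
    by have := expR_ge1Dx (t / r / 2); lra.
  rewrite expRN => h; have -> : 4 * r ^+ 2 / t ^+ 2 = ((t / r / 2) ^+ 2)^-1.
    by field; rewrite !gt_eqF.
  by rewrite lef_pV2 ?posrE ?expR_gt0 ?exprn_gt0.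
rewrite es -{1}[heat t r]mulr1 -mulrBr.
apply: (@le_trans _ _ (expR t * (4 * r ^+ 2 / t ^+ 2) * (t * (2 * (r - s) / r ^+ 2)))).
  apply: ler_pM; rewrite ?heat_ge0//.
  - by rewrite subr_ge0 expR_le1 oppr_le0 mulr_ge0// ltW.
  - by rewrite er ler_pM2l.
  - by apply: le_trans h1 _; rewrite ler_pM2l.
by rewrite le_eqVlt; apply/orP; left; apply/eqP; field; rewrite !gt_eqF.
Qed.

Lemma heat_qmodulus t : 0 < t -> qmodulus (heat t).
Proof.
move=> t0; apply: (lipschitz_qmodulus (L := 8 * expR t / t)).
  by rewrite divr_ge0 ?mulr_ge0 ?expR_ge0 ?ltW.
exact: heat_lipschitz.
Qed.

Lemma heat_int0 s : heat_int 0 s = 0.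
Proof.
rewrite /heat_int; case: ifP => // _; case: ifP => // _.
by rewrite oppr0 mul0r expR0 subrr mul0r.
Qed.

(** The integral over [[t, t + h]] of a function decreasing in time. Being an inequality between
    functions of [s], it transfers to operators. *)
Lemma heat_int_sandwich t h s : 0 <= t -> 0 <= h -> 0 <= s <= 1 ->
  h * heat (t + h) s <= heat_int (t + h) s - heat_int t s <= h * heat t s.
Proof.
move=> t0 h0 /andP[s0 s1]; rewrite heatD /heat_int.
case: (lerP s 0) => [sn|sp]; first by rewrite /heat sn !mulr0 subrr lexx.
set a := s^-1 - 1; have a0 : 0 <= a by exact: invr_sub1_ge0.
rewrite /heat (leNgt s) sp/= -/a; have [->|an] := eqVneq a 0.
  by rewrite !mulr0 expR0 !mulr1 addrAC subrr add0r lexx.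
have ap : 0 < a by rewrite lt_neqAle eq_sym an.
have -> : - (t + h) * a = - t * a + - h * a by ring.
rewrite expRD; set u := expR (- t * a); set w := expR (- h * a).
have u0 : 0 <= u by exact: expR_ge0.
have w0 : 0 < w by exact: expR_gt0.
have -> : (1 - u * w) / a - (1 - u) / a = u * ((1 - w) / a) by field.
rewrite mulrCA (mulrC h u); apply/andP; split; apply: ler_wpM2l => //.
  rewrite ler_pdivlMr// -mulrA [w * a]mulrC mulrA.
  have := expR_ge1Dx (h * a); have -> : h * a = - (- h * a) by ring.
  rewrite expRN -/w -(ler_pM2r w0) mulVf ?gt_eqF//; lra.
rewrite ler_pdivrMr//; have := expR_ge1Dx (- h * a); rewrite -/w; lra.
Qed.

Lemma heat_int_ge0 t s : 0 <= t -> 0 <= s <= 1 -> 0 <= heat_int t s.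
Proof.
move=> t0 s1; have := heat_int_sandwich (lexx 0) t0 s1.
rewrite add0r heat_int0 subr0 => /andP[h _]; apply: le_trans h.
by rewrite mulr_ge0 ?heat_ge0.
Qed.

Lemma heat_int_riemann N h s : 0 <= h -> 0 <= s <= 1 ->
  0 <= heat_int (N%:R * h) s - \sum_(k < N) h * heat (k.+1%:R * h) s
    <= h * (1 - heat (N%:R * h) s) .
Proof.
move=> h0 s1; elim: N => [|N /andP[IH1 IH2]].
  rewrite mul0r heat_int0 big_ord0 subr0 lexx/= mulr_ge0// subr_ge0 heat_le1//.
  by case/andP: s1.
have N0 : 0 <= N%:R * h by rewrite mulr_ge0.
have := heat_int_sandwich N0 h0 s1.
have -> : N%:R * h + h = N.+1%:R * h by rewrite -natr1; ring.
rewrite big_ord_recr/= => /andP[]; move: IH1 IH2.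
by set S := \sum_(k < N) _; move=> *; apply/andP; split; lra.
Qed.

(** [heat_int t] is a uniform limit of Riemann sums of functions [heat r] with [r > 0]. *)
Lemma heat_int_qmodulus t : 0 <= t -> qmodulus (heat_int t).
Proof.
move=> t0; have [->|tn] := eqVneq t 0.
  have := @qmodulus_cst R 0; congr qmodulus; apply/funext => s.
  by rewrite heat_int0.
have tp : 0 < t by rewrite lt_neqAle eq_sym tn.
apply: unif_qmodulus => e e0.
have [N hN] : exists N : nat, t / e < N.+1%:R.
  by exists (Num.truncn (t / e)); have := truncnS_gt (t / e).
set h := t / N.+1%:R; have h0 : 0 < h by rewrite divr_gt0.
have th : N.+1%:R * h = t by rewrite mulrC divfK.
(* Right endpoints, since [heat 0] jumps at [s = 0]. *)
exists (fun s => \sum_(k < N.+1) h * heat (k.+1%:R * h) s).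
  elim: (N.+1) => [|M IH].
    have := @qmodulus_cst R 0; congr qmodulus; apply/funext => s.
    by rewrite big_ord0.
  have hM : 0 < M.+1%:R * h by rewrite mulr_gt0.
  have := qmodulus_lin h (heat_qmodulus hM) IH; congr qmodulus; apply/funext => s.
  by rewrite big_ord_recr/= addrC.
move=> s s1; have := heat_int_riemann N.+1 (ltW h0) s1; rewrite th => /andP[h1 h2].
rewrite ger0_norm//; apply: le_trans h2 _.
apply: (@le_trans _ _ h); first by apply: ler_piMr; [exact: ltW|rewrite gerBl heat_ge0].
by rewrite /h ler_pdivrMr// mulrC -ler_pdivrMr// ltW.
Qed.

(** With [s = 1 / (1 + x)] this says that [x] times the integral of [exp (- r x)] over [[0, t]] is
    [1 - exp (- t x)]. *)
Lemma heat_int_resolvent t s : 0 <= s <= 1 ->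
  s * (heat_int t s + 1 - heat t s) = heat_int t s.
Proof.
move=> /andP[s0 s1]; rewrite /heat_int /heat; case: (lerP s 0) => [sn|sp].
  by rewrite (_ : s = 0) ?mul0r//; apply/eqP; rewrite eq_le sn.
have [a0|an] := eqVneq (s^-1 - 1) 0.
  have -> : s = 1 by apply/invr_inj; rewrite invr1; apply/eqP; rewrite -subr_eq0 a0.
  by rewrite invr1 subrr mulr0 expR0; ring.
set w := expR _.
have e : s^-1 = (s^-1 - 1) + 1 by rewrite subrK.
have -> : (1 - w) / (s^-1 - 1) + 1 - w = (1 - w) / (s^-1 - 1) * s^-1.
  rewrite [X in _ = _ * X]e; move: (s^-1 - 1) an => a an; by field.
by rewrite mulrC mulfVK// gt_eqF.
Qed.

Lemma heat_sub1 t s : 0 <= t -> 0 <= s <= 1 -> `|s * (heat t s - 1)| <= t.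
Proof.
move=> t0 /andP[s0 s1]; have h1 := heat_le1 t0 s1.
rewrite normrM distrC (ger0_norm s0) ger0_norm ?subr_ge0//.
rewrite /heat; case: (lerP s 0) => [sn|sp].
  by rewrite (_ : s = 0) ?mul0r//; apply/eqP; rewrite eq_le sn.
have := expR_ge1Dx (- t * (s^-1 - 1)); set w := expR _ => hw.
apply: (@le_trans _ _ (s * (t * (s^-1 - 1)))); first by rewrite ler_pM2l//; lra.
rewrite (_ : _ * _ = t * (1 - s)); last by field; rewrite gt_eqF.
by rewrite ler_piMr// gerBl.
Qed.

(** The function inside the norm is the error of the difference quotient on the range of [G]. It is
    bounded but not uniformly small near [s = 0]; a further factor [s] makes it at most [t], and
    density of the range closes the gap. *)
Lemma heat_gen_bound t s : 0 < t -> 0 <= s <= 1 ->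
  `|s * (heat t s - 1) / t + (1 - s)| <= 1.
Proof.
move=> t0 s1; have := heat_sub1 (ltW t0) s1; have /andP[s0 s1'] := s1.
have h1 := heat_le1 (ltW t0) s1'; set y := s * _ => hy.
have y0 : y <= 0 by rewrite /y mulr_ge0_le0// subr_le0.
rewrite ler_norml.
have : - 1 <= y / t by rewrite ler_pdivlMr// mulN1r; move: hy; rewrite ler_norml => /andP[].
have : y / t <= 0 by rewrite ler_pdivrMr// mul0r.
by move=> *; apply/andP; split; lra.
Qed.

Lemma heat_gen_small t s : 0 < t -> 0 <= s <= 1 ->
  `|(s * (heat t s - 1) / t + (1 - s)) * s| <= t.
Proof.
move=> t0 /andP[s0 s1]; rewrite /heat; case: (lerP s 0) => [sn|sp].
  by rewrite (_ : s = 0) ?mulr0 ?normr0 ?ltW//; apply/eqP; rewrite eq_le sn.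
set a := s^-1 - 1; have a0 : 0 <= a by exact: invr_sub1_ge0.
have ea : s * a = 1 - s by rewrite /a; field; rewrite gt_eqF.
have ta : 0 <= t * a by rewrite mulr_ge0// ltW.
have h1 : 0 <= expR (- t * a) - 1 + t * a by have := expR_ge1Dx (- t * a); lra.
have h2 : expR (- t * a) - 1 + t * a <= (t * a) ^+ 2.
  have := expRN_le ta; rewrite -mulNr => h; rewrite -subr_ge0.
  apply: (@le_trans _ _ ((t * a) ^+ 2 - ((1 + t * a)^-1 - 1 + t * a))); last by lra.
  rewrite (_ : _ - _ = (t * a) ^+ 3 / (1 + t * a)); last by field; rewrite gt_eqF// ltr_pwDl.
  by rewrite divr_ge0 ?exprn_ge0// addr_ge0.
set w := expR _ in h1 h2 *.
have -> : (s * (w - 1) / t + (1 - s)) * s = s ^+ 2 * (w - 1 + t * a) / t.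
  by rewrite -ea; field; rewrite gt_eqF.
rewrite ger0_norm; last by apply: divr_ge0; [apply: mulr_ge0; rewrite ?sqr_ge0|exact: ltW].
rewrite ler_pdivrMr//; apply: (@le_trans _ _ (s ^+ 2 * (t * a) ^+ 2)).
  by rewrite ler_wpM2l ?sqr_ge0.
rewrite (_ : _ * _ = t ^+ 2 * (s * a) ^+ 2); last by ring.
rewrite ea -expr2 ler_piMr ?sqr_ge0// exprn_ile1 ?subr_ge0//.
by rewrite gerBl.
Qed.

End HeatFunctions.

Lemma right0_cvgP (R : realType) (F : R -> R) : (forall t, 0 <= F t) ->
  (F t @[t --> 0^'+] --> (0 : R)) <->
  (forall e, 0 < e -> exists2 d, 0 < d & forall t, 0 < t -> t < d -> F t < e).
Proof.
move=> F0; split=> [/cvgrPdist_lt h e e0|h].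
  have [d /= d0 hd] := h e e0; exists d => // t t0 td; have := hd t _ t0.
  rewrite /= sub0r normrN sub0r normrN (ger0_norm (F0 t)); apply.
  by rewrite ger0_norm// ltW.
apply/cvgrPdist_lt => e /h[d d0 hd]; exists d => //= t td t0.
rewrite sub0r normrN ger0_norm//; apply: hd => //.
by move: td; rewrite /= sub0r normrN ger0_norm// ltW.
Qed.

Section OperatorSemigroup.
Context {R : realType} {V : lmodType R} (dot : V -> V -> R) (Hd : hilbert dot).
Context (G : {linear V -> V}).
Hypotheses (Gsym : forall u v, dot (G u) v = dot u (G v))
  (G0 : forall u, 0 <= dot (G u) u) (G1 : forall u, dot (G u) u <= dot u u)
  (Ginj : forall u, G u = 0 -> u = 0).
Implicit Types (u v w k f g : V).

Local Notation nrm := (nrm dot).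
Local Notation fcalc := (fcalc dot G).
Local Notation pact := (pact G).

Lemma nrm_G u : nrm (G u) <= nrm u.
Proof.
rewrite -(fcalc_id Hd Gsym G0 G1) -[leRHS]mul1r.
apply: (fcalc_bound Hd Gsym G0 G1) => //; first exact: qmodulus_id.
by move=> s /andP[s0 s1]; rewrite ger0_norm.
Qed.

Lemma cone_1B1X n : cone (1 - (1 - 'X) ^+ n : {poly R}).
Proof.
elim: n => [|n IH]; first by rewrite expr0 subrr -polyC0; exact: cone_const.
rewrite (_ : _ - _ = (1 - (1 - 'X) ^+ n) + 'X * (1 - 'X) ^+ n); last by rewrite exprS; ring.
apply: cone_add => //; apply: cone_X; elim: n {IH} => [|n IH]; first exact: cone1.
by rewrite exprS; exact: cone_1X.
Qed.

Lemma cone_1X_exp n : cone ((1 - 'X) ^+ n : {poly R}).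
Proof. by elim: n => [|n IH]; [exact: cone1|rewrite exprS; exact: cone_1X]. Qed.

(* [(1 - G) ^ n v] decreases to a vector of the kernel of [G]. *)
Lemma range_dense v e : 0 < e -> exists k, nrm (v - G k) < e.
Proof.
pose A n := pact ((1 - 'X) ^+ n) v.
pose a n := dot (A n) v.
(* [p] and [1 - p] lie in the cone, hence so does [p - p^2]. *)
have dA n m : (n <= m)%N -> nrm (A n - A m) ^+ 2 <= a n - a m.
  move=> nm; rewrite (nrm_sqr Hd) /a -(dotBl Hd) /A -pactB.
  set p := _ - _; rewrite -subr_ge0.
  have cp : cone p.
    rewrite /p -(subnKC nm) exprD (_ : _ - _ = (1 - 'X) ^+ n * (1 - (1 - 'X) ^+ (m - n))); last by ring.
    by apply: coneM; [exact: cone_1X_exp|exact: cone_1B1X].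
  have c1p : cone (1 - p).
    rewrite /p (_ : _ - _ = (1 - (1 - 'X) ^+ n) + (1 - 'X) ^+ m); last by ring.
    by apply: cone_add; [exact: cone_1B1X|exact: cone_1X_exp].
  have := pact_cone Hd Gsym G0 G1 v (coneM cp c1p).
  rewrite (_ : p * (1 - p) = p - p ^+ 2 * 1); last by ring.
  by rewrite pactB (dotBl Hd) (pact_sqr Hd Gsym) pact1.
have a_dec : nonincreasing_seq a.
  by move=> n m nm; rewrite -subr_ge0; apply: le_trans (dA n m nm); exact: sqr_ge0.
have a_ge0 n : 0 <= a n by apply: (pact_cone Hd Gsym G0 G1); exact: cone_1X_exp.
have ca : cvgn a.
  by apply: nonincreasing_is_cvgn => //; exists 0 => _ [n _ <-].
have aC e' : 0 < e' -> exists N, forall n m, (N <= n)%N -> (N <= m)%N -> `|a n - a m| < e'.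
  move=> e'0; have e2 : 0 < e' / 2 by rewrite divr_gt0.
  move/cvgrPdist_lt : ca => /(_ _ e2)[N _ hN]; exists N => n m /hN h1 /hN h2.
  rewrite (_ : a n - a m = (limn a - a m) - (limn a - a n)); last by ring.
  by apply: le_lt_trans (ler_normB _ _) _; move: h1 h2; lra.
have [w cw] : exists w, vcvg dot A w.
  apply: (hilbert_complete Hd) => e' e'0; have [N hN] := aC (e' ^+ 2) (exprn_gt0 2 e'0).
  exists N => n m Nn Nm; wlog nm : n m Nn Nm / (n <= m)%N.
    by move=> h; case/orP: (leq_total n m) => nm; [exact: h|rewrite nrm_distC//; exact: h].
  rewrite -[X in X < _]ger0_norm ?nrm_ge0//; apply: ltr_norm_sqr => //.
  apply: le_lt_trans (dA n m nm) _; apply: le_lt_trans (ler_norm _) _; exact: hN.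
have w0 : w = 0.
  apply: Ginj; apply: (vcvg_unique Hd (u := fun n => G (A n))).
    apply: (vcvg_bound (B := fun n => nrm (A n - w))) => // n.
    by rewrite -linearB nrm_G.
  apply/vcvgP => e' e'0; have [N hN] := aC (e' ^+ 2) (exprn_gt0 2 e'0).
  exists N => n Nn; rewrite subr0.
  (* A difference of consecutive terms of a Cauchy sequence, so [G] annihilates the limit. *)
  have -> : G (A n) = A n - A n.+1.
    by rewrite /A -pactB -pactX; congr pact; rewrite exprS; ring.
  rewrite -[X in X < _]ger0_norm ?nrm_ge0//; apply: ltr_norm_sqr => //.
  apply: le_lt_trans (dA n n.+1 (leqnSn n)) _; apply: le_lt_trans (ler_norm _) _.
  by apply: hN => //; exact: leqW.
move=> e0; move/vcvgP : cw => /(_ e e0)[N hN].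
(* The quotient of [1 - (1 - 'X)^N] by ['X] provides [k] with [v - G k = A N]. *)
have [p hp] : exists p : {poly R}, 1 - (1 - 'X) ^+ N = 'X * p.
  elim: N {hN} => [|N [p hp]]; first by exists 0; rewrite expr0 subrr mulr0.
  exists (p + (1 - 'X) ^+ N); rewrite mulrDr -hp exprS; ring.
exists (pact p v); rewrite -pactX -hp pactB pact1 subKr.
by have := hN N (leqnn N); rewrite w0 subr0.
Qed.

(** [heat 0] vanishes at [s = 0] and is 1 on the rest of the interval, so the calculus does not
    supply the identity at time 0. *)
Definition sgp (t : R) v := if t == 0 then v else fcalc (heat t) v.

Lemma sgp0 v : sgp 0 v = v.
Proof. by rewrite /sgp eqxx. Qed.

Lemma sgp_gt0 t v : 0 < t -> sgp t v = fcalc (heat t) v.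
Proof. by move=> t0; rewrite /sgp gt_eqF. Qed.

Lemma sgp_linear t a u v : 0 <= t -> sgp t (a *: u + v) = a *: sgp t u + sgp t v.
Proof.
move=> t0; rewrite /sgp; case: eqVneq => // tn.
by rewrite (fcalc_linear Hd Gsym G0 G1)//; apply: heat_qmodulus; rewrite lt_neqAle eq_sym tn.
Qed.

Lemma sgpB t u v : 0 <= t -> sgp t (u - v) = sgp t u - sgp t v.
Proof. by move=> t0; rewrite addrC -scaleN1r sgp_linear// scaleN1r addrC. Qed.

Lemma sgp_contr t v : 0 <= t -> nrm (sgp t v) <= nrm v.
Proof.
move=> t0; rewrite /sgp; case: eqVneq => [_|tn]; first exact: lexx.
have tp : 0 < t by rewrite lt_neqAle eq_sym tn.
rewrite -[leRHS]mul1r; apply: (fcalc_bound Hd Gsym G0 G1) => //; first exact: heat_qmodulus.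
by move=> s; exact: heat_norm_le1.
Qed.

Lemma sgpD s t v : 0 <= s -> 0 <= t -> sgp (s + t) v = sgp s (sgp t v).
Proof.
move=> s0 t0; rewrite /sgp; have [->|sn] := eqVneq s 0; first by rewrite add0r.
have [->|tn] := eqVneq t 0; first by rewrite addr0 (negPf sn).
have sp : 0 < s by rewrite lt_neqAle eq_sym sn.
have tp : 0 < t by rewrite lt_neqAle eq_sym tn.
have st : (s + t == 0) = false by rewrite gt_eqF// addr_gt0.
rewrite st -(fcalcM Hd Gsym G0 G1 v (heat_qmodulus sp) (heat_qmodulus tp)).
by rewrite (_ : heat (s + t) = fun r => heat s r * heat t r)//; apply/funext => r; rewrite heatD.
Qed.

Lemma sgp_sym t u v : 0 <= t -> dot (sgp t u) v = dot u (sgp t v).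
Proof.
move=> t0; rewrite /sgp; case: eqVneq => // tn.
by rewrite (fcalc_sym Hd Gsym G0 G1)//; apply: heat_qmodulus; rewrite lt_neqAle eq_sym tn.
Qed.

Lemma sgp_resolvent_dist t k : 0 <= t -> nrm (sgp t (G k) - G k) <= t * nrm k.
Proof.
move=> t0; rewrite /sgp; have [->|tn] := eqVneq t 0; first by rewrite subrr nrm0// mul0r.
have tp : 0 < t by rewrite lt_neqAle eq_sym tn.
have qh := heat_qmodulus tp; have qi := @qmodulus_id R.
rewrite -(fcalc_id Hd Gsym G0 G1) -(fcalcM Hd Gsym G0 G1)// addrC -scaleN1r.
rewrite -(fcalc_lin Hd Gsym G0 G1)//; last exact: qmodulusM.
apply: (fcalc_bound Hd Gsym G0 G1) => //; first by apply: qmodulus_lin => //; exact: qmodulusM.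
move=> s s1; have := heat_sub1 t0 s1; congr (`|_| <= _); ring.
Qed.

Lemma sgp_strong v : nrm (sgp t v - v) @[t --> 0^'+] --> (0 : R).
Proof.
apply/right0_cvgP => [t|e e0]; first exact: nrm_ge0.
have e4 : 0 < e / 4 by rewrite divr_gt0.
have [k hk] := range_dense v e4.
have k1 : 0 < nrm k + 1 by rewrite ltr_wpDl ?nrm_ge0.
exists (e / 4 / (nrm k + 1)) => [|t t0 td]; first by rewrite divr_gt0.
have t0' := ltW t0.
have -> : sgp t v - v = sgp t (v - G k) - (v - G k) + (sgp t (G k) - G k).
  by rewrite sgpB// opprB addrAC !subrKA.
have h1 := nrmD Hd (sgp t (v - G k) - (v - G k)) (sgp t (G k) - G k).
have h2 := nrmB Hd (sgp t (v - G k)) (v - G k).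
have h3 := sgp_contr (v - G k) t0'; have h4 := sgp_resolvent_dist k t0'.
have h5 : t * nrm k <= e / 4.
  apply: (@le_trans _ _ (t * (nrm k + 1))); first by rewrite ler_pM2l// lerDl.
  by rewrite -ler_pdivlMr// ltW.
by move: hk h1 h2 h3 h4 h5; lra.
Qed.

Definition generates (T : R -> V -> V) f g :=
  nrm (t^-1 *: (T t f - f) - g) @[t --> 0^'+] --> (0 : R).

Let psi t s : R := s * (heat t s - 1) / t + (1 - s).

Let psiE t : 0 < t -> qmodulus (psi t) /\
  forall k, t^-1 *: (sgp t (G k) - G k) - (G k - k) = fcalc (psi t) k.
Proof.
move=> t0; have qh := heat_qmodulus t0; have qi := @qmodulus_id R; have q1 := @qmodulus_cst R 1.
have qhi : qmodulus (fun s => heat t s * s) by exact: qmodulusM.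
have q2 := qmodulus_lin (-1) qi qhi; have q3 := qmodulus_lin (-1) qi q1.
have q4 := qmodulus_lin t^-1 q2 q3.
have E : psi t = fun s => t^-1 * (-1 * s + heat t s * s) + (-1 * s + 1).
  by apply/funext => s; rewrite /psi; ring.
split; first by rewrite E.
move=> k; rewrite E !(fcalc_lin Hd Gsym G0 G1)// (fcalc_id Hd Gsym G0 G1) (fcalcM Hd Gsym G0 G1)//.
rewrite (fcalc_id Hd Gsym G0 G1) (fcalc_cst Hd Gsym G0 G1) scale1r !scaleN1r.
by rewrite /sgp gt_eqF// (addrC (- G k)) opprB (addrC k).
Qed.

Lemma sgp_generates_resolvent k : generates sgp (G k) (G k - k).
Proof.
apply/right0_cvgP => [t|e e0]; first exact: nrm_ge0.
have e2 : 0 < e / 2 by rewrite divr_gt0.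
have [j hj] := range_dense k e2.
have j1 : 0 < nrm j + 1 by rewrite ltr_wpDl ?nrm_ge0.
exists (e / 2 / (nrm j + 1)) => [|t t0 td]; first by rewrite divr_gt0.
have [qp pE] := psiE t0; rewrite pE.
have -> : fcalc (psi t) k = fcalc (psi t) (1 *: (k - G j) + G j) by rewrite scale1r subrK.
rewrite (fcalc_linear Hd Gsym G0 G1)// scale1r.
apply: le_lt_trans (nrmD Hd _ _) _.
have h1 : nrm (fcalc (psi t) (k - G j)) <= 1 * nrm (k - G j).
  by apply: (fcalc_bound Hd Gsym G0 G1) => // s s1; exact: heat_gen_bound.
have h2 : nrm (fcalc (psi t) (G j)) <= t * nrm j.
  rewrite -(fcalc_id Hd Gsym G0 G1) -(fcalcM Hd Gsym G0 G1)//; last exact: qmodulus_id.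
  apply: (fcalc_bound Hd Gsym G0 G1) => //; first by apply: qmodulusM => //; exact: qmodulus_id.
    exact: ltW.
  by move=> s s1; exact: heat_gen_small.
have h5 : t * nrm j <= e / 2.
  apply: (@le_trans _ _ (t * (nrm j + 1))); first by rewrite ler_pM2l// lerDl.
  by rewrite -ler_pdivlMr// ltW.
by move: hj h1 h2 h5; lra.
Qed.

Lemma generates_lin (T : R -> V -> V) a f g f' g' :
  (forall t b u v, 0 <= t -> T t (b *: u + v) = b *: T t u + T t v) ->
  generates T f g -> generates T f' g' -> generates T (a *: f + f') (a *: g + g').
Proof.
move=> Tl h1 h2.
have c : `|a| * nrm (t^-1 *: (T t f - f) - g) + nrm (t^-1 *: (T t f' - f') - g')
   @[t --> 0^'+] --> (0 : R).
  rewrite -[X in _ --> X]addr0 -[X in _ --> X + _](mulr0 `|a|).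
  by apply: cvgD => //; apply: cvgM => //; exact: cvg_cst.
apply: (squeeze_cvgr _ (cvg_cst 0) c); near=> t; rewrite nrm_ge0/=.
have t0 : 0 <= t by apply: ltW; near: t; exact: nbhs_right_gt.
rewrite -nrmZ// (le_trans _ (nrmD Hd _ _))// le_eqVlt; apply/orP; left; apply/eqP; congr nrm.
rewrite Tl// [in RHS]scalerBr; set x := T t f; set y := T t f'.
have -> : a *: x + y - (a *: f + f') = a *: (x - f) + (y - f').
  by rewrite scalerBr opprD addrACA.
by rewrite scalerDr !scalerA (mulrC a) opprD addrACA.
Unshelve. all: by end_near. Qed.

(** Dissipativity: the difference quotients of a contraction semigroup have nonpositive inner
    product with [w], whereas their limit would be [w] itself. *)
Lemma generates_self w : generates sgp w w -> w = 0.
Proof.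
move=> hw.
apply/(nrm_eq0 Hd); rewrite -(@ler_pXn2r _ 2)// ?nnegrE ?nrm_ge0// expr0n/= (nrm_sqr Hd).
have c : nrm (t^-1 *: (sgp t w - w) - w) * nrm w @[t --> 0^'+] --> (0 : R).
  by rewrite -[X in _ --> X](mul0r (nrm w)); apply: cvgM => //; exact: cvg_cst.
apply: (ler_cvg_to (cvg_cst _) c); near=> t.
have t0 : 0 < t by near: t; exact: nbhs_right_gt.
apply: le_trans (dot_le_nrm Hd _ _); rewrite ler_normr; apply/orP; right.
rewrite (dotBl Hd) opprB lerDl oppr_ge0 (dotZl Hd) (dotBl Hd).
rewrite pmulr_rle0 ?invr_gt0// subr_le0.
apply: le_trans (ler_norm _) _; apply: le_trans (dot_le_nrm Hd _ _) _.
by rewrite -(nrm_sqr Hd) expr2 ler_wpM2r ?nrm_ge0// sgp_contr// ltW.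
Unshelve. all: by end_near. Qed.

(** The relation on the right is the graph of [1 - G^-1]. One inclusion is the computation on the
    range of [G]; for the other, the generator extends this graph, and [generates_self] leaves no
    room for a proper extension. *)
Lemma sgp_generates f g : generates sgp f g <-> f = G (f - g).
Proof.
split=> [h|e]; last first.
  by have := sgp_generates_resolvent (f - g); rewrite -e subKr.
set u := G (f - g); pose w := f - u.
have hu : generates sgp u (u - (f - g)) by exact: sgp_generates_resolvent.
have hw : generates sgp (-1 *: u + f) (-1 *: (u - (f - g)) + g).
  by apply: generates_lin => // t b x y t0; exact: sgp_linear.
have ew : -1 *: u + f = w by rewrite scaleN1r addrC.
have eg : -1 *: (u - (f - g)) + g = w.
  by rewrite scaleN1r opprB addrAC subrK.
rewrite {}ew {}eg in hw.
have w0 := generates_self hw.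
by apply/eqP; rewrite -subr_eq0 -/u -/w w0.
Qed.

End OperatorSemigroup.

(** * Local boundedness and uniqueness of strongly continuous semigroups *)

Section BoundedSemigroup.
Context {R : realType} {V : lmodType R} (dot : V -> V -> R) (Hd : hilbert dot).
Local Notation nrm := (nrm dot).

(** The supremum over the unit ball with a near-maximizer. The ratio 3/4 has to exceed 1/2, the
    share that the tail of the hump series may cancel. *)
Lemma operator_norm (S : V -> V) : (forall a u v, S (a *: u + v) = a *: S u + S v) ->
  (exists M, forall v, nrm (S v) <= M * nrm v) ->
  exists N u, [/\ 0 <= N, forall v, nrm (S v) <= N * nrm v, nrm u <= 1
    & 3 / 4 * N <= nrm (S u)].
Proof.
move=> Sl [M hM].
have S0 : S 0 = 0 by have := Sl (-1) 0 0; rewrite !scaleN1r oppr0 addr0 addNr.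
have SZ a u : S (a *: u) = a *: S u by have := Sl a u 0; rewrite S0 !addr0.
pose A := [set nrm (S u) | u in [set u | nrm u <= 1]].
have A0 : A 0 by exists 0 => /=; rewrite ?S0 nrm0 ?ler01.
have sA : has_sup A.
  split; first by exists 0.
  exists `|M| => _ [u u1 <-]; apply: le_trans (hM u) _.
  apply: le_trans (ler_norm _) _; rewrite normrM ler_piMr// ger0_norm ?nrm_ge0//.
have N0 : 0 <= sup A by apply: ub_le_sup => //; case: sA.
have hN v : nrm (S v) <= sup A * nrm v.
  have [v0|v0] := eqVneq (nrm v) 0.
    by rewrite (nrm_eq0 Hd (u := v)) ?v0// S0 !nrm0// mulr0.
  have vp : 0 < nrm v by rewrite lt_neqAle eq_sym v0 nrm_ge0.
  have : nrm (S ((nrm v)^-1 *: v)) <= sup A.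
    apply: ub_le_sup; first by case: sA.
    by exists ((nrm v)^-1 *: v) => //=; rewrite nrmZ// ger0_norm ?invr_ge0 ?nrm_ge0// mulVf.
  rewrite SZ nrmZ// ger0_norm ?invr_ge0 ?nrm_ge0// mulrC ler_pdivrMr//.
have [z|z] := eqVneq (sup A) 0.
  by exists (sup A), 0; split=> //; rewrite ?nrm0 ?z ?mulr0 ?nrm_ge0// ler01.
have Np : 0 < sup A / 4 by rewrite divr_gt0// lt_neqAle eq_sym z.
have [_ [u u1 <-] hu] := sup_adherent Np sA.
by exists (sup A), u; split => //; move: hu; lra.
Qed.

Context (T : R -> V -> V).
Hypotheses (Tbd : forall t, 0 <= t -> exists M, forall v, nrm (T t v) <= M * nrm v)
  (Tlin : forall t a u v, 0 <= t -> T t (a *: u + v) = a *: T t u + T t v)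
  (T0 : forall v, T 0 v = v)
  (TD : forall s t v, 0 <= s -> 0 <= t -> T (s + t) v = T s (T t v))
  (Tstrong : forall v, nrm (T t v - v) @[t --> 0^'+] --> (0 : R)).

Let TB t u v : 0 <= t -> T t (u - v) = T t u - T t v.
Proof. by move=> t0; rewrite addrC -scaleN1r Tlin// scaleN1r addrC. Qed.

Let TZ t a u : 0 <= t -> T t (a *: u) = a *: T t u.
Proof.
move=> t0; have z : T t 0 = 0 by have := TB 0 0 t0; rewrite !subrr.
by have := Tlin a u 0 t0; rewrite z !addr0.
Qed.

Lemma third_geom_cvg : (3^-1 : R) ^+ n @[n --> \oo] --> (0 : R).
Proof. by apply: cvg_expr; rewrite ger0_norm ?invr_ge0// invf_lt1// ltr1n. Qed.

(* Uniform boundedness near 0, by a gliding hump: vectors [u_ n] on which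
   [T (h_ n)] nearly attains its (large) norm are added up with signs and
   weights [3 ^ - n]. *)
Lemma semigroup_unif_bound : exists2 d, 0 < d & exists2 M, 0 <= M &
  forall h, 0 <= h <= d -> forall v, nrm (T h v) <= M * nrm v.
Proof.
apply: contrapT => H.
pose c (n : nat) : R := 3^-1 ^+ n.
have c0 n : 0 < c n by rewrite exprn_gt0// invr_gt0.
have cS n : c n.+1 = c n / 3 by rewrite /c exprSr.
(* Without a uniform bound near 0 there are arbitrarily small times of arbitrarily large norm. Of
   [N_ n * c n] the hump yields 3/4 and the tail costs 1/2; the quarter left exceeds [n], whence the
   factor 4. *)
have ex n : exists p : R * R * V, [/\ 0 <= p.1.1 <= n.+1%:R^-1,
   forall v, nrm (T p.1.1 v) <= p.1.2 * nrm v, nrm p.2 <= 1,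
   3 / 4 * p.1.2 <= nrm (T p.1.1 p.2) & 4 * n%:R / c n < p.1.2].
  apply: contrapT => Hn; apply: H; exists n.+1%:R^-1; first by rewrite invr_gt0.
  exists (4 * n%:R / c n); first by rewrite divr_ge0 ?mulr_ge0// ltW.
  move=> h hh v; have h0 : 0 <= h by case/andP: hh.
  have [N [u [N0 hN u1 hu]]] := operator_norm (fun a u v => Tlin a u v h0) (Tbd h0).
  apply: le_trans (hN v) _; apply: ler_wpM2r; first exact: nrm_ge0.
  by rewrite leNgt; apply/negP => hlt; apply: Hn; exists (h, N, u); split.
have [p hp] := choice ex.
pose h_ n := (p n).1.1; pose N_ n := (p n).1.2; pose u_ n := (p n).2.
have h0 n : 0 <= h_ n by case: (hp n) => /andP[].
(* The images of the two candidates differ by twice the hump, so one of them is at least as large as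
   the hump. *)
pose x := fix x n := if n is m.+1 then
  (if c m * nrm (T (h_ m) (u_ m)) <= nrm (T (h_ m) (x m + c m *: u_ m))
   then x m + c m *: u_ m else x m - c m *: u_ m) else (0 : V).
have cu n : nrm (c n *: u_ n) <= c n.
  rewrite nrmZ// ger0_norm ?(ltW (c0 n))// ler_piMr ?(ltW (c0 n))//; by case: (hp n).
have xS n : nrm (x n.+1 - x n) <= c n.
  rewrite /=; case: ifP => _; rewrite addrC addKr ?nrmN//; exact: cu.
have xT n : c n * nrm (T (h_ n) (u_ n)) <= nrm (T (h_ n) (x n.+1)).
  rewrite /=; case: ifPn => //; rewrite -ltNge => hlt.
  have e : 2 * (c n * nrm (T (h_ n) (u_ n))) =
      nrm (T (h_ n) (x n + c n *: u_ n) - T (h_ n) (x n - c n *: u_ n)).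
    have ee (z w : V) : z + w - (z - w) = 2 *: w.
      by rewrite opprB (addrC z) addrACA subrr addr0 scaler_nat mulr2n.
    rewrite -TB// ee scalerA TZ//.
    by rewrite nrmZ// ger0_norm ?mulrA// mulr_ge0// (ltW (c0 n)).
  have := nrmB Hd (T (h_ n) (x n + c n *: u_ n)) (T (h_ n) (x n - c n *: u_ n)).
  by rewrite -e; move: hlt; lra.
have xj n j : nrm (x (n + j)%N - x n) <= 3 / 2 * (c n - c (n + j)%N).
  elim: j => [|j IH]; first by rewrite addn0 !subrr nrm0// mulr0.
  rewrite addnS -(subrKA (x (n + j)%N)); apply: le_trans (nrmD Hd _ _) _.
  by have := xS (n + j)%N; rewrite cS; move: IH; lra.
have [y cy] : exists y, vcvg dot x y.
  apply: (hilbert_complete Hd) => e e0.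
  have e4 : 0 < e / 4 by rewrite divr_gt0.
  have /cvgrPdist_lt/(_ _ e4)[N _ hN] := third_geom_cvg.
  have key n : (N <= n)%N -> nrm (x n - x N) < e / 2.
    move=> Nn; have := xj N (n - N)%N; rewrite subnKC// => h1.
    have := hN N (leqnn N); rewrite sub0r normrN ger0_norm ?(ltW (c0 N))// -/(c N).
    by have := c0 n; move: h1; lra.
  exists N => n m /key h1 /key h2; rewrite -(subrKA (x N)).
  apply: le_lt_trans (nrmD Hd _ _) _; rewrite (nrm_distC Hd (x N)).
  by move: h1 h2; lra.
(* The tail of the series of weights after [n] sums to [c n / 2]. *)
have yx n : nrm (y - x n.+1) <= c n / 2.
  have c1 : nrm (x (n.+1 + j)%N - x n.+1) @[j --> \oo] --> nrm (y - x n.+1).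
    apply: (vcvg_nrm Hd); apply/vcvgP => e e0; move/vcvgP : cy => /(_ e e0)[N hN].
    exists N => j Nj; rewrite opprB subrKA.
    by apply: hN; exact: leq_trans Nj (leq_addl _ _).
  apply: (ler_cvg_to c1 (cvg_cst _)); apply: nearW => j.
  have := xj n.+1 j; rewrite cS; have := c0 (n.+1 + j)%N; lra.
have big n : n%:R < nrm (T (h_ n) y) \/ n%:R <= nrm (T (h_ n) y).
  right; have [_ hN u1 hu hc] := hp n; rewrite -/(h_ n) -/(N_ n) -/(u_ n) in hN hu hc.
  have e : T (h_ n) (x n.+1) = T (h_ n) y - T (h_ n) (y - x n.+1) by rewrite TB// subKr.
  have := xT n; rewrite e => h1; have := le_trans h1 (nrmB Hd _ _) => h2.
  have N0 : 0 < N_ n by apply: le_lt_trans hc; rewrite divr_ge0 ?mulr_ge0// ltW.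
  have h3 : nrm (T (h_ n) (y - x n.+1)) <= N_ n * (c n / 2).
    by apply: le_trans (hN _) _; rewrite ler_pM2l.
  have h4 : c n * (3 / 4 * N_ n) <= c n * nrm (T (h_ n) (u_ n)) by rewrite ler_pM2l.
  have h5 : 4 * n%:R < N_ n * c n by rewrite -ltr_pdivrMr.
  by move: h2 h3 h4 h5; lra.
(* Strong continuity at 0 keeps [T (h_ n) y] within distance 1 of [y] once [h_ n] is small, against
   its growth in [n]. *)
have /right0_cvgP := Tstrong y => /(_ (fun t => nrm_ge0 dot _) 1 ltr01)[d d0 hd].
have [n hn] : exists n : nat, Num.max d^-1 (nrm y + 1) < n.+1%:R.
  by exists (Num.truncn (Num.max d^-1 (nrm y + 1))); exact: truncnS_gt.
move: hn; rewrite gt_max => /andP[n1 n2].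
have hsmall : h_ n.+1 < d.
  have [/andP[_ hh] _ _ _ _] := hp n.+1; apply: le_lt_trans hh _.
  by rewrite -[d]invrK ltf_pV2 ?posrE ?invr_gt0// (lt_trans n1)// ltr_nat.
have : nrm (T (h_ n.+1) y - y) < 1.
  have [->|hne] := eqVneq (h_ n.+1) 0; first by rewrite T0 subrr nrm0// ltr01.
  by apply: hd => //; rewrite lt_neqAle eq_sym hne h0.
have := nrmD Hd (T (h_ n.+1) y - y) y; rewrite subrK.
have : n.+1%:R <= nrm (T (h_ n.+1) y) by case: (big n.+1) => // /ltW.
by move: n2; lra.
Qed.

(** Every time in [[0, t]] is [J] steps of length at most [d], with [J] depending on [t] only. *)
Lemma semigroup_locally_bounded t : 0 <= t -> exists2 K, 0 <= K &
  forall s, 0 <= s <= t -> forall v, nrm (T s v) <= K * nrm v.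
Proof.
move=> t0; have [d d0 [M M0 hM]] := semigroup_unif_bound.
pose J := (Num.truncn (t / d)).+1.
have J0 : 0 < J%:R :> R by rewrite ltr0n.
have tJ : t / J%:R <= d.
  rewrite ler_pdivrMr// mulrC -ler_pdivrMr//; exact/ltW/truncnS_gt.
exists (M ^+ J); first exact: exprn_ge0.
move=> s /andP[s0 st] v; have iter_bound (r : R) j : 0 <= r <= d -> nrm (T (j%:R * r) v) <= M ^+ j * nrm v.
  move=> /andP[r0 rd]; elim: j => [|j IH]; first by rewrite mul0r T0 expr0 mul1r.
  rewrite -natr1 mulrDl mul1r addrC TD//; last by rewrite mulr_ge0.
  apply: le_trans (hM r _ _) _; first by rewrite r0.
  by rewrite exprS -mulrA ler_wpM2l.
have -> : s = J%:R * (s / J%:R) by rewrite mulrC divfK// gt_eqF.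
apply: iter_bound; rewrite divr_ge0 ?(ltW J0)//=.
by apply: le_trans tJ; rewrite ler_pM2r ?invr_gt0.
Qed.

Section Uniqueness.
Context (G : {linear V -> V}).
Hypotheses (Gsym : forall u v, dot (G u) v = dot u (G v))
  (G0 : forall u, 0 <= dot (G u) u) (G1 : forall u, dot (G u) u <= dot u u)
  (Ginj : forall u, G u = 0 -> u = 0).
Hypothesis Tgen : forall f g, generates dot T f g <-> f = G (f - g).

(** A semigroup maps the domain of its generator into itself and commutes with it. *)
Lemma semigroup_resolvent_comm t k : 0 <= t -> T t (G k) = G (T t k).
Proof.
move=> t0; have [M hM] := Tbd t0.
have gk : generates dot T (G k) (G k - k) by apply/Tgen; rewrite subKr.
have : generates dot T (T t (G k)) (T t (G k - k)).
  have c : M * nrm (h^-1 *: (T h (G k) - G k) - (G k - k)) @[h --> 0^'+] --> (0 : R).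
    by rewrite -[X in _ --> X](mulr0 M); apply: cvgM => //; exact: cvg_cst.
  apply: (squeeze_cvgr _ (cvg_cst 0) c); near=> h; rewrite nrm_ge0/=.
  have h0 : 0 <= h by apply: ltW; near: h; exact: nbhs_right_gt.
  by rewrite -TD// (addrC h) TD// -TB// -TZ// -TB.
by move=> /Tgen; rewrite -TB// subKr.
Unshelve. all: by end_near. Qed.

(** On the range of [G] both difference quotients have the same limit, so one step of length [h]
    costs [h] times a small quantity and [t / h] steps cost [t] times it; density of the range gives
    the rest. *)
Lemma semigroup_unique t v : 0 <= t -> T t v = sgp dot G t v.
Proof.
move=> t0; have [->|tn] := eqVneq t 0; first by rewrite T0 /sgp eqxx.
have tp : 0 < t by rewrite lt_neqAle eq_sym tn.
have [K K0 hK] := semigroup_locally_bounded t0.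
have subB (x y z : V) : x - z - (y - z) = x - y by rewrite opprB subrKA.
have comm s r w : 0 <= s -> 0 <= r -> T s (sgp dot G r w) = sgp dot G r (T s w).
  move=> s0 r0; rewrite /sgp; case: eqVneq => // rn.
  have [M hM] := Tbd s0.
  apply: (fcalc_comm Hd Gsym G0 G1 (M := M)) => //.
  - by apply: heat_qmodulus; rewrite lt_neqAle eq_sym rn.
  - by move=> *; exact: Tlin.
  - by move=> u; exact: semigroup_resolvent_comm.
have range k : T t (G k) = sgp dot G t (G k).
  set f := G k; apply/eqP; rewrite -subr_eq0; apply/eqP/(nrm_eq0 Hd).
  (* Telescoping: the errors are carried by [T], bounded by [K] on [[0, t]], and by the contraction
     [sgp], after commuting the two. *)
  have step h j : 0 <= h -> j%:R * h <= t ->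
      nrm (T (j%:R * h) f - sgp dot G (j%:R * h) f) <= j%:R * (K * nrm (T h f - sgp dot G h f)).
    move=> h0; elim: j => [|j IH] jt.
      by rewrite !mul0r T0 /sgp eqxx subrr nrm0.
    have jt' : j%:R * h <= t by apply: le_trans jt; rewrite ler_wpM2r// ler_nat.
    have jh0 : 0 <= j%:R * h by rewrite mulr_ge0.
    have -> : j.+1%:R * h = j%:R * h + h by rewrite -natr1 mulrDl mul1r.
    rewrite TD// (addrC _ h) (sgpD Hd Gsym G0 G1)//.
    rewrite -(subrKA (T (j%:R * h) (sgp dot G h f))) -TB// comm// -(sgpB Hd Gsym G0 G1)//.
    apply: le_trans (nrmD Hd _ _) _; rewrite -natr1 mulrDl mul1r addrC; apply: lerD.
      by apply: le_trans (IH jt'); exact: sgp_contr.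
    by apply: hK; rewrite jh0.
  apply/ler_addgt0Pr => e e0; rewrite add0r.
  have tK : 0 < t * (K + 1) by rewrite mulr_gt0// ltr_wpDl.
  have e1 : 0 < e / (t * (K + 1)) / 2 by rewrite !divr_gt0.
  have g1 : generates dot T f (f - k) by apply/Tgen; rewrite subKr.
  have g2 : generates dot (sgp dot G) f (f - k) by exact: sgp_generates_resolvent.
  have /right0_cvgP/(_ _ e1)[//|d1 d10 hd1] := g1; first by move=> ?; exact: nrm_ge0.
  have /right0_cvgP/(_ _ e1)[//|d2 d20 hd2] := g2; first by move=> ?; exact: nrm_ge0.
  have d0 : 0 < Num.min d1 d2 by rewrite lt_min d10 d20.
  pose N := (Num.truncn (t / Num.min d1 d2)).+1; have N0 : 0 < N%:R :> R by rewrite ltr0n.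
  pose h := t / N%:R; have hp : 0 < h by rewrite divr_gt0.
  have hd : h < Num.min d1 d2.
    by rewrite /h ltr_pdivrMr// mulrC -ltr_pdivrMr//; exact: truncnS_gt.
  have Nh : N%:R * h = t by rewrite mulrC divfK// gt_eqF.
  have := step h N (ltW hp); rewrite Nh => /(_ (lexx t)) h1.
  move: hd; rewrite lt_min => /andP[/(hd1 h hp) b1 /(hd2 h hp) b2].
  have h2 : nrm (T h f - sgp dot G h f) <= h * (e / (t * (K + 1))).
    have -> : T h f - sgp dot G h f = h *: ((h^-1 *: (T h f - f) - (f - k))
        - (h^-1 *: (sgp dot G h f - f) - (f - k))).
      by rewrite subB -scalerBr scalerA divff ?gt_eqF// scale1r subB.
    rewrite nrmZ// ger0_norm ?(ltW hp)// ler_pM2l//.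
    apply: le_trans (nrmB Hd _ _) _; apply: le_trans (ltW (ltrD b1 b2)) _.
    by rewrite -splitr lexx.
  apply: le_trans h1 _; apply: (@le_trans _ _ (N%:R * ((K + 1) * (h * (e / (t * (K + 1))))))).
    apply: ler_wpM2l => //; apply: ler_pM; rewrite ?nrm_ge0//.
    by rewrite lerDl.
  rewrite le_eqVlt; apply/orP; left; apply/eqP.
  have -> (z : R) : N%:R * ((K + 1) * (h * z)) = (N%:R * h) * (K + 1) * z by ring.
  by rewrite Nh mulrC divfK// gt_eqF.
apply/eqP; rewrite -subr_eq0; apply/eqP/(nrm_eq0 Hd)/ler_addgt0Pr => e e0; rewrite add0r.
have K1 : 0 < K + 1 by rewrite ltr_wpDl.
have [k hk] := range_dense Hd Gsym G0 G1 Ginj v (divr_gt0 e0 K1).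
have -> : T t v - sgp dot G t v = T t (v - G k) - sgp dot G t (v - G k).
  by rewrite TB// (sgpB Hd Gsym G0 G1)// range subB.
apply: le_trans (nrmB Hd _ _) _.
have h1 := hK t (andb_true_intro (conj t0 (lexx t))) (v - G k).
have h2 := sgp_contr Hd Gsym G0 G1 (v - G k) t0.
by move: hk; rewrite ltr_pdivlMr//; move: h1 h2; lra.
Qed.

End Uniqueness.

End BoundedSemigroup.

(** A negative increment is treated by the sandwich started at [h + t], which stays positive for
    [|h| < t]. *)
Lemma derive_sandwich (R : realType) (F a : R -> R) (t : R) : 0 < t ->
  (forall s h, 0 <= s -> 0 < h -> h * a (s + h) <= F (s + h) - F s <= h * a s) ->
  {for t, continuous a} ->
  h^-1 * (F (h + t) - F t) @[h --> (0 : R)^'] --> a t.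
Proof.
move=> t0 sandwich ac; apply/cvgrPdist_lt => e e0.
have c1 : h + t @[h --> (0 : R)] --> t.
  by rewrite -[X in _ --> X]add0r; apply: cvgD => //; exact: cvg_cst.
have c2 : a (h + t) @[h --> (0 : R)] --> a t by exact: continuous_cvg.
move/cvgrPdist_lt : c2 => /(_ e e0) ac'.
near=> h.
have h0 : h != 0 by near: h; exact: nbhs_dnbhs_neq.
have hac : `|a t - a (h + t)| < e by near: h; exact: nbhs_dnbhs.
have ht : 0 < h + t.
  have : `|h| < t by near: h; exact: dnbhs0_lt.
  by rewrite ltr_norml => /andP[]; lra.
apply: le_lt_trans hac.
have [hn|hp|hz] := ltgtP h 0; last by rewrite hz eqxx in h0.
- have nh : 0 < - h by rewrite oppr_gt0.
  have := sandwich _ _ (ltW ht) nh; rewrite [h + t - h]addrAC subrr add0r => /andP[h1 h2].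
  have q1 : a t <= h^-1 * (F (h + t) - F t) by rewrite mulrC ler_ndivlMr//; lra.
  have q2 : h^-1 * (F (h + t) - F t) <= a (h + t) by rewrite mulrC ler_ndivrMr//; lra.
  have q3 := le_trans q1 q2.
  rewrite distrC ger0_norm ?subr_ge0//.
  by rewrite distrC ger0_norm ?subr_ge0// lerB.
- have := sandwich _ _ (ltW t0) hp; rewrite (addrC t) => /andP[h1 h2].
  have q1 : a (h + t) <= h^-1 * (F (h + t) - F t) by rewrite mulrC ler_pdivlMr//; lra.
  have q2 : h^-1 * (F (h + t) - F t) <= a t by rewrite mulrC ler_pdivrMr//; lra.
  have q3 := le_trans q1 q2.
  rewrite ger0_norm ?subr_ge0//.
  by rewrite ger0_norm ?subr_ge0// lerB.
Unshelve. all: by end_near. Qed.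

Lemma derive1_cvg (R : realType) (F : R -> R) (s l : R) :
  h^-1 * (F (h + s) - F s) @[h --> (0 : R)^'] --> l ->
  derivable F s 1 /\ derive1 F s = l.
Proof.
move=> c; have c' : h^-1 *: ((F \o shift s) (h *: (1 : R)) - F s) @[h --> (0 : R)^'] --> l.
  rewrite (_ : (fun h => _) = (fun h => h^-1 * (F (h + s) - F s)))//.
  by apply/funext => h; rewrite /= -[h *: 1]/(h * 1) mulr1.
by split; [apply/cvg_ex; exists l|exact: cvg_lim c].
Qed.

Opaque fcalc heat heat_int sgp.

(** * The time integral of the semigroup *)

Section TimeIntegral.
Context {R : realType} {V : lmodType R} (dot : V -> V -> R) (Hd : hilbert dot).
Context (G : {linear V -> V}).
Hypotheses (Gsym : forall u v, dot (G u) v = dot u (G v))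
  (G0 : forall u, 0 <= dot (G u) u) (G1 : forall u, dot (G u) u <= dot u u)
  (Ginj : forall u, G u = 0 -> u = 0).
Implicit Types (u v w k f g : V).

Local Notation nrm := (nrm dot).
Local Notation fcalc := (fcalc dot G).
Local Notation sgp := (sgp dot G).

(** Defined by the calculus, where its algebraic identities are pointwise ones; it is identified
    with the Lebesgue integral only in [integral_sgp]. *)
Definition sgp_int (t : R) f := fcalc (heat_int t) f.

Let fcalcB (c : R) (p r : R -> R) f : qmodulus p -> qmodulus r ->
  fcalc r f - c *: fcalc p f = fcalc (fun s => - c * p s + r s) f.
Proof. by move=> qp qr; rewrite (fcalc_lin Hd Gsym G0 G1)// scaleNr addrC. Qed.

Let fcalc_le0 (p : R -> R) f : qmodulus p -> (forall s, 0 <= s <= 1 -> p s <= 0) ->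
  dot (fcalc p f) f <= 0.
Proof.
move=> qp p0; have q0 := @qmodulus_cst R 0.
have := fcalcB 1 f qp q0; rewrite (fcalc_cst Hd Gsym G0 G1) scale0r scale1r sub0r => e.
rewrite -oppr_ge0 -(dotNl Hd) e.
apply: (fcalc_ge0 Hd Gsym G0 G1); first exact: qmodulus_lin.
by move=> s /p0; lra.
Qed.

Lemma sgp_int_resolvent t f : 0 < t -> G (sgp_int t f + f - sgp t f) = sgp_int t f.
Proof.
move=> t0; have qh := heat_qmodulus t0; have qi := heat_int_qmodulus (ltW t0).
have q1 := @qmodulus_cst R 1; have qid := @qmodulus_id R.
have q2 := qmodulus_lin 1 qi q1; have q3 := qmodulus_lin (-1) qh q2.
have -> : sgp_int t f + f - sgp t f = fcalc (fun s => -1 * heat t s + (1 * heat_int t s + 1)) f.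
  rewrite (fcalc_lin Hd Gsym G0 G1 (-1) f qh q2) (fcalc_lin Hd Gsym G0 G1 1 f qi q1).
  by rewrite (fcalc_cst Hd Gsym G0 G1) sgp_gt0// !scale1r scaleN1r addrC.
rewrite -(fcalc_id Hd Gsym G0 G1) -(fcalcM Hd Gsym G0 G1 f qid q3).
apply: eq_fcalc; first exact: qmodulusM.
by move=> s s1; rewrite -[RHS](heat_int_resolvent t s1) /=; ring.
Qed.

Lemma sgp_sgp_int_ge0 t f : 0 < t -> 0 <= dot (sgp t f) (sgp_int t f).
Proof.
move=> t0; have qh := heat_qmodulus t0; have qi := heat_int_qmodulus (ltW t0).
rewrite sgp_gt0// (dotC Hd) -(fcalc_sym Hd Gsym G0 G1 _ _ qh) -(fcalcM Hd Gsym G0 G1 f qh qi).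
apply: (fcalc_ge0 Hd Gsym G0 G1); first exact: qmodulusM.
by move=> s s1; rewrite mulr_ge0 ?heat_ge0// heat_int_ge0// ltW.
Qed.

Lemma sgp_sqr_le t f : 0 < t -> nrm (sgp t f) ^+ 2 <= dot (sgp t f) f.
Proof.
move=> t0; have qh := heat_qmodulus t0; have qh2 := qmodulusM qh qh.
rewrite (nrm_sqr Hd) sgp_gt0// (fcalc_sym Hd Gsym G0 G1 _ _ qh) -(fcalcM Hd Gsym G0 G1 f qh qh).
rewrite (dotC Hd f) -subr_ge0 -(dotBl Hd).
rewrite -[X in _ - X]scale1r fcalcB //.
apply: (fcalc_ge0 Hd Gsym G0 G1); first exact: qmodulus_lin.
move=> s s1; rewrite (_ : _ + _ = heat t s * (1 - heat t s)); last by ring.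
rewrite mulr_ge0 ?heat_ge0// subr_ge0; apply: heat_le1; first exact: ltW.
by case/andP: s1.
Qed.

Lemma sgp_int_sandwich t h f : 0 <= t -> 0 < h ->
  h * dot (sgp (t + h) f) f <= dot (sgp_int (t + h) f) f - dot (sgp_int t f) f
    <= h * dot (sgp t f) f.
Proof.
move=> t0 h0; have th : 0 < t + h by rewrite ltr_wpDl.
have qh := heat_qmodulus th; have qi := heat_int_qmodulus t0; have qih := heat_int_qmodulus (ltW th).
have qd := qmodulus_lin (-1) qi qih.
rewrite sgp_gt0// -(dotBl Hd) /sgp_int.
rewrite -[X in _ - X]scale1r fcalcB //.
apply/andP; split.
  rewrite -subr_ge0 -(dotZl Hd) -(dotBl Hd).
  rewrite fcalcB //.
  apply: (fcalc_ge0 Hd Gsym G0 G1); first exact: qmodulus_lin.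
  move=> s s1; have /andP[h1 _] := heat_int_sandwich t0 (ltW h0) s1.
  by move: h1; lra.
(* At time 0 the constant 1 replaces [heat 0], which is too small at [s = 0]. *)
have [p [qg eg hg]] : exists p : R -> R, [/\ qmodulus p, sgp t f = fcalc p f
    & forall s, 0 <= s <= 1 -> heat t s <= p s].
  have [->|tn] := eqVneq t 0.
    exists (fun=> 1); split; first exact: qmodulus_cst.
      by rewrite sgp0 (fcalc_cst Hd Gsym G0 G1) scale1r.
    by move=> s /andP[_ s1]; exact: heat_le1.
  have tp : 0 < t by rewrite lt_neqAle eq_sym tn.
  by exists (heat t); split; [exact: heat_qmodulus|exact: sgp_gt0|].
rewrite eg -subr_le0 -(dotZl Hd) -(dotBl Hd) (fcalcB h f qg qd).
apply: fcalc_le0; first exact: qmodulus_lin.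
move=> s s1; have /andP[_ h1] := heat_int_sandwich t0 (ltW h0) s1.
have : h * heat t s <= h * p s by rewrite ler_pM2l// hg.
by move: h1; lra.
Qed.

Lemma sgp_int0 f : sgp_int 0 f = 0.
Proof.
rewrite /sgp_int (@eq_fcalc _ _ dot G _ (fun=> 0)); first by rewrite (fcalc_cst Hd Gsym G0 G1) scale0r.
  exact: heat_int_qmodulus.
by move=> s _; rewrite heat_int0.
Qed.

Lemma sgp_int_ge t f : 0 < t -> t * dot (sgp t f) f <= dot (sgp_int t f) f.
Proof.
move=> t0; have := sgp_int_sandwich f (lexx 0) t0.
by rewrite add0r sgp_int0 (dot0l Hd) subr0 => /andP[].
Qed.

(** Frozen at negative times, so that [a] and [F] below are continuous on the whole line. *)
Let a f g (t : R) : R := dot (sgp (Num.max t 0) f) g.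
Let F f g (t : R) : R := dot (sgp_int (Num.max t 0) f) g.

Let max0_ge0 (t : R) : 0 <= Num.max t 0.
Proof. by rewrite le_max lexx orbT. Qed.

Let max0_id (t : R) : 0 <= t -> Num.max t 0 = t.
Proof. by move=> t0; rewrite max_l. Qed.

Let a_dist f g (s t : R) : 0 <= s -> s <= t ->
  `|dot (sgp t f) g - dot (sgp s f) g| <= nrm (sgp (t - s) f - f) * nrm g.
Proof.
move=> s0 st; have ts : 0 <= t - s by rewrite subr_ge0.
have e0 : dot (sgp t f) g = dot (sgp s (sgp (t - s) f)) g.
  by have := sgpD Hd Gsym G0 G1 f s0 ts; rewrite subrKC => ->.
have e : dot (sgp t f) g - dot (sgp s f) g = dot (sgp s (sgp (t - s) f - f)) g.
  have := sgpB Hd Gsym G0 G1 (sgp (t - s) f) f s0 => ->.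
  have := dotBl Hd (sgp s (sgp (t - s) f)) (sgp s f) g => ->.
  exact: (congr1 (fun z => z - _) e0).
rewrite e; apply: le_trans (dot_le_nrm Hd _ _) _.
apply: ler_wpM2r; [exact: nrm_ge0|exact: sgp_contr].
Qed.

Let max0_dist_lt (s t d : R) : `|s - t| < d -> `|Num.max s 0 - Num.max t 0| < d.
Proof.
rewrite !ltr_norml => /andP[h1 h2].
by apply/andP; split; case: (lerP s 0) => s0; case: (lerP t 0) => t0; lra.
Qed.

Let a_cont f g : continuous (a f g).
Proof.
move=> t; apply/cvgrPdist_lt => e e0.
have g1 : 0 < nrm g + 1 by rewrite ltr_wpDl ?nrm_ge0.
have /right0_cvgP/(_ (e / (nrm g + 1)))[||d d0 hd] := sgp_strong Hd Gsym G0 G1 Ginj f.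
- by move=> ?; exact: nrm_ge0.
- by rewrite divr_gt0.
have key s r : 0 <= s -> s <= r -> r - s < d ->
    `|dot (sgp r f) g - dot (sgp s f) g| < e.
  move=> s0 sr rd; apply: le_lt_trans (a_dist f g s0 sr) _.
  have [->|rs] := eqVneq (r - s) 0.
    by rewrite sgp0 subrr nrm0// mul0r.
  have rs0 : 0 < r - s by rewrite lt_neqAle eq_sym rs subr_ge0.
  apply: (@le_lt_trans _ _ (nrm (sgp (r - s) f - f) * (nrm g + 1))).
    by rewrite ler_wpM2l ?nrm_ge0// lerDl.
  by rewrite -ltr_pdivlMr// hd.
near=> s; rewrite /a.
have st : `|t - s| < d by near: s; exact: cvgr_dist_lt.
have := max0_dist_lt st; set x := Num.max t 0; set y := Num.max s 0 => xy.
have [h|h] := lerP x y.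
  by rewrite distrC; apply: key => //; [exact: max0_ge0|move: xy; rewrite distrC ger0_norm ?subr_ge0].
apply: key; [exact: max0_ge0|exact: ltW|].
by move: xy; rewrite ger0_norm// subr_ge0 ltW.
Unshelve. all: by end_near. Qed.

Let F_lip f g (s t : R) : 0 <= s -> s <= t ->
  `|dot (sgp_int t f) g - dot (sgp_int s f) g| <= (t - s) * (nrm f * nrm g).
Proof.
move=> s0 st; have qs := heat_int_qmodulus s0; have qt := heat_int_qmodulus (le_trans s0 st).
have ts : 0 <= t - s by rewrite subr_ge0.
rewrite -(dotBl Hd); apply: le_trans (dot_le_nrm Hd _ _) _.
rewrite mulrA; apply: ler_wpM2r; first exact: nrm_ge0.
rewrite -[X in _ - X]scale1r fcalcB //.
apply: (fcalc_bound Hd Gsym G0 G1) => //; first exact: qmodulus_lin.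
move=> r r1; have := heat_int_sandwich s0 ts r1; rewrite subrKC => /andP[h1 h2].
have h3 : 0 <= (t - s) * heat t r by rewrite mulr_ge0 ?heat_ge0.
have h4 : (t - s) * heat s r <= t - s.
  by rewrite ler_piMr// heat_le1//; case/andP: r1.
by rewrite mulN1r addrC ger0_norm; [exact: le_trans h2 h4|exact: le_trans h3 h1].
Qed.

Let F_cont f g : continuous (F f g).
Proof.
move=> t; apply/cvgrPdist_lt => e e0.
pose C := nrm f * nrm g + 1.
have C0 : 0 < C by rewrite ltr_wpDl// mulr_ge0 ?nrm_ge0.
have key s r : 0 <= s -> s <= r -> r - s < e / C ->
    `|dot (sgp_int r f) g - dot (sgp_int s f) g| < e.
  move=> s0 sr; rewrite ltr_pdivlMr// => rd; apply: le_lt_trans (F_lip f g s0 sr) _.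
  by apply: le_lt_trans rd; rewrite ler_wpM2l ?subr_ge0// lerDl.
near=> s; rewrite /F.
have st : `|t - s| < e / C by near: s; apply: cvgr_dist_lt => //; rewrite divr_gt0.
have := max0_dist_lt st; set x := Num.max t 0; set y := Num.max s 0 => xy.
have [h|h] := lerP x y.
  by rewrite distrC; apply: key => //; [exact: max0_ge0|move: xy; rewrite distrC ger0_norm ?subr_ge0].
apply: key; [exact: max0_ge0|exact: ltW|].
by move: xy; rewrite ger0_norm// subr_ge0 ltW.
Unshelve. all: by end_near. Qed.

Let F_deriv_diag f (t : R) : 0 < t ->
  h^-1 * (F f f (h + t) - F f f t) @[h --> (0 : R)^'] --> a f f t.
Proof.
move=> t0; apply: derive_sandwich => //; last exact: a_cont.
move=> s h s0 h0; rewrite /a /F !max0_id ?addr_ge0 ?(ltW h0)//.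
exact: sgp_int_sandwich.
Qed.

Let polarize (S : V -> V) f g : (forall b u v, S (b *: u + v) = b *: S u + S v) ->
  (forall u v, dot (S u) v = dot u (S v)) ->
  dot (S f) g = (dot (S (f + g)) (f + g) - dot (S (f - g)) (f - g)) / 4.
Proof.
move=> Sl Ss.
have -> : f - g = -1 *: g + f by rewrite scaleN1r addrC.
have -> : f + g = 1 *: g + f by rewrite scale1r addrC.
rewrite !Sl !(dotDl Hd) !(dotDr Hd) !(dotZl Hd) !(dotZr Hd) (Ss g f) (dotC Hd g).
by field.
Qed.

(** The sandwich rests on positivity and holds on the diagonal only; symmetry of the operators gives
    the rest by polarization. *)
Let F_deriv f g (t : R) : 0 < t ->
  h^-1 * (F f g (h + t) - F f g t) @[h --> (0 : R)^'] --> a f g t.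
Proof.
move=> t0.
have Fp s : F f g s = (F (f + g) (f + g) s - F (f - g) (f - g) s) / 4.
  rewrite /F; apply: polarize => [b u v|u v].
    exact: (fcalc_linear Hd Gsym G0 G1 b u v (heat_int_qmodulus (max0_ge0 s))).
  exact: (fcalc_sym Hd Gsym G0 G1 u v (heat_int_qmodulus (max0_ge0 s))).
have -> : a f g t = (a (f + g) (f + g) t - a (f - g) (f - g) t) / 4.
  rewrite /a; apply: polarize => [b u v|u v]; first exact: sgp_linear.
  exact: sgp_sym.
have -> : (fun h => h^-1 * (F f g (h + t) - F f g t)) =
  (fun h => (h^-1 * (F (f + g) (f + g) (h + t) - F (f + g) (f + g) t)
           - h^-1 * (F (f - g) (f - g) (h + t) - F (f - g) (f - g) t)) / 4).
  apply/funext => h.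
  have gen (A B C D k : R) : k * ((A - B) / 4 - (C - D) / 4) = (k * (A - C) - k * (B - D)) / 4.
    by ring.
  exact: etrans (congr2 (fun x y => h^-1 * (x - y)) (Fp (h + t)) (Fp t)) (gen _ _ _ _ _).
by apply: cvgM; [apply: cvgB; exact: F_deriv_diag|exact: cvg_cst].
Qed.

Lemma integral_sgp f g (t : R) : 0 < t ->
  \int[lebesgue_measure]_(s in `[0, t]) dot (sgp s f) g = dot (sgp_int t f) g.
Proof.
move=> t0.
have dF s : 0 < s -> derivable (F f g) s 1 /\ derive1 (F f g) s = a f g s.
  by move=> s0; apply: derive1_cvg; exact: F_deriv.
transitivity (\int[lebesgue_measure]_(s in `[0, t]) a f g s).
  apply: eq_Rintegral => s; rewrite inE/= in_itv/= => /andP[s0 _].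
  by rewrite /a (max0_id s0).
rewrite /Rintegral (@continuous_FTC2 R (a f g) (F f g) 0 t t0).
- rewrite -EFinB /= /F (max0_id (ltW t0)) (max0_id (lexx 0)).
  by rewrite sgp_int0 (dot0l Hd) subr0.
- by apply: continuous_subspaceT; exact: a_cont.
- split.
  + by move=> s; rewrite in_itv/= => /andP[s0 _]; case: (dF s s0).
  + by apply: cvg_at_right_filter; exact: F_cont.
  + by apply: cvg_at_left_filter; exact: F_cont.
- by move=> s; rewrite in_itv/= => /andP[s0 _]; case: (dF s s0).
Qed.

End TimeIntegral.

(** * Asymptotics of the Green function *)

Section GreenAsymptotics.
Context {R : realType} {X : choiceType} (b : X -> X -> R) (q : X -> R).
Hypotheses (bgraph : is_graph b) (bconn : graph_connected b) (hge0 : hform_ge0 b q).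
Implicit Types (f g u v phi : X -> R).

Local Notation h := (hform b q).
Local Notation E := (closure_bform b q).
Local Notation D := (closure_dom b q).

Lemma closure_hcap_le x u : D u -> hcap b q x * u x ^+ 2 <= E u u.
Proof.
move=> du; have := @closure_bform_ge _ _ _ _ bgraph hge0 (hcap b q x) 1 0 x x u du.
rewrite mul1r mul0r addr0; apply => phi fp.
by rewrite mul1r mul0r addr0; exact: hcap_le.
Qed.

(* [u] stands for both [(H1 + mu)^-1 1_x] as [mu] tends to 0 and the integral of
   [e^(-s H1) 1_x] over [[0, t]] as [t] tends to infinity. *)
Section Family.
Context (T : Type) (F : set_system T) {FF : ProperFilter F} (u : T -> X -> R) (x : X).
Hypothesis uE : \forall t \near F, D (u t) /\ E (u t) (u t) <= u t x.

(** [cap x * u(x)^2 <= E(u, u) <= u(x)] bounds [u(x)] by [1 / cap x], and then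
    [cap y * u(y)^2 <= u(x)] bounds [u(y)]. *)
Lemma no_blowup y : (forall z, hcap b q z <> 0) -> ~ (u t y @[t --> F] --> +oo).
Proof.
move=> hc; have c0 z : 0 < hcap b q z.
  by rewrite lt_neqAle hcap_ge0// andbT eq_sym; apply/eqP.
pose B := 1 + (hcap b q x * hcap b q y)^-1.
move=> /cvgryPgt/(_ B) uB; have [t [[du ux] ut]] := filter_ex (filterI uE uB).
have hx := closure_hcap_le x du; have hy := closure_hcap_le y du.
have e0 := closure_bform_ge0 bgraph hge0 du.
have ux0 : 0 <= u t x by exact: le_trans e0 ux.
have ux1 : u t x <= (hcap b q x)^-1.
  rewrite -[leRHS]mul1r ler_pdivlMr//; have [->|n0] := eqVneq (u t x) 0; first by rewrite mul0r.
  have up : 0 < u t x by rewrite lt_neqAle eq_sym n0.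
  rewrite -(ler_pM2r up) mul1r mulrAC -expr2 mulrC; exact: le_trans hx ux.
have uy : u t y ^+ 2 <= (hcap b q x * hcap b q y)^-1.
  rewrite invfM ler_pdivlMr// mulrC; exact: le_trans hy (le_trans ux ux1).
have K0 : 0 < (hcap b q x * hcap b q y)^-1 by rewrite invr_gt0 mulr_gt0.
move: ut uy K0; rewrite /B; move: (_^-1) (u t y) => k z; nra.
Qed.

Hypothesis uC : forall phi, finsupp_fun phi -> phi x = 1 -> forall e : R, 0 < e ->
  \forall t \near F, 1 <= 2 * u t x * (h phi + e).

Lemma blowup_diag : hcap b q x = 0 -> u t x @[t --> F] --> +oo.
Proof.
(* With [h phi] and the error both at most [e], the lower bound becomes [1 <= 4 e u t x]. *)
move=> c0; apply/cvgryPge => A; pose e : R := (4 * (`|A| + 1))^-1.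
have A1 : 0 < `|A| + 1 by rewrite ltr_wpDl.
have e0 : 0 < e by rewrite invr_gt0 mulr_gt0.
have [phi [fp _ px hp]] := hcap0_null bgraph hge0 c0.
move/cvgrPdist_lt : hp => /(_ e e0)[N _ hN].
have := hN N (leqnn N); rewrite sub0r normrN => /(le_lt_trans (ler_norm _)) hlt.
apply: filterS (uC (fp N) (px N) e0) => t ut.
have h0 := hge0 (fp N).
have ux : 0 < u t x.
  rewrite ltNge; apply/negP => ule.
  have : 2 * u t x * (h (phi N) + e) <= 0.
    by apply: mulr_le0_ge0; [rewrite pmulr_rle0|rewrite addr_ge0// ltW].
  by move=> /(le_trans ut); rewrite ler10.
have : 1 <= u t x / (`|A| + 1).
  apply: le_trans ut _; rewrite (_ : u t x / (`|A| + 1) = 2 * u t x * (e + e)); last first.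
    by rewrite /e; field; rewrite gt_eqF.
  by apply: ler_wpM2l; [rewrite mulr_ge0// ltW|rewrite lerD2r ltW].
rewrite ler_pdivlMr// mul1r => le; have := ler_norm A; lra.
Qed.

Lemma blowup_all : hcap b q x = 0 -> forall y, u t y @[t --> F] --> +oo.
Proof.
move=> c0 y; have ux := blowup_diag c0.
have [v [vp vs]] := positive_superharmonic_ex bgraph bconn hge0 x.
have v0 := superharmonic_gt0 bgraph bconn vp vs.
have upos : \forall t \near F, 0 < u t x by move/cvgryPgt : ux; exact.
pose e t z := (u t x)^-1 * u t z.
have z0 : finsupp_fun (fun _ : X => 0 : R) by apply/finsupp_supp; exists fset0.
have d0 : D (fun=> 0) by exact: (closure_dom_fin q bgraph z0).
(* The energy is quadratic: dividing by [u t x] leaves at most [u t x / u t x ^+ 2]. *)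
have eD : \forall t \near F, D (e t) /\ E (e t) (e t) <= (u t x)^-1.
  apply: filterS2 uE upos => t [du le] up.
  have eE : e t = (fun z => (u t x)^-1 * u t z + 0) by apply/funext => z; rewrite addr0.
  have de : D (e t) by rewrite eE; exact: (closure_dom_lin bgraph hge0 _ du d0).
  have El w : D w -> E (e t) w = (u t x)^-1 * E (u t) w.
    move=> dw; rewrite eE (closure_bform_linl bgraph hge0 _ du d0 dw).
    have := closure_bform_linl bgraph hge0 (-1) d0 d0 dw.
    rewrite (_ : (fun=> -1 * 0 + 0) = (fun=> 0) :> (X -> R)); last by apply/funext => z; rewrite mulr0 addr0.
    by rewrite mulN1r addNr => ->; rewrite addr0.
  split => //; rewrite (El _ de) (closure_bformC bgraph hge0 du de) (El _ du) mulrA -expr2 exprVn.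
  by rewrite ler_pdivrMl ?exprn_gt0// expr2 -mulrA divff ?gt_eqF// mulr1.
have iv : (u t x)^-1 @[t --> F] --> (0 : R) by exact: (gtr0_cvgV0 (f := fun t => u t x) upos).2 ux.
have e0 : E (e t) (e t) @[t --> F] --> (0 : R).
  apply: (squeeze_cvgr _ (cvg_cst 0) iv); apply: filterS eD => t [de ->].
  by rewrite (closure_bform_ge0 bgraph hge0 de).
have ex : e t x @[t --> F] --> (1 : R).
  apply: cvg_near_cst.
  by apply: filterS upos => t up; rewrite /e mulVf ?gt_eqF.
have eD' : \forall t \near F, D (e t) by apply: filterS eD => t [].
have ey : e t y @[t --> F] --> 1 * v y / v x.
  exact: (null_family_cvg bgraph bconn hge0 vp vs eD' e0 ex).
have c1 : 0 < v y / v x by rewrite divr_gt0.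
have c2 : 0 < v y / v x / 2 by rewrite divr_gt0.
move/cvgrPdist_lt : ey => /(_ _ c2); rewrite mul1r => eyn.
apply/cvgryPge => A; move/cvgryPge : ux => /(_ (`|A| / (v y / v x / 2))) uA.
apply: filterS3 uA upos eyn => t ut up; rewrite ltr_norml => /andP[_].
have -> : u t y = u t x * e t y by rewrite /e mulrA divff ?mul1r// gt_eqF.
move: ut; rewrite ler_pdivrMr ?divr_gt0// => ut lt.
apply: le_trans (ler_norm A) (le_trans ut _).
by rewrite ler_pM2l//; move: lt; move: (v y / v x) (e t y) => c d; lra.
Qed.

Lemma blowup_hcap : hcap b q x = 0 <-> exists y, u t y @[t --> F] --> +oo.
Proof.
split=> [c0|[y uy]]; first by exists x; exact: blowup_all.
apply: contrapT => c0; apply: no_blowup uy => z cz; apply: c0.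
exact: (hcap0_all bgraph bconn hge0 cz).
Qed.

End Family.

End GreenAsymptotics.

(** * Independent superharmonic functions in the subcritical case *)

Section SubcriticalSuperharmonic.
Context {R : realType} {X : choiceType} (b : X -> X -> R).
Hypotheses (bgraph : is_graph b) (bconn : graph_connected b).
Implicit Types (q u v phi : X -> R).

Lemma hform_shift q (c : R) x phi : finsupp_fun phi ->
  hform b (fun y => q y - c * (y == x)%:R) phi = hform b q phi - c * phi x ^+ 2.
Proof.
move=> /finsupp_supp[K hK]; rewrite /hform -addrA; congr (_ + _).
rewrite !(@fsum_fin _ _ _ K) => [|y /hK->|y /hK->]; rewrite ?expr0n ?mulr0//.
under eq_bigr do rewrite mulrBl; rewrite sumrB; congr (_ - _).
have [xK|/hK px] := boolP (x \in K); last first.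
  rewrite px expr0n mulr0 big1// => y _; have [->|_] := eqVneq y x; first by rewrite px expr0n mulr0.
  by rewrite mulr0 mul0r.
rewrite (bigD1_seq x)//= eqxx mulr1 big1 ?addr0// => y /negPf ->.
by rewrite mulr0 mul0r.
Qed.

Lemma formalH_sum q (I : eqType) (r : seq I) (a : I -> R) (u : I -> X -> R) x :
  (forall i, in_F b (u i)) ->
  formalH b q (fun y => \sum_(i <- r) a i * u i y) x
  = \sum_(i <- r) a i * formalH b q (u i) x.
Proof.
move=> uF.
have E z : (fun y => b z y * \sum_(i <- r) a i * u i y)
    = (fun y => \sum_(i <- r) a i * (b z y * u i y)).
  by apply/funext => y; rewrite mulr_sumr; apply: eq_bigr => i _; rewrite mulrCA.
have s z : abs_summable (fun y => \sum_(i <- r) a i * (b z y * u i y))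
    /\ rsum (fun y => \sum_(i <- r) a i * (b z y * u i y))
       = \sum_(i <- r) rsum (fun y => a i * (b z y * u i y)).
  by apply: rsum_sum => i; apply: abs_summableZ; exact: uF.
rewrite (formalHE q bgraph); last by move=> z; rewrite E; case: (s z).
rewrite E (s x).2 mulr_sumr -sumrB; apply: eq_bigr => i _.
rewrite rsumZ; last exact: uF.
by rewrite (formalHE q bgraph) ?mulrBr 1?mulrCA//; exact: uF.
Qed.

Section Subcritical.
Variable q : X -> R.
Hypothesis hge0 : hform_ge0 b q.

(* A ground state of the form [h - cap {x} 1_x], which is critical. *)
Lemma capacitary_superharmonic x : exists v, [/\ positive_fun v, in_F b v
  & forall y, formalH b q v y = hcap b q x * v x * (y == x)%:R].
Proof.
pose c := hcap b q x; pose q' y := q y - c * (y == x)%:R.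
have hge0' : hform_ge0 b q'.
  by move=> phi fp; rewrite hform_shift// subr_ge0; exact: hcap_le.
(* On functions with value 1 at [x], the shift lowers [h] by exactly its infimum. *)
have c0 : hcap b q' x = 0.
  apply/eqP; rewrite eq_le hcap_ge0// andbT; apply/ler_addgt0Pr => e e0; rewrite add0r.
  have [_ [phi [fp px] <-]] := inf_adherent e0 (conj (hcap_ne b q x) (hcap_lbound hge0 x)).
  rewrite -/(hcap b q x) -/c => lt; have := hcap_le bgraph hge0' x fp.
  rewrite hform_shift// px expr1n !mulr1 => /le_trans; apply.
  by rewrite lerBlDl ltW.
have crit : h_critical b q'.
  by apply/(critical_hcap bgraph hge0') => y; exact: (hcap0_all bgraph bconn hge0' c0).
have [v [vp vs]] := positive_superharmonic_ex bgraph bconn hge0' x.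
have [vF vH] := critical_harmonic bgraph bconn hge0' crit vp vs.
exists v; split=> // y; have := vH y; rewrite /formalH /q' mulrBl addrA => /eqP.
rewrite subr_eq0 => /eqP ->; rewrite -/c.
by have [->|_] := eqVneq y x; rewrite ?mulr0 ?mul0r ?mulr1.
Qed.

(** Applying [H] to a vanishing combination and evaluating at the point [p j] isolates the
    coefficient of index [j]. *)
Lemma subcritical_lin_indep : infinite_set [set: X] -> (forall x, hcap b q x <> 0) ->
  forall n, exists u : 'I_n -> X -> R,
    (forall i, positive_fun (u i) /\ H_superharmonic b q (u i)) /\ lin_indep u.
Proof.
move=> Xinf hc n; have [v hv] := choice capacitary_superharmonic.
have c0 x : 0 < hcap b q x by rewrite lt_neqAle hcap_ge0// andbT eq_sym; exact/eqP.
have [K _ nK] := infinite_set_fset n Xinf.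
have vs x : H_superharmonic b q (v x).
  have [[v0 _] vF vH] := hv x; split=> // y.
  by rewrite vH !mulr_ge0 ?ler0n// ltW.
have vp x : positive_fun (v x) by case: (hv x).
have [x0 _] := infinite_setN0 Xinf.
pose p (i : 'I_n) := nth x0 K i.
exists (fun i => v (p i)); split=> [i|a ha j]; first by split.
have vF i : in_F b (v (p i)) by case: (hv (p i)).
have H0 : formalH b q (fun=> 0) (p j) = 0.
  have z0 : abs_summable (fun _ : X => 0 : R) by apply: (abs_summable_fin (K := fset0)).
  rewrite /formalH mulr0 addr0 (_ : (fun y => b (p j) y * (0 - 0)) = fun=> 0 * 0).
    by rewrite rsumZ ?mul0r.
  by apply/funext => y; rewrite subrr !mulr0.
have := formalH_sum q (index_enum 'I_n) a (p j) vF.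
have -> : (fun y => \sum_(i < n) a i * v (p i) y) = (fun=> 0) by exact/funext.
rewrite H0 (bigD1 j)//= big1 ?addr0 => [/esym/eqP|i ij]; last first.
  have [_ _ ->] := hv (p i); rewrite (_ : p j == p i = false) ?mulr0//.
  rewrite /p nth_uniq ?fset_uniq ?(leq_trans (ltn_ord _) nK)//.
  by rewrite eq_sym; exact/negbTE.
have [vpj _ vHj] := hv (p j).
have [_ _ ->] := hv (p j); rewrite eqxx mulr1 mulf_eq0 => /orP[/eqP//|].
by rewrite gt_eqF// mulr_gt0//; exact: (superharmonic_gt0 bgraph bconn vpj (vs _)).
Qed.

End Subcritical.

End SubcriticalSuperharmonic.

(** * Blow-up of the resolvent *)

Section ResolventBlowup.
Context {R : realType} {X : choiceType} (b : X -> X -> R) (q : X -> R).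
Hypotheses (bgraph : is_graph b) (bconn : graph_connected b) (hge0 : hform_ge0 b q).
Implicit Types (f g u v phi : X -> R).

Local Notation h := (hform b q).
Local Notation E := (closure_bform b q).
Local Notation D := (closure_dom b q).

(** [1 = (s + t)^2 <= 2 (s^2 + t^2)]. *)
Lemma ler_double_mul (s t a c d e z : R) : s ^+ 2 <= a * c -> t ^+ 2 <= d * e ->
  0 <= c -> 0 <= e -> a <= z -> d <= z -> s + t = 1 -> 1 <= 2 * z * (c + e).
Proof.
move=> h1 h2 c0 e0 az dz st.
have h3 := ler_wpM2r c0 az; have h4 := ler_wpM2r e0 dz.
have := sqr_ge0 (s - t); have : t = 1 - s by rewrite -st addrC addKr.
move=> ->; move: h1 h2 h3 h4 => /[swap]; nra.
Qed.

(** Testing the equation against [u] shows that energy and [mu]-weighted norm add up to [u x], so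
    each is at most [u x]; testing it against [phi] gives the splitting of 1. *)
Lemma weak_resolvent_indic (mu : R) x u : 0 < mu -> weak_resolvent b q mu (\1_[set x]) u ->
  [/\ D u, E u u <= u x & forall phi, finsupp_fun phi -> phi x = 1 ->
    1 <= 2 * u x * (h phi + mu * inner2 phi phi)].
Proof.
move=> mu0 [du hu]; have u2 := closure_dom_ell2 du.
have Euu := hu _ du; rewrite (inner2C (\1_[set x])) inner2_indic in Euu.
have uu : 0 <= mu * inner2 u u by rewrite mulr_ge0 ?inner2_ge0 ?(ltW mu0).
split => // [|phi fp px]; first by rewrite -Euu lerDl.
have dp := closure_dom_fin q bgraph fp; have p2 := closure_dom_ell2 dp.
have := hu _ dp; rewrite (inner2C (\1_[set x])) inner2_indic px => e1.
apply: (ler_double_mul (a := E u u) (d := mu * inner2 u u) _ _ _ _ _ _ e1).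
- by have := closure_bform_CS bgraph hge0 du dp; rewrite (closure_bform_fin bgraph hge0 fp fp) (hB_diag q bgraph fp).
- rewrite exprMn expr2 -!mulrA; apply: (ler_wpM2l (ltW mu0)).
  rewrite [leRHS]mulrCA; apply: (ler_wpM2l (ltW mu0)); exact: inner2_CS.
- exact: hge0.
- by rewrite mulr_ge0 ?inner2_ge0 ?(ltW mu0).
- by rewrite -Euu lerDl.
- by rewrite -Euu lerDr (closure_bform_ge0 bgraph hge0 du).
Qed.

Lemma near_at_left (P : R -> Prop) : (forall mu : R, 0 < mu -> P (- mu)) ->
  \forall l \near (0 : R)^'-, P l.
Proof.
move=> hP; near=> l; rewrite -(opprK l); apply: hP; rewrite oppr_gt0.
by near: l; exact: nbhs_left_lt.
Unshelve. all: by end_near. Qed.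

Lemma resolvent_blowup_hcap x :
  (hcap b q x = 0 -> forall y, resolvent_blowup b q x y) /\
  (forall y, resolvent_blowup b q x y -> hcap b q x = 0).
Proof.
have W mu : 0 < mu -> weak_resolvent b q mu (\1_[set x]) (resolvent (H1 b q) (- mu) (\1_[set x])).
  by move=> mu0; exact: (resolventP bgraph hge0 mu0 (@ell2_indic R X x)).
have uE : \forall l \near (0 : R)^'-, D (resolvent (H1 b q) l (\1_[set x])) /\
    E (resolvent (H1 b q) l (\1_[set x])) (resolvent (H1 b q) l (\1_[set x]))
    <= resolvent (H1 b q) l (\1_[set x]) x.
  by apply: near_at_left => mu mu0; have [] := weak_resolvent_indic mu0 (W mu mu0).
have uC phi : finsupp_fun phi -> phi x = 1 -> forall e : R, 0 < e ->
    \forall l \near (0 : R)^'-, 1 <= 2 * resolvent (H1 b q) l (\1_[set x]) x * (h phi + e).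
  move=> fp px e e0; have n0 : 0 <= inner2 phi phi by exact: inner2_ge0 (ell2_finsupp fp).
  have lt0 : 0 < e / (inner2 phi phi + 1) by rewrite divr_gt0// ltr_wpDl.
  near=> l; have mu0 : 0 < - l by rewrite oppr_gt0; near: l; exact: nbhs_left_lt.
  have := W _ mu0; rewrite opprK => /(weak_resolvent_indic mu0)[du ule /(_ _ fp px)] /le_trans; apply.
  apply: ler_wpM2l; first by rewrite mulr_ge0// (le_trans _ ule)// (closure_bform_ge0 bgraph hge0 du).
  rewrite lerD2l; apply: (@le_trans _ _ (- l * (inner2 phi phi + 1))).
    by apply: ler_wpM2l; [exact: ltW|rewrite lerDl].
  rewrite -ler_pdivlMr ?ltr_wpDl// lerNl ltW//.
  by near: l; apply: nbhs_left_gt; rewrite oppr_lt0.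
split=> [c0 y|y hy]; first exact: (blowup_all bgraph bconn hge0 uE uC c0).
by apply/(blowup_hcap bgraph bconn hge0 uE uC); exists y.
Unshelve. all: by end_near. Qed.

End ResolventBlowup.

(** * The Hilbert space of square-summable functions *)

Definition ell2_pred (R : realType) (X : choiceType) : {pred X -> R} := fun f => `[< ell2 f >].

Lemma ell2_submod (R : realType) (X : choiceType) : submod_closed (@ell2_pred R X).
Proof.
split=> [|a f g]; first exact/asboolP/(@ell2_0 R X).
by move=> /asboolP hf /asboolP hg; exact/asboolP/(ell2_lin a hf hg).
Qed.

HB.instance Definition _ (R : realType) (X : choiceType) :=
  GRing.isSubmodClosed.Build R (X -> R) (@ell2_pred R X) (@ell2_submod R X).

Record l2 (R : realType) (X : choiceType) := L2 { l2val :> X -> R; _ : l2val \in @ell2_pred R X }.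

HB.instance Definition _ (R : realType) (X : choiceType) := [isSub for @l2val R X].
HB.instance Definition _ (R : realType) (X : choiceType) := [Choice of l2 R X by <:].
HB.instance Definition _ (R : realType) (X : choiceType) :=
  [SubChoice_isSubLmodule of l2 R X by <:].

Section SquareSummableSpace.
Context {R : realType} {X : choiceType}.
Implicit Types (f g : X -> R) (u v w : l2 R X).

Lemma l2_ell2 u : ell2 u.
Proof. by apply/asboolP; exact: (valP u). Qed.

Definition to_l2 f (hf : ell2 f) : l2 R X := L2 (asboolT hf).

Definition l2_dot u v : R := inner2 u v.

Lemma l2_eqP u v : (forall x, u x = v x) -> u = v.
Proof. by move=> h; apply/val_inj/funext. Qed.

Lemma nrm_l2_dot u : nrm l2_dot u = norm2 u. Proof. by []. Qed.

Lemma l2_hilbert : hilbert l2_dot.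
Proof.
split.
- by move=> u v; exact: inner2C.
- by move=> a u v w; exact: (inner2_linl a (l2_ell2 u) (l2_ell2 v) (l2_ell2 w)).
- by move=> u; exact: inner2_ge0 (l2_ell2 u).
- move=> u u0; apply: l2_eqP => x.
  have uu : inner2 u u <= 0 by rewrite -[leRHS]u0.
  exact: (congr1 (@^~ x) (inner2_eq0 (l2_ell2 u) uu)).
move=> u hu; have [e e0|l l2l ul] := l2_complete (fun n => l2_ell2 (u n)).
  have [N hN] := hu e e0; exists N => n m Nn Nm.
  rewrite -(ltr_pXn2r (n := 2))// ?nnegrE ?norm2_ge0 ?(ltW e0)//.
  by rewrite (sqr_norm2 (l2_ell2 (u n - u m))); exact: hN.
exists (to_l2 l2l).
have E n : l2_dot (u n - to_l2 l2l) (u n - to_l2 l2l)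
    = norm2 (fun x => u n x - l x) * norm2 (fun x => u n x - l x).
  by rewrite -expr2 (sqr_norm2 (l2_ell2 (u n - to_l2 l2l))).
under eq_fun do rewrite E.
by rewrite -[0 : R](mulr0 0); apply: cvgM; exact: ul.
Qed.

End SquareSummableSpace.

(** * The resolvent at -1 as an operator on l^2 *)

Section HeatSemigroup.
Context {R : realType} {X : choiceType} (b : X -> X -> R) (q : X -> R).
Hypotheses (bgraph : is_graph b) (hge0 : hform_ge0 b q).
Local Notation V := (l2 R X).
Local Notation E := (closure_bform b q).
Local Notation D := (closure_dom b q).
Implicit Types (f g : X -> R) (u v w : V).

Let Gfun_weak u : weak_resolvent b q 1 u (resolvent (H1 b q) (- 1) u).
Proof. exact: (resolventP bgraph hge0 ltr01 (l2_ell2 u)). Qed.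

Let Gfun u : V := to_l2 (closure_dom_ell2 (Gfun_weak u).1).

Let combine (a x y z t : R) : a * x + y + (a * z + t) = a * (x + z) + (y + t).
Proof. by rewrite mulrDr addrACA. Qed.

Let Gfun_linear : linear Gfun.
Proof.
move=> a u v; apply: val_inj.
have [du hu] := Gfun_weak u; have [dv hv] := Gfun_weak v.
apply: (weak_resolvent_unique bgraph hge0 ltr01 (Gfun_weak _)); split.
  exact: (closure_dom_lin bgraph hge0 a du dv).
move=> w dw; have w2 := closure_dom_ell2 dw.
rewrite (closure_bform_linl bgraph hge0 a du dv dw).
rewrite (inner2_linl a (closure_dom_ell2 du) (closure_dom_ell2 dv) w2).
rewrite (inner2_linl a (l2_ell2 u) (l2_ell2 v) w2) -(hu _ dw) -(hv _ dw) !mul1r.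
exact: combine.
Qed.

(* [(H1 + 1)^-1] *)
Definition l2_resolvent : {linear V -> V} :=
  HB.pack_for {linear V -> V} Gfun (GRing.isLinear.Build R V V *:%R Gfun Gfun_linear).

Local Notation G := l2_resolvent.

Lemma l2_resolvent_weak u : weak_resolvent b q 1 u (G u).
Proof. exact: Gfun_weak. Qed.

Opaque l2_resolvent.

Lemma l2_resolvent_dom u : D (G u). Proof. by case: (l2_resolvent_weak u). Qed.

Lemma l2_resolvent_dot u v : l2_dot (G u) v = E (G u) (G v) + l2_dot (G u) (G v).
Proof.
have [dv hv] := l2_resolvent_weak v; have du := l2_resolvent_dom u.
have e := hv _ du; rewrite mul1r in e.
apply: (etrans (inner2C (G u) v)); apply: (etrans (esym e)).
exact: congr2 (closure_bformC bgraph hge0 dv du) (inner2C (G v) (G u)).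
Qed.

Lemma l2_resolvent_sym u v : l2_dot (G u) v = l2_dot u (G v).
Proof.
rewrite (dotC l2_hilbert u) (l2_resolvent_dot u v) (l2_resolvent_dot v u).
exact: congr2 (closure_bformC bgraph hge0 (l2_resolvent_dom u) (l2_resolvent_dom v))
  (dotC l2_hilbert (G u) (G v)).
Qed.

Lemma l2_resolvent_ge0 u : 0 <= l2_dot (G u) u.
Proof.
rewrite l2_resolvent_dot addr_ge0 ?(dot_ge0 l2_hilbert)//.
exact: (closure_bform_ge0 bgraph hge0 (l2_resolvent_dom u)).
Qed.

Lemma l2_resolvent_le u : l2_dot (G u) u <= l2_dot u u.
Proof.
have h : 0 <= l2_dot (u - G u) (u - G u) by exact: (dot_ge0 l2_hilbert).
have e0 := closure_bform_ge0 bgraph hge0 (l2_resolvent_dom u).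
have e := l2_resolvent_dot u u; move: h.
rewrite (dotBl l2_hilbert) !(dotBr l2_hilbert) (dotC l2_hilbert u (G u)); lra.
Qed.

(** Indicators lie in the form domain, so testing the weak equation against them recovers [u]
    pointwise. *)
Lemma l2_resolvent_inj u : G u = 0 -> u = 0.
Proof.
move=> Gu; apply: l2_eqP => x; have fx := closure_dom_fin q bgraph (@finsupp_indic R X x).
have [du hu] := l2_resolvent_weak u.
have := hu _ fx; rewrite Gu (closure_bform_indic bgraph hge0); last by rewrite -Gu.
rewrite !inner2_indic /Hop => <-.
have -> : inner2 (b x) (0 : V) = 0.
  rewrite inner2C; exact: (dot0l l2_hilbert (to_l2 (ell2_edge bgraph x))).
by rewrite (_ : (0 : V) x = 0)// !mulr0 subr0 addr0.
Qed.

(** Has the shape of [sgp_generates], with the sign of the generator reversed. *)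
Lemma H1_l2_resolvent u v : H1 b q u v <-> u = G (v + u).
Proof.
have e : (fun x => (v + u) x + - 1 * u x) = v :> (X -> R).
  by apply/funext => x; rewrite mulN1r -[LHS]/(v x + u x - u x) addrK.
have w := weak_resolvent_H1 b q 1 u (l2_ell2 (v + u)).
split=> [h|h].
  apply: val_inj; apply: (weak_resolvent_unique bgraph hge0 ltr01 _ (l2_resolvent_weak (v + u))).
  by apply/w; rewrite e.
by rewrite -e; apply/w; rewrite {2}h; exact: l2_resolvent_weak.
Qed.

End HeatSemigroup.

(** * Identification of the chosen semigroup *)

Section ExpSemigroup.
Context {R : realType} {X : choiceType} (b : X -> X -> R) (q : X -> R).
Hypotheses (bgraph : is_graph b) (hge0 : hform_ge0 b q).
Local Notation V := (l2 R X).
Local Notation G := (l2_resolvent bgraph hge0).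
Local Notation dot := (@l2_dot R X).
Implicit Types (f g : X -> R) (u v w : V) (S : R -> (X -> R) -> (X -> R)).

Let Hd : hilbert dot := l2_hilbert.
Let Gsym := l2_resolvent_sym bgraph hge0.
Let G0 := l2_resolvent_ge0 bgraph hge0.
Let G1 := l2_resolvent_le bgraph hge0.
Let Ginj := l2_resolvent_inj (bgraph := bgraph) (hge0 := hge0).

(** Operators here act on all functions and are controlled on l^2 only; the default [v] is not
    reached at times [t >= 0] for a semigroup that preserves l^2. *)
Definition l2_lift (S : R -> (X -> R) -> (X -> R)) t v : V :=
  if pselect (ell2 (S t v)) is left h then to_l2 h else v.

Lemma l2_liftE S t v : ell2 (S t v) -> l2_lift S t v = S t v :> (X -> R).
Proof. by rewrite /l2_lift; case: pselect. Qed.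

Lemma sg_generator_lift S v w : (forall t, 0 <= t -> forall f, ell2 f -> ell2 (S t f)) ->
  sg_generator S v w <-> generates dot (l2_lift S) v w.
Proof.
move=> S2.
have E : \forall t \near (0 : R)^'+,
    nrm dot (t^-1 *: (l2_lift S t v - v) - w) = norm2 (fun x => (S t v x - v x) / t - w x).
  near=> t; have t0 : 0 <= t by apply: ltW; near: t; exact: nbhs_right_gt.
  rewrite nrm_l2_dot; congr norm2; apply/funext => x.
  rewrite -(l2_liftE (S2 t t0 v (l2_ell2 v))).
  by rewrite -[LHS]/(t^-1 * (l2_lift S t v x - v x) - w x) mulrC.
rewrite /sg_generator /generates; split=> [[_ _]|] h.
  by apply: cvg_trans h; apply: near_eq_cvg; apply: filterS E.
split; [exact: l2_ell2|exact: l2_ell2|].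
by apply: cvg_trans h; apply: near_eq_cvg; apply: filterS E => t.
Unshelve. all: by end_near. Qed.

Definition heat_semigroup (t : R) f : X -> R :=
  if pselect (ell2 f) is left h then sgp dot G t (to_l2 h) else fun=> 0.

Lemma heat_semigroupE t v : heat_semigroup t v = sgp dot G t v :> (X -> R).
Proof.
rewrite /heat_semigroup; case: pselect => [h|n]; last by case: (n (l2_ell2 v)).
by congr (l2val (sgp dot G t _)); exact: l2_eqP.
Qed.

Lemma heat_semigroup_fun t f (hf : ell2 f) : heat_semigroup t f = sgp dot G t (to_l2 hf) :> (X -> R).
Proof. exact: heat_semigroupE (to_l2 hf). Qed.

Lemma heat_semigroup_ell2 t f : ell2 f -> ell2 (heat_semigroup t f).
Proof. by move=> hf; rewrite (heat_semigroup_fun t hf); exact: l2_ell2. Qed.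

Lemma heat_semigroup_lift t v : l2_lift heat_semigroup t v = sgp dot G t v.
Proof.
apply: l2_eqP => x; rewrite (l2_liftE (heat_semigroup_ell2 t (l2_ell2 v))).
by rewrite heat_semigroupE.
Qed.

Lemma heat_semigroup_spec : c0_semigroup heat_semigroup /\
  forall f g, H1 b q f g <-> sg_generator heat_semigroup f (fun x => - g x).
Proof.
split; first split.
- move=> t t0; split.
  + by move=> f; exact: heat_semigroup_ell2.
  + move=> a f g hf hg; rewrite (heat_semigroup_fun t hf) (heat_semigroup_fun t hg).
    have hfg := ell2_lin a hf hg; rewrite (heat_semigroup_fun t hfg).
    have -> : to_l2 hfg = a *: to_l2 hf + to_l2 hg by exact: l2_eqP.
    by rewrite (sgp_linear Hd Gsym G0 G1 a _ _ t0).
  + exists 1 => f hf; rewrite mul1r (heat_semigroup_fun t hf).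
    exact: (sgp_contr Hd Gsym G0 G1 (to_l2 hf) t0).
- by move=> f hf; rewrite (heat_semigroup_fun 0 hf) sgp0.
- move=> s t f s0 t0 hf; rewrite (heat_semigroup_fun (s + t) hf) (heat_semigroup_fun t hf).
  by rewrite heat_semigroupE (sgpD Hd Gsym G0 G1 (to_l2 hf) s0 t0).
- move=> f hf; under eq_fun do rewrite (heat_semigroup_fun _ hf).
  exact: (sgp_strong Hd Gsym G0 G1 Ginj (to_l2 hf)).
move=> f g.
have key u v : H1 b q u v <-> sg_generator heat_semigroup u (fun x => - v x).
  have e := sg_generator_lift u (- v) (fun t _ f hf => heat_semigroup_ell2 t hf).
  have -> : (fun x => - v x) = (- v : V) by [].
  split=> [/(H1_l2_resolvent bgraph hge0) h|/e h].
    apply/e; rewrite (_ : l2_lift _ = sgp dot G); last first.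
      by apply/funext => t; apply/funext => w; exact: heat_semigroup_lift.
    by apply/(sgp_generates Hd Gsym G0 G1 Ginj); rewrite opprK [u + v]addrC.
  apply/(H1_l2_resolvent bgraph hge0); move: h.
  rewrite (_ : l2_lift _ = sgp dot G); last first.
    by apply/funext => t; apply/funext => w; exact: heat_semigroup_lift.
  by move=> /(sgp_generates Hd Gsym G0 G1 Ginj); rewrite opprK [u + v]addrC.
split=> [h|h].
  have [/closure_dom_ell2 hf hg _] := h.
  by have /key := (h : H1 b q (to_l2 hf) (to_l2 hg)).
have [hf hg' _] := h.
have hg : ell2 g.
  by have := ell2Z (-1) hg'; congr ell2; apply/funext => x; rewrite mulN1r opprK.
by apply: (key (to_l2 hf) (to_l2 hg)).2.
Qed.

(** [heat_semigroup] shows that the choice is made from a nonempty set; uniqueness, applied to the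
    lift of the chosen member, identifies it. *)
Lemma exp_semigroupE t v : 0 <= t -> exp_semigroup (H1 b q) t v = sgp dot G t v :> (X -> R).
Proof.
set S := exp_semigroup _; move=> t0.
have [[Sb S0 SD Sst] Sgen] : c0_semigroup S /\
    forall f g, H1 b q f g <-> sg_generator S f (fun x => - g x).
  by apply: (@getPex _ [set T | c0_semigroup T /\ _]); exists heat_semigroup; exact: heat_semigroup_spec.
have S2 s : 0 <= s -> forall f, ell2 f -> ell2 (S s f) by move=> s0; case: (Sb s s0).
have L s u : 0 <= s -> l2_lift S s u = S s u :> (X -> R).
  by move=> s0; apply: l2_liftE; exact: S2 (l2_ell2 u).
rewrite -L//; congr l2val.
apply: (semigroup_unique Hd _ _ _ _ _ Gsym G0 G1 Ginj _ v t0).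
- move=> s s0; have [_ _ [M hM]] := Sb s s0; exists M => u.
  by rewrite !nrm_l2_dot (L s u s0); exact: hM (l2_ell2 u).
- move=> s a u w s0; apply: val_inj; rewrite [LHS](L _ _ s0).
  have [_ Sl _] := Sb s s0.
  rewrite [LHS](Sl a u w (l2_ell2 u) (l2_ell2 w)) -!(L s _ s0)//.
- by move=> u; apply: val_inj; rewrite [LHS](L _ _ (lexx 0)) (S0 _ (l2_ell2 u)).
- move=> r s u r0 s0; apply: val_inj; rewrite [LHS](L _ _ (addr_ge0 r0 s0)).
  by rewrite (SD _ _ _ r0 s0 (l2_ell2 u)) [RHS](L _ _ r0) (L _ _ s0).
- move=> u; have := Sst u (l2_ell2 u); apply: cvg_trans; apply: near_eq_cvg.
  near=> s; have s0 : 0 <= s by apply: ltW; near: s; exact: nbhs_right_gt.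
  by rewrite nrm_l2_dot; congr norm2; apply/funext => x; rewrite -(L s u s0).
move=> u w; have e := sg_generator_lift u w S2.
have k := Sgen u (- w).
have eN : (fun x => - (- w : V) x) = (w : X -> R) by apply/funext => x; exact: opprK.
rewrite eN in k; split=> [/e/k/(H1_l2_resolvent bgraph hge0)|h].
  by rewrite addrC.
by apply/e/k/(H1_l2_resolvent bgraph hge0); rewrite addrC.
Unshelve. all: by end_near. Qed.

End ExpSemigroup.

Lemma near_eq_cvgry (R : realType) (F : set_system R) {FF : Filter F} (f g : R -> R) :
  (\forall t \near F, f t = g t) -> f t @[t --> F] --> +oo -> g t @[t --> F] --> +oo.
Proof.
move=> fg /cvgryPge h; apply/cvgryPge => A.
by apply: filterS2 fg (h A) => t ->.
Qed.

(** * Blow-up of the time integral *)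

Section SemigroupBlowup.
Context {R : realType} {X : choiceType} (b : X -> X -> R) (q : X -> R).
Hypotheses (bgraph : is_graph b) (bconn : graph_connected b) (hge0 : hform_ge0 b q).
Local Notation V := (l2 R X).
Local Notation G := (l2_resolvent bgraph hge0).
Local Notation dot := (@l2_dot R X).
Local Notation h := (hform b q).
Local Notation E := (closure_bform b q).
Local Notation D := (closure_dom b q).
Local Notation delta x := (to_l2 (@ell2_indic R X x)).
Local Notation green t x := (sgp_int dot G t (delta x)).
Implicit Types (phi : X -> R).

Let Hd : hilbert dot := l2_hilbert.
Let Gsym := l2_resolvent_sym bgraph hge0.
Let G0 := l2_resolvent_ge0 bgraph hge0.
Let G1 := l2_resolvent_le bgraph hge0.
Let Ginj := l2_resolvent_inj (bgraph := bgraph) (hge0 := hge0).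

Lemma dot_delta (v : V) x : dot v (delta x) = v x.
Proof. exact: inner2_indic. Qed.

Lemma green_H1 (t : R) x : 0 < t -> H1 b q (green t x) (delta x - sgp dot G t (delta x)).
Proof.
move=> t0; apply/(H1_l2_resolvent bgraph hge0).
apply: (etrans (esym (sgp_int_resolvent Hd Gsym G0 G1 (delta x) t0))).
by congr (G _); rewrite -addrA addrC.
Qed.

(** With [g] the time integral, [E g v = v x - dot Tf v], so the remainder in the splitting of 1 is
    [dot Tf phi]. Monotonicity in time gives [|Tf|^2 <= dot Tf 1_x <= g x / t], whence the error
    [inner2 phi phi / t]. *)
Lemma green_energy (t : R) x : 0 < t ->
  [/\ D (green t x), E (green t x) (green t x) <= green t x x
    & forall phi, finsupp_fun phi -> phi x = 1 ->
      1 <= 2 * green t x x * (h phi + inner2 phi phi / t)].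
Proof.
move=> t0; have [du _ hu] := green_H1 x t0.
pose Tf := sgp dot G t (delta x).
have hu' (v : V) : D v -> E (green t x) v = v x - dot Tf v.
  by move=> dv; rewrite (hu v dv) -(dot_delta v x) (dotC Hd v) -(dotBl Hd).
have Euu := hu' _ du.
have le : E (green t x) (green t x) <= green t x x.
  by rewrite Euu gerBl; exact: (sgp_sgp_int_ge0 Hd Gsym G0 G1 (delta x) t0).
split=> // phi fp px; pose p := to_l2 (ell2_finsupp fp).
have dp : D p by exact: (closure_dom_fin q bgraph fp).
have p0 : 0 <= inner2 phi phi by exact: inner2_ge0 (ell2_finsupp fp).
have Eup : E (green t x) p + dot Tf p = 1 by rewrite (hu' p dp) (px : p x = 1) subrK.
have Epp : E p p = h phi.
  by rewrite -(hB_diag q bgraph fp); exact: (closure_bform_fin bgraph hge0 fp fp).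
apply: (ler_double_mul (a := E (green t x) (green t x)) (d := green t x x) _ _ _ _ _ _ Eup) => //.
- have := closure_bform_CS bgraph hge0 du dp; rewrite Epp; exact.
- have Tn : dot Tf Tf <= green t x x / t.
    apply: (@le_trans _ _ (dot Tf (delta x))).
      rewrite -(nrm_sqr Hd); exact: (sgp_sqr_le Hd Gsym G0 G1 (delta x) t0).
    rewrite ler_pdivlMr// mulrC -(dot_delta (green t x) x).
    exact: (sgp_int_ge Hd Gsym G0 G1 (delta x) t0).
  rewrite [leRHS]mulrA [leRHS]mulrAC.
  exact: (le_trans (dot_CS Hd Tf p) (ler_wpM2r p0 Tn)).
- exact: hge0.
- by rewrite divr_ge0// ltW.
Qed.

Lemma integral_exp_semigroup (t : R) x y : 0 < t ->
  \int[lebesgue_measure]_(s in `[0, t]) exp_semigroup (H1 b q) s (\1_[set x] : X -> R) y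
  = green t x y.
Proof.
move=> t0; rewrite -(dot_delta (green t x) y).
rewrite -(integral_sgp Hd Gsym G0 G1 Ginj (delta x) (delta y) t0).
apply: eq_Rintegral => s; rewrite inE /= in_itv /= => /andP[s0 _].
rewrite dot_delta.
exact: (congr1 (@^~ y) (exp_semigroupE bgraph hge0 (delta x) s0)).
Qed.

Lemma semigroup_blowup_hcap x :
  (hcap b q x = 0 -> forall y, semigroup_blowup b q x y) /\
  (forall y, semigroup_blowup b q x y -> hcap b q x = 0).
Proof.
have pos : \forall t \near +oo, 0 < t :> R by exact: nbhs_pinfty_gt.
have uE : \forall t \near +oo, D (green t x) /\ E (green t x) (green t x) <= green t x x.
  by apply: filterS pos => t /(green_energy x)[].
have uC phi : finsupp_fun phi -> phi x = 1 -> forall e : R, 0 < e ->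
    \forall t \near +oo, 1 <= 2 * green t x x * (h phi + e).
  move=> fp px e e0; have big : \forall t \near +oo, inner2 phi phi / e < t :> R.
    by apply: nbhs_pinfty_gt; exact: num_real.
  apply: filterS2 pos big => t t0 tb; have [du le /(_ _ fp px)] := green_energy x t0.
  move=> /le_trans; apply; apply: ler_wpM2l.
    by rewrite mulr_ge0// (le_trans _ le)// (closure_bform_ge0 bgraph hge0 du).
  by rewrite lerD2l ler_pdivrMr// mulrC -ler_pdivrMr// ltW.
have eqv y : \forall t \near +oo,
    \int[lebesgue_measure]_(s in `[0, t]) exp_semigroup (H1 b q) s (\1_[set x] : X -> R) y
    = green t x y.
  by apply: filterS pos => t; exact: integral_exp_semigroup.
split=> [c0 y|y hy].
  have c : green t x y @[t --> +oo] --> +oo by exact: (blowup_all bgraph bconn hge0 uE uC c0 y).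
  by apply: (near_eq_cvgry _ c); apply: filterS (eqv y) => t ->.
apply/(blowup_hcap bgraph bconn hge0 uE uC); exists y.
exact: (near_eq_cvgry (eqv y) hy).
Qed.

End SemigroupBlowup.

(** * Null sequences *)

Section NullSequences.
Context {R : realType} {X : choiceType} (b : X -> X -> R) (q : X -> R).
Hypotheses (bgraph : is_graph b) (bconn : graph_connected b) (hge0 : hform_ge0 b q).
Local Notation h := (hform b q).
Implicit Types (phi : nat -> X -> R).

Lemma null_sequence_hcap0 phi : null_sequence b q phi -> forall x, hcap b q x = 0.
Proof.
move=> [fe [z [c [c0 ec]]] e0]; apply: (hcap0_all bgraph bconn hge0 (x := z)).
have : hcap b q z * c ^+ 2 <= 0.
  apply: (ler_cvg_to (cvg_cst _) e0); apply: nearW => n.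
  by rewrite -(ec n); exact: (hcap_le bgraph hge0 z (fe n).1).
rewrite pmulr_lle0 ?exprn_gt0// => le0.
by apply/eqP; rewrite eq_le le0 hcap_ge0.
Qed.

Lemma hcap0_null_sequence o (c : R) : 0 < c -> hcap b q o = 0 ->
  exists e, null_sequence b q e /\ forall n, e n o = c.
Proof.
move=> c0 /(hcap0_null bgraph hge0)[e [fe e0 eo he]].
exists (fun n x => c * e n x); have ec n : c * e n o = c by rewrite eo mulr1.
split=> //; split.
- move=> n; split; first exact: finsuppZ.
  split=> [x|]; first by rewrite mulr_ge0// ltW.
  by exists o; rewrite ec; apply/eqP; rewrite gt_eqF.
- by exists o, c.
under eq_fun do rewrite (hformZ q bgraph)//.
by rewrite -(mulr0 (c ^+ 2)); apply: cvgM => //; exact: cvg_cst.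
Qed.

(** The sequence is first normalized to the value [v z] at [z], so that truncation at [v] leaves
    this value unchanged and the limit is [v] itself. *)
Lemma null_sequence_below v phi : positive_fun v -> H_superharmonic b q v ->
  null_sequence b q phi -> exists e,
    [/\ null_sequence b q e, forall n x, 0 <= e n x <= v x
      & forall x, e n x @[n --> \oo] --> v x].
Proof.
move=> vp vs /[dup] /null_sequence_hcap0 hc [_ [z _] _].
have v0 := superharmonic_gt0 bgraph bconn vp vs; have [vF vH] := vs.
have [g [[gf _ g0] go]] := hcap0_null_sequence (v0 z) (hc z).
have gp n x : 0 <= g n x by case: (gf n) => _ [].
pose e n x := Num.min (g n x) (v x); have eo n : e n z = v z by rewrite /e go minxx.
have ef n : finsupp_fun (e n).
  have [/finsupp_supp[K hK] _] := gf n; apply/finsupp_supp; exists K => x /hK.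
  by rewrite /e => ->; rewrite min_l// ltW.
have e0 n x : 0 <= e n x by rewrite le_min gp ltW.
have he : h (e n) @[n --> \oo] --> (0 : R).
  apply: (squeeze_cvgr _ (cvg_cst 0) g0); apply: nearW => n.
  by rewrite hge0//= (ground_min bgraph v0 vF vH (gf n).1 (gp n)).
exists e; split.
- split=> // [n|]; last by exists z, (v z).
  by split=> //; split=> //; exists z; rewrite eo; apply/eqP; rewrite gt_eqF.
- by move=> n x; rewrite e0 ge_min lexx orbT.
move=> x; have eoc : e n z @[n --> \oo] --> v z by under eq_fun do rewrite eo; exact: cvg_cst.
have -> : v x = v z * v x / v z by rewrite mulrAC divff ?mul1r// gt_eqF.
exact: (null_seq_cvg bgraph bconn hge0 vp vs ef he eoc).
Qed.

End NullSequences.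

(** * The cycle of implications between the criteria *)

Theorem theorem5p3 (R : realType) (X : choiceType)
    (Xinf : infinite_set [set: X])
    (b : X -> X -> R) (bgraph : is_graph b) (bconn : graph_connected b)
    (q : X -> R) (hge0 : hform_ge0 b q) :
  [<->
    h_critical b q;

    exists x y, resolvent_blowup b q x y;
    forall x y, resolvent_blowup b q x y;

    exists x y, semigroup_blowup b q x y;
    forall x y, semigroup_blowup b q x y;

    exists u : X -> R, [/\ positive_fun u, H_superharmonic b q u
      & forall v : X -> R, positive_fun v -> H_superharmonic b q v ->
          exists c : R, forall x, v x = c * u x];

    exists N : nat, forall (n : nat) (u : 'I_n -> X -> R),
      (forall i, positive_fun (u i) /\ H_superharmonic b q (u i)) ->
      lin_indep u -> (n <= N)%N;

    forall (o : X) (c : R), 0 < c ->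
      exists e : nat -> X -> R,
        null_sequence b q e /\ (forall n, e n o = c);

    exists (v : X -> R) (e : nat -> X -> R),
      [/\ positive_fun v, H_harmonic b q v, null_sequence b q e,
          forall n x, 0 <= e n x <= v x
        & forall x, e n x @[n --> \oo] --> v x];

    forall x, hcap b q x = 0]
  /\
  (h_critical b q ->
     forall u : X -> R, positive_fun u -> H_superharmonic b q u ->
       H_harmonic b q u).
Proof.
have [x0 _] := infinite_setN0 Xinf.
have critP := critical_hcap bgraph hge0.
have all0 x : hcap b q x = 0 -> forall y, hcap b q y = 0 := hcap0_all bgraph bconn hge0 (x := x).
have res x := resolvent_blowup_hcap bgraph bconn hge0 x.
have sem x := semigroup_blowup_hcap bgraph bconn hge0 x.
split; last by move=> crit u; exact: (critical_harmonic bgraph bconn hge0 crit).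
tfae.
- by move=> /critP hc; exists x0, x0; exact: (res x0).1.
- by move=> [x [y /((res x).2)/all0 hc]] z; exact: (res z).1.
- by move=> /(_ x0 x0)/((res x0).2)/all0 hc; exists x0, x0; exact: (sem x0).1.
- by move=> [x [y /((sem x).2)/all0 hc]] z; exact: (sem z).1.
- move=> /(_ x0 x0)/((sem x0).2)/all0/critP crit.
  have [u [up us]] := positive_superharmonic_ex bgraph bconn hge0 x0.
  by exists u; split=> // v; exact: (critical_unique bgraph bconn hge0 crit up us).
- move=> [u [up us uniq_u]]; exists 1%N => -[//|[//|n]] v hv iv.
  have mult i : exists c : R, forall x, v i x = c * u x.
    by have [vp vs] := hv i; exact: uniq_u.
  have [c hc] := choice mult; pose i1 : 'I_n.+2 := inord 1.
  have i10 : (i1 == ord0) = false by rewrite -val_eqE /= inordK.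
  (* The relation [c_1 v_0 - c_0 v_1 = 0] between two multiples of [u], extended by zero;
     independence then forces [c_1 = 0] and [v_1 = 0]. *)
  pose a i : R := if i == ord0 then c i1 else if i == i1 then - c ord0 else 0.
  have a0 x : \sum_i a i * v i x = 0.
    rewrite (bigD1 ord0)//= (bigD1 i1) ?i10//= big1 => [|i /andP[i0 i1']].
      by rewrite /a eqxx i10 eqxx !hc; ring.
    by rewrite /a (negPf i0) (negPf i1') mul0r.
  have c1 : c i1 = 0 by have := iv a a0 ord0; rewrite /a eqxx.
  have [[_ [x vx]] _] := hv i1; exfalso; apply: vx.
  by rewrite hc c1 mul0r.
- move=> [N hN] o c c0; apply: (hcap0_null_sequence bgraph hge0 c0).
  (* One nonzero capacity makes all of them nonzero, and [N + 1] independent functions contradict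
     the bound. *)
  apply: contrapT => co; have hc x : hcap b q x <> 0 by move=> /all0/(_ o).
  have [u [us iu]] := subcritical_lin_indep bgraph bconn hge0 Xinf hc N.+1.
  by have := hN _ _ us iu; rewrite ltnn.
- move=> /(_ x0 1 ltr01)[e [en _]].
  have crit := critP.2 (null_sequence_hcap0 bgraph bconn hge0 en).
  have [v [vp vs]] := positive_superharmonic_ex bgraph bconn hge0 x0.
  have [g [g1 g2 g3]] := null_sequence_below bgraph bconn hge0 vp vs en.
  by exists v, g; split=> //; exact: (critical_harmonic bgraph bconn hge0 crit vp vs).
- by move=> [v [e [_ _ en _ _]]]; exact: (null_sequence_hcap0 bgraph bconn hge0 en).
- by move/critP.
Qed.
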